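(* Let $m\ge2$, $n\ge2$ be integers and consider the partition of the plane $\{(a_1,a_2)\in\mathbb{R}^2\}$ by the lines $a_1x_1+a_2x_2=1$ for all $(x_1,x_2)\in (E_m\times E_n)\setminus\{(0,0)\}$. Every cell of this partition is a generalized $3$-polygon or a generalized $4$-polygon, and the numbers $c_3(m,n)$, $c_4(m,n)$ of such cells are $$c_3(m,n)=f_2(m,n)+4=\frac{3}{2\pi^2}m^2n^2+O(mn^2),\qquad c_4(m,n)=\tfrac12 f_1(m,n)-f_2(m,n)-3=\frac{3}{2\pi^2}m^2n^2+O(mn^2),$$ so that the total number of cells is $$c(m,n)=c_3(m,n)+c_4(m,n)=\tfrac12 f_1(m,n)+1=\frac{3}{\pi^2}m^2n^2+O(mn^2).$$ Moreover, the number of edges $e(m,n)$ and the number of vertices $v(m,n)$ of the partition are $$e(m,n)=f_1(m,n)-\tfrac12 f_2(m,n)-s(m,n)-2=\frac{21}{4\pi^2}m^2n^2+O(mn^2),$$ $$v(m,n)=\tfrac12 f_1(m,n)-\tfrac12 f_2(m,n)-s(m,n)-2=\frac{9}{4\pi^2}m^2n^2+O(mn^2).$$ All asymptotics hold for $m\le n$ with absolute implied constants.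
   Context: $E_k=\{0,1,\dots,k-1\}$. Cells are the connected components (closures of) of the complement of the union of the lines; edges are the (finite or infinite, i.e., rays/segments/lines) pieces into which the lines are cut by intersection points; vertices are intersection points of the lines (points at infinity are not counted). A convex (possibly unbounded) polygon is a generalized $k$-polygon if it can be obtained as the intersection of a polyhedral cone in $\mathbb{R}^3$ with $k$ faces with a plane not containing the cone's apex. For a positive integer $q$, $$f_q(m,n)=\sum_{\substack{-m<i<m,\ -n<j<n\\ \gcd(i,j)=q}}(m-|i|)(n-|j|),$$ the sum over integers $i,j$; $s(m,n)$ is the number of integer pairs $(i,j)$ with $0<i<m$, $0<j<n$, $\gcd(i,j)=1$.
   Formalization: In the definition of generalized k-polygon, the polyhedral cone is additionally required to lie on the side of its apex containing the cutting plane; otherwise k is not determined by the polygon and the counts c_3, c_4 already fail for m=n=2. *)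

(* Defs.v *)
From mathcomp Require Import all_boot all_order all_algebra finmap.
From mathcomp Require Import all_classical all_reals all_analysis.

Set Implicit Arguments.
Unset Strict Implicit.
Unset Printing Implicit Defensive.

Import Order.TTheory GRing.Theory Num.Theory numFieldNormedType.Exports.
Local Open Scope classical_set_scope.
Local Open Scope ring_scope.

(* [fset_set] sends infinite sets to the empty set, so this is the cardinality
   of [A] only together with [finite_set A]. *)
Definition number (T : choiceType) (A : set T) : nat := #|` fset_set A|%fset.

Definition dot (R : realType) (u v : 'rV[R]_3) : R := \sum_(i < 3) u 0 i * v 0 i.

Definition polyhedral_cone (R : realType) (p : 'rV[R]_3) (C : set 'rV[R]_3) :=
  exists U : seq 'rV[R]_3,
    C = [set x | forall u, u \in U -> dot u (x - p) <= 0].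

(* The last clause says that [F] contains three affinely independent points. *)
Definition two_dim_face (R : realType) (C F : set 'rV[R]_3) :=
  exists (u : 'rV[R]_3) (c : R),
    [/\ u != 0,
        (forall x, C x -> dot u x <= c),
        F = C `&` [set x | dot u x = c] &
        exists x y z, [/\ F x, F y, F z & row_free (col_mx (y - x) (z - x))]].

(* [a |-> o + a.1 *: v + a.2 *: w] is an isometry of the plane onto the plane
   P through [o] directed by [v] and [w]; [h] is a normal of P, and P misses
   the apex [p] because [dot h (o - p) != 0].
   The last clause says that the cone lies on the side of its apex that
   contains P, i.e. that each of its rays meets P or is parallel to P: the cone
   is then the closure of the cone spanned by [Q].  Without it the number of
   faces is not determined by [Q]: the quadrant x >= 0, y >= 0 is the section
   by z = 1 of the trihedral cone x, y, z >= 0, but also of the four-faced cone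
   x, y, x + z, y + z >= 0.  In particular, when [Q] has a two-dimensional set
   of directions at infinity, one of the [k] faces is parallel to P. *)
Definition generalized_polygon (R : realType) (k : nat) (Q : set (R * R)) :=
  exists (p : 'rV[R]_3) (C : set 'rV[R]_3) (o v w h : 'rV[R]_3),
    [/\ polyhedral_cone p C /\ (two_dim_face C #= `I_k)%card,
        [/\ dot v v = 1, dot w w = 1 & dot v w = 0],
        [/\ dot h v = 0, dot h w = 0 & 0 < dot h (o - p)],
        Q = [set a | C (o + a.1 *: v + a.2 *: w)] &
        forall x, C x -> 0 <= dot h (x - p)].

Definition line (R : realType) (x : nat * nat) : set (R * R) :=
  [set a | a.1 * x.1%:R + a.2 * x.2%:R = 1].
Arguments line : clear implicits.

Definition lines (R : realType) (m n : nat) : set (set (R * R)) :=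
  [set line R x | x in
    [set x : nat * nat | [/\ (x.1 < m)%N, (x.2 < n)%N & x != (0, 0)%N]]].
Arguments lines : clear implicits.

Definition components (T : topologicalType) (A : set T) : set (set T) :=
  [set connected_component A x | x in A].

Definition cells (R : realType) (m n : nat) : set (set (R * R)) :=
  [set closure K | K in components (~` \bigcup_(L in lines R m n) L)].
Arguments cells : clear implicits.

Definition vertices (R : realType) (m n : nat) : set (R * R) :=
  [set a | exists L L', [/\ lines R m n L, lines R m n L', L <> L', L a & L' a]].
Arguments vertices : clear implicits.

Definition edges (R : realType) (m n : nat) : set (set (R * R)) :=
  \bigcup_(L in lines R m n)
    [set closure K | K in components (L `\` vertices R m n)].
Arguments edges : clear implicits.

Definition num_cells (R : realType) (m n : nat) : nat := number (cells R m n).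
Arguments num_cells : clear implicits.

Definition num_polygons (R : realType) (k m n : nat) : nat :=
  number [set Q | cells R m n Q /\ generalized_polygon k Q].
Arguments num_polygons : clear implicits.

Definition num_edges (R : realType) (m n : nat) : nat := number (edges R m n).
Arguments num_edges : clear implicits.

Definition num_vertices (R : realType) (m n : nat) : nat :=
  number (vertices R m n).
Arguments num_vertices : clear implicits.

Definition open_range (m : nat) : seq int :=
  [seq k.+1%:Z - m%:Z | k <- iota 0 m.*2.-1].

Lemma open_range_uniq m : uniq (open_range m).
Proof. by rewrite map_inj_uniq ?iota_uniq// => i j /addIr []. Qed.

Lemma mem_open_range m i : (i \in open_range m) = (- m%:Z < i < m%:Z).
Proof.
apply/mapP/idP => [[k]|/andP[mi im]].
  rewrite mem_iota add0n => /andP[_ km] ->.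
  rewrite ltrBrDr addNr ltrBlDr -PoszD !ltz_nat /= addnn.
  by rewrite -ltn_predRL.
have : 0 < i + m%:Z by rewrite -ltrBlDr sub0r.
case E : (i + m%:Z) => [[|k]|//] // _; exists k; last by rewrite -E addrK.
rewrite mem_iota add0n /= ltn_predRL -addnn -ltz_nat -E PoszD.
by rewrite ltrD2r.
Qed.

Definition f (q m n : nat) : int :=
  \sum_(i <- open_range m) \sum_(j <- open_range n | gcdz i j == q%:Z)
    (m%:Z - `|i|) * (n%:Z - `|j|).

Definition s (m n : nat) : nat :=
  #|[pred x : 'I_m * 'I_n | [&& (0 < x.1)%N, (0 < x.2)%N & coprime x.1 x.2]]|.

(* g(m,n) = a m^2 n^2 + O(m n^2) for 2 <= m <= n, with an absolute constant. *)
Definition asymptotics (R : realType) (g : nat -> nat -> nat) (a : R) :=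
  exists K : R, forall m n : nat, (2 <= m <= n)%N ->
    `|(g m n)%:R - a * m%:R ^+ 2 * n%:R ^+ 2| <= K * (m%:R * n%:R ^+ 2).

(* Main.v *)
(* Lines are dual to the nonzero points x of the grid G = E_m x E_n, a cell is the
   set B of the points x of G with a.x > 1 for a in the cell, and the line at
   infinity is dual to the origin.

   Counting.  Adding a line creates as many cells as the earlier lines cut pieces
   on it.  Two lines meet the line of x in the same point, or are both parallel to
   it, when their grid points are collinear with x, so the pieces are counted by
   the directions of the points of G seen from x.  If the lines are added in
   lexicographic order, the line of x creates as many cells as there are earlier y
   with y - x primitive; on the complete arrangement it carries as many edges as
   there are y with y - x primitive that either precede x or have 2x - y outside G.

   Shape.  A cell is the section of the cone cut out by the linear inequalities of
   all the points of G, and its number of faces is the number of essential points,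
   those whose inequality alone can be made an equality.  An essential pair
   outside B spans a line tangent to the complement of B, which a lattice argument
   shows to be unique; hence at most two essential points outside B, at most two in
   B by symmetry, and at most four in all.  A cone with two facets only would
   contain a line, which gives the bound three.  Double counting the incidences
   between cells and essential points yields 3 c_3 + 4 c_4 = 2 e + 2 (s + 2), where
   2 (s + 2) counts the cells with an edge at infinity.

   Asymptotics.  Moebius inversion reduces f_q to the sum of mu(d) / d^2, which is
   compared with 6 / pi^2, the remaining terms being bounded by means of
   |sum mu(d) / d| <= 3. *)
Require Import Defs.
From mathcomp Require Import all_boot all_order all_algebra finmap.
From mathcomp Require Import all_classical all_reals all_analysis.
From mathcomp Require Import zify ring lra.

Import Order.TTheory GRing.Theory Num.Theory numFieldNormedType.Exports.
Local Open Scope classical_set_scope.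
Local Open Scope ring_scope.

Set Implicit Arguments.
Unset Strict Implicit.
Unset Printing Implicit Defensive.

(** * Regions of an arrangement *)

(** Connected components are traded for the finite set of sign patterns that the forms [a.x - 1]
    realize; one deletion-restriction lemma over an arbitrary flat set then serves cells, edges and
    directions at infinity. No shape is identified cell by cell: [c_3] and [c_4] are solved from
    [c_3 + c_4 = c] and the incidence count. It suffices that a cell has three or four faces and
    that this number depends on the cell only, which is why the cone is recovered from its section.
    The gcd 2 enters through midpoints: when [y] and [2x - y] are both in G they give one direction
    seen from [x], not two, and with [y - x] primitive the pair [(2x - y, y)] has a difference of
    gcd 2. An error [O(m n^2)] without logarithm leaves no room for trivial estimates. Bounding
    [sum mu(d) / d] termwise costs a factor [log m], and so does bounding by [m] the rounding error
    of the sum of [m - i] over the multiples [i] of [d]; hence the bound 3 for the former and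
    [d / 4] for the latter. *)

Lemma sign_stable (R : realFieldType) (l : seq (R * R)) :
  all (fun p => p.1 != 0) l ->
  exists2 e : R, 0 < e &
    forall t, `|t| <= e -> forall p, p \in l -> 0 < p.1 * (p.1 + t * p.2).
Proof.
elim: l => [_|p l IHl /= /andP[p0 /IHl[e e0 he]]]; first by exists 1.
have p1 : 0 < `|p.1| by rewrite normr_gt0.
have p2 : 0 < 1 + `|p.2| by rewrite ltr_pwDl.
exists (Num.min e (`|p.1| / (1 + `|p.2|))).
  by rewrite lt_min e0 divr_gt0.
move=> t; rewrite le_min => /andP[te tp] q; rewrite inE => /orP[/eqP ->|]; last exact: he.
rewrite ler_pdivlMr// in tp.
have tp2 : `|t * p.2| < `|p.1|.
  rewrite normrM; case: (eqVneq t 0) => [->|t0]; first by rewrite normr0 mul0r.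
  by apply: lt_le_trans tp; rewrite mulrDr mulr1 ltrDr normr_gt0.
rewrite mulrDr -expr2 -real_normK ?num_real// expr2.
rewrite -ltrBlDr sub0r; have := ler_norm (- (p.1 * (t * p.2))).
move=> /le_lt_trans; apply.
by rewrite normrN normrM ltr_pM2l.
Qed.

Lemma sign_between (R : realFieldType) (u v t : R) :
  0 <= t <= 1 -> 0 < u * v -> 0 < u * (u + t * (v - u)).
Proof.
move=> /andP[t0 t1] uv; have u2 : 0 < u ^+ 2.
  by rewrite exprn_even_gt0//=; apply: contraTneq uv => ->; rewrite mul0r ltxx.
have [->|tn0] := eqVneq t 0; first by rewrite mul0r addr0.
have tp : 0 < t by rewrite lt_neqAle eq_sym tn0.
by nra.
Qed.

Definition aff (R : realType) (c : R * R * R) (a : R * R) : R :=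
  a.1 * c.1.1 + a.2 * c.1.2 + c.2.

Definition along (R : realType) (a b : R * R) (t : R) : R * R :=
  (a.1 + t * (b.1 - a.1), a.2 + t * (b.2 - a.2)).

Definition flat (R : realType) (W : set (R * R)) :=
  forall a b t, W a -> W b -> W (along a b t).

Lemma aff_along (R : realType) c (a b : R * R) t :
  aff c (along a b t) = aff c a + t * (aff c b - aff c a).
Proof. by rewrite /aff /along /=; ring. Qed.

Lemma along1 (R : realType) (a b : R * R) : along a b 1 = b.
Proof. by case: a b => [? ?] [? ?]; rewrite /along /=; congr pair; ring. Qed.

Lemma along0 (R : realType) (a b : R * R) : along a b 0 = a.
Proof. by case: a b => [? ?] [? ?]; rewrite /along /=; congr pair; ring. Qed.

Lemma flat_setT (R : realType) : flat [set: R * R].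
Proof. by []. Qed.

Lemma flatI_zero (R : realType) (W : set (R * R)) c :
  flat W -> flat (W `&` [set a | aff c a = 0]).
Proof.
move=> fW a b t [Wa /= a0] [Wb /= b0]; split; first exact: fW.
by rewrite /= aff_along a0 b0; ring.
Qed.

Section Regions.
Variables (R : realType) (I : finType) (w : I -> R * R * R).
Implicit Types (W : set (R * R)) (A B : {set I}) (a b : R * R).

Definition generic A a := [forall i in A, aff (w i) a != 0].

Definition pattern A a : {set I} := [set i in A | 0 < aff (w i) a]%SET.

(** With [W] as a parameter the same finite set describes the cells of the plane, the pieces of a
    line and, for linear forms, the sectors of directions at infinity. *)
Definition regions W A : {set {set I}} :=
  [set B | `[< exists a, [/\ W a, generic A a & B = pattern A a] >]]%SET.

Lemma regionsP W A B :
  reflect (exists a, [/\ W a, generic A a & B = pattern A a]) (B \in regions W A).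
Proof. by rewrite inE; apply: asboolP. Qed.

Lemma genericP A a : reflect (forall i, i \in A -> aff (w i) a != 0) (generic A a).
Proof. exact: 'forall_implyP. Qed.

Lemma genericU1 x A a :
  generic (x |: A) a = (aff (w x) a != 0) && generic A a.
Proof.
apply/genericP/andP => [h|[hx /genericP hA] i].
  split; first by apply: h; rewrite !inE eqxx.
  by apply/genericP => i iA; apply: h; rewrite !inE iA orbT.
by rewrite !inE => /orP[/eqP ->|/hA].
Qed.

Lemma patternU1 x A a : pattern (x |: A) a =
  if 0 < aff (w x) a then x |: pattern A a else (pattern A a :\ x)%SET.
Proof.
apply/setP => i; case: ifP => hx; rewrite !inE.
  by case: (eqVneq i x) => [->|]; rewrite //= hx.
by case: (eqVneq i x) => [->|]; rewrite //= hx.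
Qed.

Lemma pattern_sub A a : pattern A a \subset A.
Proof. by apply/fintype.subsetP => i; rewrite inE => /andP[]. Qed.

Lemma pattern_out x A a : x \notin A -> (pattern A a :\ x)%SET = pattern A a.
Proof.
move=> xA; apply/setP => i; rewrite !inE.
by case: (eqVneq i x) => [->|]; rewrite //= (negbTE xA).
Qed.

Lemma same_pattern A a b :
  (forall i, i \in A -> 0 < aff (w i) a * aff (w i) b) ->
  [/\ generic A a, generic A b & pattern A a = pattern A b].
Proof.
move=> h; split.
- by apply/genericP => i /h; apply: contraTneq => ->; rewrite mul0r ltxx.
- by apply/genericP => i /h; apply: contraTneq => ->; rewrite mulr0 ltxx.
apply/setP => i; rewrite !inE; case: (boolP (i \in A)) => //= /h; nra.
Qed.

Lemma pattern_gt0 A a b i : generic A a -> generic A b ->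
  pattern A a = pattern A b -> i \in A -> 0 < aff (w i) a * aff (w i) b.
Proof.
move=> /genericP ga /genericP gb /setP /(_ i) + iA.
move: (ga _ iA) (gb _ iA); rewrite !inE iA /=.
by case: ltrgt0P => // ha _; case: ltrgt0P => // hb _ _; nra.
Qed.

Lemma perturb W A a b :
  flat W -> W a -> W b -> generic A a ->
  exists2 e : R, 0 < e & forall t, `|t| <= e ->
    [/\ W (along a b t), generic A (along a b t) &
        pattern A (along a b t) = pattern A a].
Proof.
move=> fW Wa Wb /genericP ga.
pose l := [seq (aff (w i) a, aff (w i) b - aff (w i) a) | i <- enum A].
have [|e e0 he] := @sign_stable R l.
  by apply/allP => p /mapP[i]; rewrite mem_enum => /ga ? ->.
exists e => // t /he ht.
have [|_ gt eq_t] := @same_pattern A a (along a b t).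
  move=> i iA; rewrite aff_along; apply: (ht (_, _)).
  by apply/mapP; exists i; rewrite ?mem_enum.
by split; rewrite ?eq_t//; apply: fW.
Qed.

(* Deletion-restriction: a region of [A] splits in two exactly when it meets the
   zero set of [w x]. *)
Lemma regionsU1 W A x : flat W -> x \notin A ->
  (exists2 b, W b & aff (w x) b != 0) ->
  #|regions W (x |: A)| =
    (#|regions W A| + #|regions (W `&` [set a | aff (w x) a = 0%R]) A|)%N.
Proof.
move=> fW xA [b Wb bx].
pose R0 := [set B : {set I} | (x \notin B) && (B \in regions W (x |: A))]%SET.
pose R1 := [set B : {set I} | (x \notin B) && (x |: B \in regions W (x |: A))]%SET.
have outB C B : B = pattern A C -> x \notin B.
  by move=> ->; apply: contra xA; apply/fintype.subsetP/pattern_sub.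
have R0P B : B \in R0 <-> exists a, [/\ W a, generic A a, B = pattern A a & aff (w x) a < 0].
  rewrite inE; split.
    case/andP => xB /regionsP[a [Wa]]; rewrite genericU1 patternU1 => /andP[ax ga].
    case: ltrgt0P ax => // ax _ eB; first by rewrite eB setU11 in xB.
    by exists a; rewrite eB pattern_out.
  case=> a [Wa ga eB ax]; rewrite (outB _ _ eB); apply/regionsP; exists a.
  by rewrite genericU1 patternU1 lt_eqF// ltNge ltW//= pattern_out.
have R1P B : B \in R1 <-> exists a, [/\ W a, generic A a, B = pattern A a & 0 < aff (w x) a].
  rewrite inE; split.
    case/andP => xB /regionsP[a [Wa]]; rewrite genericU1 patternU1 => /andP[ax ga].
    case: ltrgt0P ax => // ax _ eB; last first.
      by have := setU11 x B; rewrite eB !inE eqxx.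
    exists a; split=> //; have := congr1 (fun C => C :\ x)%SET eB.
    by rewrite !setU1K// (outB a).
  case=> a [Wa ga eB ax]; rewrite (outB _ _ eB); apply/regionsP; exists a.
  by rewrite genericU1 patternU1 gt_eqF// ax eB.
have fact (e : R) : 0 < e -> forall u v : R, v != 0 -> u = 0 ->
    exists2 t : R, `|t| <= e & 0 < u + t * (v - u).
  move=> e0 u v v0 ->; exists (Num.sg v * e).
    by rewrite normrM normr_sg v0 mul1r ger0_norm // ltW.
  by rewrite add0r subr0 mulrAC -normrEsg mulr_gt0// normr_gt0.
have fact' (e : R) : 0 < e -> forall u v : R, v != 0 -> u = 0 ->
    exists2 t : R, `|t| <= e & u + t * (v - u) < 0.
  move=> e0 u v v0 u0; have [t te ht] := fact e e0 u v v0 u0.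
  by exists (- t); rewrite ?normrN//; lra.
have -> : #|regions W (x |: A)| = (#|R0| + #|R1|)%N.
  rewrite -(cardsID R0 (regions W (x |: A))); congr (_ + _)%N.
    apply: eq_card => B; rewrite !inE; case: (boolP (x \notin B)) => //=.
      by rewrite andbb.
    by rewrite andbF.
  rewrite -[RHS](@card_in_imset _ _ (fun B : {set I} => x |: B)); last first.
    move=> B C; rewrite !inE => /andP[xB _] /andP[xC _] /(congr1 (fun D => D :\ x)%SET).
    by rewrite !setU1K.
  apply: eq_card => B; apply/idP/imsetP => [/finset.setDP[BR]|[C]].
    rewrite inE BR andbT negbK => xB.
    exists (B :\ x)%SET; last by rewrite finset.setD1K.
    by rewrite inE setD11 finset.setD1K.
  rewrite inE => /andP[xC CR] ->; apply/finset.setDP; split=> //.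
  by rewrite inE setU11.
rewrite -cardsUI; congr (_ + _)%N; apply: eq_card => B.
  apply/finset.setUP/regionsP => [[/R0P|/R1P] [a [Wa ga eB _]]|[a [Wa ga eB]]].
  - by exists a.
  - by exists a.
  case: (ltrgt0P (aff (w x) a)) => ax.
  - by right; apply/R1P; exists a.
  - by left; apply/R0P; exists a.
  have [e e0 he] := perturb fW Wa Wb ga.
  have [t te ht] := fact e e0 _ _ bx ax.
  have [? ? pe] := he _ te.
  by right; apply/R1P; exists (along a b t); rewrite pe aff_along.
apply/finset.setIP/regionsP => [[/R0P[a [Wa ga eB ax]] /R1P[c [Wc gc eC cx]]]|].
  pose t := aff (w x) a / (aff (w x) a - aff (w x) c).
  have d0 : 0 < aff (w x) c - aff (w x) a by lra.
  have t0 : 0 < t < 1.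
    rewrite /t -mulrNN -invrN opprB ltr_pdivlMr// ltr_pdivrMr// mul0r mul1r; lra.
  have [|_ ? pe] := @same_pattern A a (along a c t).
    move=> i iA; rewrite aff_along.
    have uv := pattern_gt0 ga gc (etrans (esym eB) eC) iA.
    by apply: sign_between => //; case/andP: t0 => /ltW -> /ltW ->.
  exists (along a c t); split=> //; last by rewrite -pe.
  split; first exact: fW.
  have d1 : aff (w x) a - aff (w x) c != 0 by rewrite -opprB oppr_eq0 gt_eqF.
  by rewrite /= aff_along /t; field.
case=> a [[Wa /= ax] ga eB].
have [e e0 he] := perturb fW Wa Wb ga.
split.
  have [t te ht] := fact' e e0 _ _ bx ax; have [? ? pe] := he _ te.
  by apply/R0P; exists (along a b t); rewrite pe aff_along.
have [t te ht] := fact e e0 _ _ bx ax; have [? ? pe] := he _ te.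
by apply/R1P; exists (along a b t); rewrite pe aff_along.
Qed.

Lemma regions0 W : W !=set0 -> #|regions W finset.set0| = 1%N.
Proof.
move=> [a Wa]; apply/eqP/cards1P; exists finset.set0; apply/setP => B.
rewrite finset.in_set1; apply/regionsP/eqP => [[c [_ _ ->]]|->].
  by apply/setP => i; rewrite !inE.
exists a; split=> //; first by apply/genericP => i; rewrite inE.
by apply/setP => i; rewrite !inE.
Qed.

Lemma regions_null W A i : i \in A -> (forall a, W a -> aff (w i) a = 0) ->
  #|regions W A| = 0%N.
Proof.
move=> iA h; apply: eq_card0 => B; apply/negbTE/negP => /regionsP[a [Wa /genericP ga _]].
by have := ga _ iA; rewrite h ?eqxx.
Qed.

Lemma regions_point a A : generic A a -> #|regions [set a] A| = 1%N.
Proof.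
move=> ga; apply/eqP/cards1P; exists (pattern A a); apply/setP => B.
rewrite finset.in_set1; apply/regionsP/eqP => [[c [/= -> _ ->//]]|->].
by exists a.
Qed.

Lemma regions_point_null a A : ~~ generic A a -> #|regions [set a] A| = 0%N.
Proof.
move=> ga; apply: eq_card0 => B; apply/negbTE/negP => /regionsP[c [/= -> gc _]].
by rewrite gc in ga.
Qed.

Lemma regions_set0 A : #|regions set0 A| = 0%N.
Proof. by apply: eq_card0 => B; apply/negbTE/negP => /regionsP[c []]. Qed.

(** Deletion-restriction with restrictions reduced to a point or empty: the zero of the removed form
    adds one region if no other form vanishes there, and none otherwise. [V] lists the
    breakpoints. *)
Lemma regions_line W A (V : seq (R * R)) :
  flat W -> (exists a b, [/\ W a, W b & a <> b]) ->
  (forall i a b, i \in A -> W a -> W b -> aff (w i) a = 0 -> aff (w i) b = 0 -> a = b) ->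
  uniq V -> (forall a, a \in V <-> W a /\ exists2 i, i \in A & aff (w i) a = 0) ->
  #|regions W A| = (size V).+1.
Proof.
move=> fW [a0 [b0 [Wa0 Wb0 ab0]]]; move: {2}#|A| (leqnn #|A|) => k.
elim: k A V => [|k IHk] A V.
  rewrite leqn0 cards_eq0 => /eqP -> _ _ hV.
  rewrite regions0; last by exists a0.
  case: V hV => // a V /(_ a); rewrite inE eqxx => -[/(_ isT)[_ [i]]].
  by rewrite inE.
case: (set_0Vmem A) => [->|[x xA]]; first by move=> _; apply: IHk; rewrite cards0.
rewrite -(finset.setD1K xA); set A' := (A :\ x)%SET.
have xA' : x \notin A' by rewrite !inE eqxx.
rewrite cardsU1 xA' => cA' inj uV hV.
have inj' i a b : i \in A' -> W a -> W b -> aff (w i) a = 0 -> aff (w i) b = 0 -> a = b.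
  by move=> iA'; apply: (inj i); rewrite inE iA' orbT.
pose V' := [seq a <- V | [exists i in A', aff (w i) a == 0]].
have hV' a : a \in V' <-> W a /\ exists2 i, i \in A' & aff (w i) a = 0.
  rewrite mem_filter; split.
    by case/andP => /exists_inP[i iA' /eqP ai] /hV[Wa _]; split=> //; exists i.
  case=> Wa [i iA' ai]; apply/andP; split; first by apply/exists_inP; exists i => //; apply/eqP.
  by apply/hV; split=> //; exists i => //; rewrite inE iA' orbT.
rewrite regionsU1// ?(IHk A' V') ?filter_uniq//; last first.
  have [ax|ax] := eqVneq (aff (w x) a0) 0; last by exists a0.
  have [bx|bx] := eqVneq (aff (w x) b0) 0; last by exists b0.
  by case: ab0; apply: (inj x) => //; rewrite setU11.
have eqV : (forall a, W a -> aff (w x) a = 0 -> ~~ generic A' a) -> V' = V.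
  move=> h; apply/all_filterP/allP => a /hV[Wa [i]].
  rewrite inE finset.in_set1 => /orP[/eqP -> ax|iA' ai]; last by apply/exists_inP; exists i => //; apply/eqP.
  apply: contraNT (h a Wa ax) => /exists_inPn na.
  by apply/genericP.
have [[r Wr rx]|nor] := pselect (exists2 r, W r & aff (w x) r = 0); last first.
  rewrite (_ : W `&` _ = set0) ?regions_set0 ?addn0 ?eqV//.
    by move=> a Wa ax; case: nor; exists a.
  by apply/seteqP; split => // a [Wa ax]; apply: nor; exists a.
rewrite (_ : W `&` _ = [set r]); last first.
  apply/seteqP; split => [a [Wa ax]|a -> //].
  by apply: (inj x) => //; rewrite setU11.
have [gr|gr] := boolP (generic A' r); last first.
  rewrite regions_point_null// addn0 eqV// => a Wa ax.
  by rewrite (inj x a r)// setU11.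
rewrite regions_point// addn1; congr S.
suff /perm_size : perm_eq (r :: V') V by [].
apply: uniq_perm => //=.
  rewrite filter_uniq// andbT mem_filter negb_and; apply/orP; left.
  by apply/exists_inPn; apply/genericP.
move=> a; rewrite inE; apply/orP/idP => [[/eqP ->|]|].
- by apply/hV; split=> //; exists x; rewrite ?setU11.
- by rewrite mem_filter => /andP[].
move=> aV; have /hV[Wa [i]] := aV.
rewrite inE finset.in_set1 => /orP[/eqP -> ax|iA' ai].
  by left; rewrite (inj x a r)// setU11.
by right; apply/hV'; split=> //; exists i.
Qed.

End Regions.

(** * Regions and connected components *)

Lemma continuous_aff (R : realType) c : continuous (@aff R c).
Proof.
move=> a; rewrite /aff.
apply: cvgD; last exact: cvg_cst.
by apply: cvgD; apply: cvgM; [exact: cvg_fst|exact: cvg_cst|exact: cvg_snd|exact: cvg_cst].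
Qed.

Lemma continuous_along (R : realType) (a b : R * R) : continuous (along a b).
Proof.
have cont (u v : R) : continuous (fun t : R => u + t * v).
  by move=> t; apply: cvgD; [exact: cvg_cst|apply: cvgM; [exact: cvg_id|exact: cvg_cst]].
by move=> t; exact: (cvg_pair (F:=nbhs t) (G:=nbhs (a.1 + t * (b.1 - a.1))) (H:=nbhs (a.2 + t * (b.2 - a.2))) (cont _ _ t) (cont _ _ t)).
Qed.

Lemma weak_sign (R : realFieldType) (u v : R) : 0 < u * v ->
  if 0 < v then 0 <= u else u <= 0.
Proof.
case: (ltrgt0P v) => h; last by rewrite h mulr0 ltxx.
  by rewrite pmulr_lgt0// => /ltW.
by rewrite nmulr_lgt0// => /ltW.
Qed.

Lemma weak_sign_gt0 (R : realFieldType) (u v : R) : u != 0 -> v != 0 ->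
  (if 0 < v then 0 <= u else u <= 0) -> 0 < u * v.
Proof.
move=> u0; case: (ltrgt0P v) => // hv _ h.
  by rewrite pmulr_lgt0// lt_neqAle eq_sym u0.
by rewrite nmulr_lgt0// lt_neqAle u0.
Qed.

Lemma weak_sign_between (R : realFieldType) (u v t : R) : 0 < t <= 1 -> v != 0 ->
  (if 0 < v then 0 <= u else u <= 0) -> 0 < (u + t * (v - u)) * v.
Proof.
move=> /andP[t0 t1] v0 h; have v2 : 0 < v ^+ 2 by rewrite exprn_even_gt0.
have uv : 0 <= u * v.
  case: (ltrP 0 v) h => ? ?; first by rewrite mulr_ge0// ltW.
  by rewrite mulr_le0.
have -> : (u + t * (v - u)) * v = (1 - t) * (u * v) + t * v ^+ 2 by ring.
by apply: ltr_wpDl; [rewrite mulr_ge0// subr_ge0|exact: mulr_gt0].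
Qed.

Section Topology.
Variables (R : realType) (I : finType) (w : I -> R * R * R).
Implicit Types (W : set (R * R)) (A B : {set I}) (a b : R * R).

Definition closed_region W A B : set (R * R) :=
  [set b | W b /\ forall i, i \in A ->
    if i \in B then 0 <= aff (w i) b else aff (w i) b <= 0].

(** A form that changes sign on a connected set vanishes on it; conversely, the segment between two
    points of equal pattern avoids all zero sets. *)
Lemma component_region W A a : flat W -> W a -> generic w A a ->
  connected_component (W `&` [set b | generic w A b]) a =
  W `&` [set b | generic w A b /\ pattern w A b = pattern w A a].
Proof.
move=> fW Wa ga; apply/seteqP; split => [b [C [Ca CW cC] Cb]|b [Wb [gb eb]]].
  have [Wb gb] := CW _ Cb; split=> //; split=> //.
  have [//|_ _ ->//] := @same_pattern _ _ w A b a.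
  move=> i iA; rewrite ltNge; apply/negP => hi.
  have /connected_intervalP iv : connected (aff (w i) @` C).
    apply: connected_continuous_connected => //.
    exact/continuous_subspaceT/continuous_aff.
  have : (aff (w i) @` C) 0.
    have := genericP _ _ _ ga i iA; case: ltrgt0P => // h _.
      apply: (iv (aff (w i) b) (aff (w i) a)); [by exists b|by exists a|].
      by rewrite (ltW h) andbT -(pmulr_lle0 _ h).
    apply: (iv (aff (w i) a) (aff (w i) b)); [by exists a|by exists b|].
    by rewrite (ltW h) /= -(nmulr_lle0 _ h).
  case=> c Cc c0; have [_ /= /genericP /(_ i iA)] := CW _ Cc.
  by rewrite c0 eqxx.
exists (along a b @` `[0, 1]); last first.
  by exists 1; rewrite ?along1//= in_itv /= ler01 lexx.
split.
- by exists 0; rewrite ?along0//= in_itv /= ler01 lexx.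
- move=> c [t /=]; rewrite in_itv /= => t01 <-; split; first exact: fW.
  have [|//] := @same_pattern _ _ w A (along a b t) a.
  move=> i iA; rewrite aff_along.
  have uv := pattern_gt0 ga gb (esym eb) iA.
  by rewrite mulrC; apply: sign_between.
- apply: connected_continuous_connected; first exact: segment_connected.
  exact/continuous_subspaceT/continuous_along.
Qed.

(** A point that satisfies the weak inequalities is approached along the segment towards the generic
    point [a], on which they become strict at once. *)
Lemma closure_region W A a : flat W -> closed W -> W a -> generic w A a ->
  closure (W `&` [set b | generic w A b /\ pattern w A b = pattern w A a]) =
  closed_region W A (pattern w A a).
Proof.
move=> fW cW Wa ga; apply/seteqP; split.
  have cK : closed (closed_region W A (pattern w A a)).
    have -> : closed_region W A (pattern w A a) = W `&` \bigcap_(i in [set` A])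
        (if i \in pattern w A a then aff (w i) @^-1` [set x | 0 <= x]
         else aff (w i) @^-1` [set x | x <= 0]).
      apply/seteqP; split => b [Wb h]; split=> //.
        by move=> i /= iA; have := h i iA; case: ifP.
      by move=> i iA; have := h i iA; case: ifP.
    apply: closedI => //; apply: closed_bigI => i _.
    case: ifP => _; apply: closed_comp; [|exact: closed_ge| |exact: closed_le];
      by move=> x _; exact: continuous_aff.
  rewrite [X in _ `<=` X](closure_id _).1//; apply: closure_subset => b [Wb [gb eb]].
  split=> // i iA; have := weak_sign (pattern_gt0 gb ga eb iA).
  by rewrite !inE iA /=.
move=> b [Wb hb] N Nb.
have := @continuous_along R b a 0.
rewrite /continuous_at along0 => /(_ _ Nb) /nbhs_ballP[e /= e0 he].
pose t := Num.min (e / 2) (1 / 2).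
have t0 : 0 < t by rewrite lt_min !divr_gt0.
have t1 : t <= 1 / 2 by rewrite ge_min lexx orbT.
have te : t < e by rewrite /t gt_min ltr_pdivrMr// ltr_pMr// ltr1n.
exists (along b a t); split; last first.
  by apply: he; rewrite -ball_normE /= sub0r normrN gtr0_norm.
split; first exact: fW.
have [|gt _ et] := @same_pattern _ _ w A (along b a t) a; last by [].
move=> i iA; rewrite aff_along; apply: weak_sign_between.
- by rewrite t0 (le_trans t1)// ler_pdivrMr// mul1r ler1n.
- by move/genericP: ga; apply.
- by have := hb i iA; rewrite !inE iA /=.
Qed.

(** At a generic point a weak inequality is strict, so a point of one region that lies in the
    closure of another has the pattern of both. Counting closures is thus counting patterns. *)
Lemma closed_region_inj W A : {in regions w W A &, injective (closed_region W A)}.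
Proof.
move=> B C /regionsP[a [Wa ga ->]] /regionsP[b [Wb gb ->]] e.
have [//|_ _ ->//] := @same_pattern _ _ w A a b.
move=> i iA.
have [_ /(_ i iA)] : closed_region W A (pattern w A b) a.
  rewrite -e; split=> // j jA; rewrite !inE jA /=.
  by case: ltrgt0P.
rewrite !inE iA /=; apply: weak_sign_gt0; first by move/genericP: ga; apply.
by move/genericP: gb; apply.
Qed.

Lemma closures_of_components W A : flat W -> closed W ->
  [set closure K | K in components (W `&` [set b | generic w A b])] =
  [set closed_region W A B | B in [set` regions w W A]].
Proof.
move=> fW cW; apply/seteqP; split => [_ [_ [a [Wa ga] <-] <-]|_ [B /= /regionsP[a [Wa ga ->]] <-]].
  rewrite component_region// closure_region//.
  by exists (pattern w A a) => //=; apply/regionsP; exists a.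
exists (connected_component (W `&` [set b | generic w A b]) a); first by exists a.
by rewrite component_region// closure_region.
Qed.

End Topology.

Lemma number_image (S : finType) (T : choiceType) (F : S -> T) (A : {set S}) :
  {in A &, injective F} ->
  finite_set [set F x | x in [set` A]] /\ Defs.number [set F x | x in [set` A]] = #|A|.
Proof.
move=> injF.
have fA : finite_set [set` A] by exact: finite_finset.
split; first exact: finite_image.
rewrite /Defs.number fset_set_image// card_in_imfset /=; last first.
  by move=> x y; rewrite !in_fset_set// !inE; apply: injF.
have -> : [set` A] = [set` [fset x in A]%fset].
  by apply/seteqP; split=> x /=; rewrite !inE.
by rewrite set_fsetK card_imfset//= cardE.
Qed.

(** * Uniqueness of the tangent line *)

Definition in_box (b : int * int * int * int) (x y : int) :=
  let: (A, B, C, D) := b in [&& A <= x, x <= B, C <= y & y <= D].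

(* If (q, -p) or (-q', p') were in the box, the two linear forms would have
   different signs there; but the two segments and the origin are in the box, which
   forces [v1] and [u1] to be negative, and then (-q', p') is in the box. *)
Lemma no_two_tangents_acute (b : int * int * int * int)
    (p q p' q' v1 v2 u1 u2 : int) :
  in_box b 0 0 -> 0 < p -> 0 <= q -> 0 < p * q' - p' * q ->
  (forall x y, in_box b x y -> (0 <= p * x + q * y) = (0 <= p' * x + q' * y)) ->
  in_box b v1 v2 -> in_box b (v1 + q) (v2 - p) -> p * v1 + q * v2 = -1 ->
  in_box b u1 u2 -> in_box b (u1 - q') (u2 + p') -> p' * u1 + q' * u2 = -1 ->
  False.
Proof.
case: b => [[[A B] C] D] O p0 q0 det P Iv Ivd ev Iu Iud eu.
have nd : ~~ in_box (A, B, C, D) q (- p).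
  apply/negP => /P; rewrite (_ : p * q + _ = 0); last by ring.
  by rewrite lexx => /esym; lia.
have nd' : ~~ in_box (A, B, C, D) (- q') p'.
  apply/negP => /P; rewrite (_ : p' * - q' + _ = 0); last by ring.
  by rewrite lexx => ?; lia.
have nv : p' * v1 + q' * v2 <= -1 by have := P _ _ Iv; rewrite ev; lia.
have nu : p * u1 + q * u2 <= -1 by have := P _ _ Iu; rewrite eu; lia.
have v1neg : v1 <= -1.
  rewrite leNgt; apply/negP => v1pos.
  have v2neg : v2 <= -1 by nia.
  move: nd Iv Ivd O; rewrite /in_box; lia.
have dv1 : (p * q' - p' * q) * v1 >= q - q'.
  have -> : (p * q' - p' * q) * v1 =
    q' * (p * v1 + q * v2) - q * (p' * v1 + q' * v2) by ring.
  rewrite ev; have := ler_wpM2l q0 nv; lia.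
have q'0 : q < q'.
  have : (p * q' - p' * q) * v1 <= (p * q' - p' * q) * -1 by rewrite ler_pM2l.
  by lia.
have du1 : (p * q' - p' * q) * u1 <= q - q'.
  have -> : (p * q' - p' * q) * u1 =
    q' * (p * u1 + q * u2) - q * (p' * u1 + q' * u2) by ring.
  have q'1 : 0 <= q' by lia.
  rewrite eu; have := ler_wpM2l q'1 nu; lia.
have u1neg : u1 <= -1.
  by rewrite -ltzD1 addNr -(pmulr_rlt0 _ det); lia.
have [p'0|p'0] := lerP p' 0.
  have u2neg : u2 <= -1 by nia.
  by move: nd' Iu Iud O; rewrite /in_box; lia.
have u2pos : 0 <= u2 by nia.
by move: nd' Iu Iud O; rewrite /in_box; lia.
Qed.

(** The hypotheses of [no_two_tangents_acute] without the position of [(p, q)] and the sign of the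
    determinant, packed so as to be carried through quarter turns. *)
Definition two_tangents (b : int * int * int * int) (p q p' q' : int) :=
  [/\ in_box b 0 0,
      forall x y, in_box b x y -> (0 <= p * x + q * y) = (0 <= p' * x + q' * y),
      exists v1 v2, [/\ in_box b v1 v2, in_box b (v1 + q) (v2 - p) &
                        p * v1 + q * v2 = -1] &
      exists u1 u2, [/\ in_box b u1 u2, in_box b (u1 - q') (u2 + p') &
                        p' * u1 + q' * u2 = -1]].

Lemma two_tangents_rot A B C D p q p' q' :
  two_tangents (A, B, C, D) p q p' q' ->
  two_tangents (C, D, - B, - A) q (- p) q' (- p').
Proof.
have box x y : in_box (C, D, - B, - A) x y = in_box (A, B, C, D) (- y) x.
  by rewrite /in_box; lia.
case=> O P [v1 [v2 [Iv Ivd ev]]] [u1 [u2 [Iu Iud eu]]]; split.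
- by rewrite box oppr0.
- by move=> x y; rewrite box => /P; rewrite !mulrN !mulNr !(addrC (- _)).
- exists v2, (- v1); split; rewrite ?box ?opprK//; last by lia.
  by rewrite opprD !opprK.
exists u2, (- u1); split; rewrite ?box ?opprK//; last by lia.
by rewrite opprD !opprK.
Qed.

(** A positive determinant makes [(p, q)] nonzero, and one of the four quarter turns then brings it
    to [0 < p], [0 <= q]. *)
Lemma no_two_tangents b p q p' q' :
  0 < p * q' - p' * q -> ~ two_tangents b p q p' q'.
Proof.
have acute b0 p0 q0 p0' q0' : 0 < p0 -> 0 <= q0 -> 0 < p0 * q0' - p0' * q0 ->
    ~ two_tangents b0 p0 q0 p0' q0'.
  move=> p_gt0 q_ge0 det [I0 P [v1 [v2 [Iv Ivd ev]]] [u1 [u2 [Iu Iud eu]]]].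
  exact: (no_two_tangents_acute I0 p_gt0 q_ge0 det P Iv Ivd ev Iu Iud eu).
case: b => [[[A B] C] D] det T.
have T1 := two_tangents_rot T; have T2 := two_tangents_rot T1.
have T3 := two_tangents_rot T2.
have [p0|p0|p0] := ltrgt0P p.
- have [q0|q0] := leP 0 q; first by apply: (acute _ _ _ _ _ p0 q0 det T).
  by apply: (acute _ _ _ _ _ _ _ _ T3); lia.
- have [q0|q0] := ltP 0 q; first by apply: (acute _ _ _ _ _ _ _ _ T1); lia.
  by apply: (acute _ _ _ _ _ _ _ _ T2); lia.
have [q0|q0] := ltP 0 q; first by apply: (acute _ _ _ _ _ _ _ _ T1); lia.
have q1 : q != 0 by apply: contraTneq det => ->; rewrite p0 mul0r mulr0 subrr ltxx.
by apply: (acute _ _ _ _ _ _ _ _ T3); lia.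
Qed.

(** The weights [1], [j], [H - 1 - j] are nonnegative with sum [H]: this is a convex combination
    with its denominator cleared. *)
Lemma le_conv3 (H j lo x a b c : int) : 0 <= j -> j < H ->
  H * x = a + j * b + (H - 1 - j) * c -> lo <= a -> lo <= b -> lo <= c -> lo <= x.
Proof.
move=> j0 jH e la lb lc; have H0 : 0 < H by lia.
rewrite -(ler_pM2l H0) e.
have h1 : j * lo <= j * b by rewrite ler_wpM2l.
have h2 : (H - 1 - j) * lo <= (H - 1 - j) * c by rewrite ler_wpM2l//; lia.
by lia.
Qed.

Lemma conv3_le (H j hi x a b c : int) : 0 <= j -> j < H ->
  H * x = a + j * b + (H - 1 - j) * c -> a <= hi -> b <= hi -> c <= hi -> x <= hi.
Proof.
move=> j0 jH e la lb lc; rewrite -lerN2.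
by apply: (@le_conv3 H j _ _ (- a) (- b) (- c)); rewrite ?lerN2//; lia.
Qed.

Lemma in_box_conv3 b (H j x y a1 b1 c1 a2 b2 c2 : int) : 0 <= j -> j < H ->
  H * x = a1 + j * b1 + (H - 1 - j) * c1 ->
  H * y = a2 + j * b2 + (H - 1 - j) * c2 ->
  in_box b a1 a2 -> in_box b b1 b2 -> in_box b c1 c2 -> in_box b x y.
Proof.
case: b => [[[A B] C] D] j0 jH ex ey.
move=> /and4P[? ? ? ?] /and4P[? ? ? ?] /and4P[? ? ? ?].
apply/and4P; split.
- exact: le_conv3 ex _ _ _.
- exact: conv3_le ex _ _ _.
- exact: le_conv3 ey _ _ _.
- exact: conv3_le ey _ _ _.
Qed.

(* The triangle on a primitive segment of the line [p x + q y = r] and a lattice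
   point above that line contains a lattice point on the next lattice line. *)
Lemma next_line_point b (p q r z1 z2 o1 o2 : int) : coprimez p q ->
  in_box b z1 z2 -> in_box b (z1 + q) (z2 - p) -> in_box b o1 o2 ->
  p * z1 + q * z2 = r -> r < p * o1 + q * o2 ->
  exists x y, [/\ in_box b x y, p * x + q * y = r + 1 &
    forall p' q' r', p' * z1 + q' * z2 <= r' ->
      p' * (z1 + q) + q' * (z2 - p) <= r' ->
      r' < p' * x + q' * y -> p' * x + q' * y <= p' * o1 + q' * o2].
Proof.
move=> /coprimezP[[u v] /= uv] Iz Izd Io ez oz.
pose H := p * o1 + q * o2 - r; have H0 : 0 < H by lia.
pose k := v * (o1 - z1) - u * (o2 - z2).
(* With [d = (q, -p)], the points [(o + j (z + d) + (H - 1 - j) z) / H] for [0 <= j < H] lie in the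
   triangle on the next lattice line, [d / H] apart, so exactly one of them is a lattice point; the
   residue of [- k] selects it. *)
pose j := (- k %% H)%Z; pose t := (- k %/ H)%Z.
have ek : - k = t * H + j by exact: divz_eq.
have j0 : 0 <= j by rewrite modz_ge0// gt_eqF.
have jH : j < H by rewrite ltz_pmod.
pose x := z1 + (u - t * q); pose y := z2 + (v + t * p).
have HE : H = p * (o1 - z1) + q * (o2 - z2) by rewrite /H -ez; ring.
have ex : H * x = o1 + j * (z1 + q) + (H - 1 - j) * z1.
  have -> : j = - k - t * H by lia.
  suff : H * u + k * q = o1 - z1 by rewrite /x; move: (H) (k) (t) => H1 k1 t1 e; lia.
  rewrite -[RHS]mulr1 -uv HE /k; ring.
have ey : H * y = o2 + j * (z2 - p) + (H - 1 - j) * z2.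
  have -> : j = - k - t * H by lia.
  suff : H * v - k * p = o2 - z2 by rewrite /y; move: (H) (k) (t) => H1 k1 t1 e; lia.
  rewrite -[RHS]mulr1 -uv HE /k; ring.
exists x, y; split.
- exact: in_box_conv3 ex ey _ _ _.
- by rewrite -ez /x /y -uv; ring.
move=> p' q' r' hz hzd hxy.
have e : H * (p' * x + q' * y) = (p' * o1 + q' * o2) +
    j * (p' * (z1 + q) + q' * (z2 - p)) + (H - 1 - j) * (p' * z1 + q' * z2).
  by rewrite mulrDr mulrCA [H * (q' * y)]mulrCA ex ey; ring.
rewrite leNgt; apply/negP => h.
set X := p' * x + q' * y in e h hxy *.
have : X <= X - 1; last by lia.
by apply: conv3_le e _ _ _ => //; lia.
Qed.

(** A primitive segment inside the box is required because it serves as the base of the triangles in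
    [next_line_point]. *)
Definition tangent b (p q r : int) :=
  coprimez p q /\ exists z1 z2,
    [/\ in_box b z1 z2, in_box b (z1 + q) (z2 - p) & p * z1 + q * z2 = r].

(* Two applications of [next_line_point] give a common point at height one above
   both lines; translated there, the two forms satisfy [no_two_tangents]. *)
Lemma tangent_unique b p q r p' q' r' o1 o2 :
  tangent b p q r -> tangent b p' q' r' ->
  (forall x y, in_box b x y -> (r < p * x + q * y) = (r' < p' * x + q' * y)) ->
  in_box b o1 o2 -> r < p * o1 + q * o2 ->
  [/\ p = p', q = q' & r = r'].
Proof.
move=> [cpq [z1 [z2 [Iz Izd ez]]]] [cpq' [y1 [y2 [Iy Iyd ey]]]] same.
have zle : p' * z1 + q' * z2 <= r' by rewrite leNgt -same// ez ltxx.
have yle : p * y1 + q * y2 <= r by rewrite leNgt same// ey ltxx.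
have ydle : p * (y1 + q') + q * (y2 - p') <= r.
  rewrite leNgt same// (_ : p' * _ + _ = r') ?ltxx//.
  by rewrite -ey; ring.
move=> Io ho.
have [a1 [a2 [Ia ea _]]] := next_line_point cpq Iz Izd Io ez ho.
have ha : r' < p' * a1 + q' * a2 by rewrite -same// ea ltrDl.
have [c1 [c2 [Ic ec hc]]] := next_line_point cpq' Iy Iyd Ia ey ha.
have {}ea : p * c1 + q * c2 = r + 1.
  have hc' : r < p * c1 + q * c2 by rewrite same// ec ltrDl.
  by have := hc p q r yle ydle hc'; rewrite ea; lia.
case: b Iz Izd Iy Iyd Io Ia Ic same => [[[A B] C] D] Iz Izd Iy Iyd _ _ Ic same.
pose b := (A - c1, B - c1, C - c2, D - c2).
have bE x y : in_box b x y = in_box (A, B, C, D) (x + c1) (y + c2).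
  by rewrite /in_box /b; lia.
have bE' x y : in_box b (x - c1) (y - c2) = in_box (A, B, C, D) x y.
  by rewrite bE !subrK.
have P x y : in_box b x y -> (0 <= p * x + q * y) = (0 <= p' * x + q' * y).
  rewrite bE => /same.
  rewrite (_ : p * _ + _ = p * x + q * y + (p * c1 + q * c2)); last by ring.
  rewrite (_ : p' * _ + _ = p' * x + q' * y + (p' * c1 + q' * c2)); last by ring.
  by rewrite ea ec; lia.
have I0 : in_box b 0 0 by rewrite bE !add0r.
have Iv : in_box b (z1 - c1) (z2 - c2) by rewrite bE'.
have Ivd : in_box b (z1 - c1 + q) (z2 - c2 - p) by rewrite addrAC (addrAC z2) bE'.
have Iu : in_box b (y1 - c1) (y2 - c2) by rewrite bE'.
have Iud : in_box b (y1 - c1 + q') (y2 - c2 - p') by rewrite addrAC (addrAC y2) bE'.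
have ev : p * (z1 - c1) + q * (z2 - c2) = -1 by lia.
have eu : p' * (y1 - c1) + q' * (y2 - c2) = -1 by lia.
have [det|det|det] := ltrgt0P (p * q' - p' * q).
- case: (no_two_tangents det (b := b)); split=> //.
    by exists (z1 - c1), (z2 - c2).
  exists (y1 - c1 + q'), (y2 - c2 - p'); split; rewrite ?addrK ?subrK//.
  by rewrite -eu; ring.
- have det' : 0 < p' * q - p * q' by lia.
  case: (no_two_tangents det' (b := b)); split=> //.
  + by move=> x y /P.
  + by exists (y1 - c1), (y2 - c2).
  exists (z1 - c1 + q), (z2 - c2 - p); split; rewrite ?addrK ?subrK//.
  by rewrite -ev; ring.
have /coprimezP[[u v] /= uv] := cpq; have /coprimezP[[u' v'] /= uv'] := cpq'.
pose k := p * u' + q * v'.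
have pk : p = k * p'.
  transitivity (p * (u' * p' + v' * q')); first by rewrite uv' mulr1.
  have -> : p * (u' * p' + v' * q') = k * p' + v' * (p * q' - p' * q).
    by rewrite /k; ring.
  by rewrite det mulr0 addr0.
have qk : q = k * q'.
  transitivity (q * (u' * p' + v' * q')); first by rewrite uv' mulr1.
  have -> : q * (u' * p' + v' * q') = k * q' - u' * (p * q' - p' * q).
    by rewrite /k; ring.
  by rewrite det mulr0 subr0.
have k1 : k * (u * p' + v * q') = 1.
  by rewrite mulrDr mulrCA -pk mulrCA -qk.
have {k1} [k1|k1] : k = 1 \/ k = -1.
  have := congr1 absz k1; rewrite abszM => /eqP; rewrite muln_eq1 => /andP[/eqP ? _].
  by lia.
  have ep : p = p' by rewrite pk k1 mul1r.
  have eq : q = q' by rewrite qk k1 mul1r.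
  by split=> //; apply: (addIr 1); rewrite -ea -ec ep eq.
have := P _ _ Iv; rewrite ev.
have -> : p' * (z1 - c1) + q' * (z2 - c2) = 1 by rewrite -[RHS]opprK -ev pk qk k1; ring.
by [].
Qed.

(** * Essential points of a region *)

Section Essential.
Variables (R : realType) (m n : nat).
Local Notation G := ('I_m * 'I_n)%type.
Implicit Types (y : R * R * R) (x z : G) (B : {set G}).

(* A point a of the plane is (a.1, a.2, 1); homogeneous coordinates [y] with last
   entry 0 are points at infinity, where the origin of the grid vanishes. *)
Definition hom y x : R := y.1.1 * x.1%:R + y.1.2 * x.2%:R - y.2.

Definition essential B x := exists2 y, hom y x = 0 &
  forall z, z != x -> if z \in B then 0 < hom y z else hom y z < 0.

Definition grid_box : int * int * int * int := (0, m%:Z - 1, 0, n%:Z - 1).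

Lemma grid_boxP x : in_box grid_box x.1%:Z x.2%:Z.
Proof. by rewrite /in_box /=; case: x => [[x ?] [y ?]] /=; lia. Qed.

Lemma grid_boxE (a b : int) : in_box grid_box a b ->
  exists x : G, a = x.1%:Z /\ b = x.2%:Z.
Proof.
case: a => a; case: b => b; rewrite /in_box /=; try lia.
move=> h; have ha : (a < m)%N by lia.
have hb : (b < n)%N by lia.
by exists (Ordinal ha, Ordinal hb).
Qed.

Lemma homB y x z : hom y x - hom y z =
  y.1.1 * (x.1%:Z - z.1%:Z)%:~R + y.1.2 * (x.2%:Z - z.2%:Z)%:~R.
Proof. by rewrite /hom !intrB -!pmulrn; ring. Qed.

(** A real form that vanishes at two lattice points is a multiple [k] of a primitive integer form,
    and the sign of [k] orients it; the point [b] of [B] excludes [k = 0]. *)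
Lemma tangent_of_real B (g1 g2 : R) z z' b :
  let g x := g1 * (x.1%:Z - z.1%:Z)%:~R + g2 * (x.2%:Z - z.2%:Z)%:~R in
  z' != z -> g z' = 0 -> (forall x, if x \in B then 0 < g x else g x <= 0) -> b \in B ->
  exists p q r, [/\ tangent grid_box p q r, p * z.1%:Z + q * z.2%:Z = r &
    forall x, (x \in B) = (r < p * x.1%:Z + q * x.2%:Z)].
Proof.
move=> g zz' gz' gB bB.
pose e1 := z'.1%:Z - z.1%:Z; pose e2 := z'.2%:Z - z.2%:Z.
pose c := gcdz e1 e2.
have c0 : 0 < c.
  rewrite lt_neqAle le0z_nat andbT eq_sym gcdz_eq0; apply: contra zz' => /andP[/eqP h1 /eqP h2].
  move: h1 h2; rewrite /e1 /e2 -pair_eqE /pair_eq /= -!val_eqE /=; lia.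
pose d1 := (e1 %/ c)%Z; pose d2 := (e2 %/ c)%Z.
have E1 : e1 = d1 * c by rewrite divzK// dvdz_gcdl.
have E2 : e2 = d2 * c by rewrite divzK// dvdz_gcdr.
have /coprimezP[[u v] /= uv] : coprimez d1 d2.
  apply/eqP/(mulIf (lt0r_neq0 c0)).
  by rewrite mul1r -[X in _ * X](gez0_abs (ltW c0)) mulz_gcdl -E1 -E2.
have Izd : in_box grid_box (z.1%:Z + d1) (z.2%:Z + d2).
  apply: (@in_box_conv3 _ c 0 _ _ z'.1%:Z z'.1%:Z z.1%:Z z'.2%:Z z'.2%:Z z.2%:Z);
    rewrite ?grid_boxP//; move: E1 E2; rewrite /e1 /e2; lia.
have cr : (c%:~R : R) != 0 by rewrite intr_eq0 gt_eqF.
have gd : g1 * d1%:~R + g2 * d2%:~R = 0.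
  apply: (mulIf cr); rewrite mul0r mulrDl -!mulrA -!intrM -E1 -E2; exact: gz'.
pose k := g1 * v%:~R - g2 * u%:~R.
have uvR : u%:~R * d1%:~R + v%:~R * d2%:~R = 1 :> R by rewrite -!intrM -intrD uv.
have G1 : g1 = k * d2%:~R.
  transitivity (g1 * (u%:~R * d1%:~R + v%:~R * d2%:~R)); first by rewrite uvR mulr1.
  transitivity (k * d2%:~R + u%:~R * (g1 * d1%:~R + g2 * d2%:~R)); first by rewrite /k; ring.
  by rewrite gd mulr0 addr0.
have G2 : g2 = - k * d1%:~R.
  transitivity (g2 * (u%:~R * d1%:~R + v%:~R * d2%:~R)); first by rewrite uvR mulr1.
  transitivity (- k * d1%:~R + v%:~R * (g1 * d1%:~R + g2 * d2%:~R)); first by rewrite /k; ring.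
  by rewrite gd mulr0 addr0.
have gE x : g x = k * (d2 * (x.1%:Z - z.1%:Z) - d1 * (x.2%:Z - z.2%:Z))%:~R.
  by rewrite /g G1 G2 [in RHS]intrB !intrM; ring.
have BE x : (x \in B) = (0 < g x).
  by have := gB x; case: ifP => _ h; rewrite ?h// ltNge h.
have [k0|k0|k0] := ltrgt0P k.
- exists d2, (- d1), (d2 * z.1%:Z - d1 * z.2%:Z); split; first split.
  + by apply/coprimezP; exists (v, - u) => /=; rewrite -uv; ring.
  + exists (z.1%:Z + d1), (z.2%:Z + d2); split => //; last by ring.
    by rewrite !addrK grid_boxP.
  + by ring.
  + by move=> x; rewrite BE gE pmulr_rgt0// ltr0z; lia.
- exists (- d2), d1, (d1 * z.2%:Z - d2 * z.1%:Z); split; first split.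
  + by apply/coprimezP; exists (- v, u) => /=; rewrite -uv; ring.
  + exists z.1%:Z, z.2%:Z; split; rewrite ?opprK ?grid_boxP//; by ring.
  + by ring.
  + by move=> x; rewrite BE gE nmulr_rgt0// ltrz0; lia.
by have := bB; rewrite BE gE k0 mul0r ltxx.
Qed.

(** The line that witnesses [z] is turned about [z] until it hits another point outside [B]. One
    sense of rotation meets no point of [B] on the way; it is here that a second essential point
    [z'] is needed. *)
Lemma tangent_at_essential B z z' b : z \notin B -> z' \notin B -> z' != z ->
  b \in B -> essential B z -> essential B z' ->
  exists p q r, [/\ tangent grid_box p q r, p * z.1%:Z + q * z.2%:Z = r &
    forall x, (x \in B) = (r < p * x.1%:Z + q * x.2%:Z)].
Proof.
move=> zB z'B zz' bB [y yz hy] [y' y'z' hy'].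
pose X x : R := (x.1%:Z - z.1%:Z)%:~R; pose Y x : R := (x.2%:Z - z.2%:Z)%:~R.
pose u x := y.1.1 * X x + y.1.2 * Y x; pose w x := y.1.1 * Y x - y.1.2 * X x.
have uE x : u x = hom y x by rewrite -[RHS]subr0 -yz homB.
have u1 x : x \in B -> 0 < u x.
  move=> xB; rewrite uE; have := hy x; rewrite xB; apply.
  by apply: contraNneq zB => <-.
have u0 x : x \notin B -> x != z -> u x < 0.
  by move=> xB xz; rewrite uE; have := hy x xz; rewrite (negbTE xB).
pose Z := [pred x | (x \notin B) && (x != z)].
have Zz' : Z z' by rewrite /= z'B.
(* The form [w + rho x * u] vanishes at [z] and at [x], so the extreme values of [rho] outside [B]
   belong to the first points hit in either sense. *)
pose rho x := - (w x / u x).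
have [x1 /andP[x1B x1z] max1] := @Order.TotalTheory.arg_maxP _ _ _ z' Z rho Zz'.
have [x2 /andP[x2B x2z] min2] := @Order.TotalTheory.arg_minP _ _ _ z' Z rho Zz'.
have wE x : x \notin B -> x != z -> w x = - rho x * u x.
  by move=> xB xz; rewrite /rho opprK divfK// lt_eqF// u0.
have uz : u z = 0 by rewrite uE yz.
have wz : w z = 0 by rewrite /w /X /Y !subrr !mulr0 subr0.
have [all1|] := boolP [forall x in B, 0 < w x + rho x1 * u x].
  apply: (@tangent_of_real B (rho x1 * y.1.1 - y.1.2) (rho x1 * y.1.2 + y.1.1) z x1 b) => //.
    by have := wE _ x1B x1z; rewrite /w /u /X /Y; lra.
  move=> x; rewrite (_ : _ + _ = w x + rho x1 * u x); last by rewrite /w /u /X /Y; ring.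
  case: ifPn => xB; first by move/forall_inP: all1; apply.
  have [->|xz] := eqVneq x z; first by rewrite wz uz mulr0 addr0.
  rewrite wE// -mulrDl nmulr_lle0 ?u0// addrC subr_ge0.
  by apply: max1; rewrite /= xB.
rewrite negb_forall => /existsP[ o]; rewrite negb_imply -leNgt => /andP[oB ho].
have [all2|] := boolP [forall x in B, 0 < - w x - rho x2 * u x].
  apply: (@tangent_of_real B (- rho x2 * y.1.1 + y.1.2) (- rho x2 * y.1.2 - y.1.1) z x2 b) => //.
    by have := wE _ x2B x2z; rewrite /w /u /X /Y; lra.
  move=> x; rewrite (_ : _ + _ = - w x - rho x2 * u x); last by rewrite /w /u /X /Y; ring.
  case: ifPn => xB; first by move/forall_inP: all2; apply.
  have [->|xz] := eqVneq x z; first by rewrite wz uz mulr0 subr0 oppr0.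
  rewrite wE// mulNr opprK -mulrBl nmulr_lle0 ?u0// subr_ge0.
  by apply: min2; rewrite /= xB.
rewrite negb_forall => /existsP[ o2]; rewrite negb_imply -leNgt => /andP[xB2 ho2].
exfalso.
have zo : o != z by apply: contraNneq zB => <-.
have zo2 : o2 != z by apply: contraNneq zB => <-.
have uo := u1 _ oB; have uo2 := u1 _ xB2; have uz' := u0 _ z'B zz'.
have r1 : rho z' <= rho x1 by apply: max1.
have r2 : rho x2 <= rho z' by apply: min2.
have wz' := wE _ z'B zz'.
(* Points [o] and [o2] of [B] now block both rotations. The form of [z'], shifted to vanish at [z],
   is positive on [B] and at [z']; expressed through [u] and [w] it is nonpositive at one of the
   blockers, according to the sign of [Q]. *)
pose L x := y'.1.1 * X x + y'.1.2 * Y x.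
pose N := y.1.1 ^+ 2 + y.1.2 ^+ 2.
have N0 : 0 < N.
  rewrite lt_neqAle addr_ge0 ?sqr_ge0// andbT eq_sym paddr_eq0 ?sqr_ge0// !sqrf_eq0.
  apply/negP => /andP[/eqP b1 /eqP b2].
  by move: uo; rewrite /u b1 b2 !mul0r addr0 ltxx.
pose P := y'.1.1 * y.1.1 + y'.1.2 * y.1.2.
pose Q := y'.1.2 * y.1.1 - y'.1.1 * y.1.2.
have NL x : N * L x = P * u x + Q * w x by rewrite /N /L /P /Q /u /w; ring.
have LE x : L x = hom y' x - hom y' z by rewrite homB.
have fz : hom y' z < 0 by have := hy' z; rewrite eq_sym zz' (negbTE zB); apply.
have Lpos x : x \in B -> 0 < P * u x + Q * w x.
  move=> xB; rewrite -NL mulr_gt0// LE subr_gt0 (lt_trans fz)//.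
  by have := hy' x; rewrite xB; apply; apply: contraNneq z'B => <-.
have : 0 < P * u z' + Q * w z' by rewrite -NL mulr_gt0// LE y'z' sub0r oppr_gt0.
rewrite wz' (_ : _ + _ = (P - Q * rho z') * u z'); last by ring.
rewrite nmulr_lgt0 ?u0// => PQ.
have [Q0|Q0] := leP 0 Q.
  have := Lpos _ oB; rewrite ltNge => /negP; apply.
  have h1 : Q * w o <= Q * (- rho x1 * u o) by rewrite ler_wpM2l// mulNr -subr_le0 opprK.
  have h2 : (P - Q * rho x1) * u o <= 0.
    rewrite pmulr_lle0// (le_trans _ (ltW PQ))// lerD2l lerN2 ler_wpM2l//.
  by lra.
have := Lpos _ xB2; rewrite ltNge => /negP; apply.
have h1 : Q * w o2 <= Q * (- rho x2 * u o2).
  by apply: (ler_wnM2l (ltW Q0)); move: ho2; lra.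
have h2 : (P - Q * rho x2) * u o2 <= 0.
  by rewrite pmulr_lle0// (le_trans _ (ltW PQ))// lerD2l lerN2 ler_wnM2l// ltW.
by lra.
Qed.

End Essential.

(** * At most four essential points *)

Section Bounds.
Variables (R : realType) (m n : nat).
Local Notation G := ('I_m * 'I_n)%type.
Local Notation hom := (@hom R m n).
Local Notation essential := (@essential R m n).
Implicit Types (y : R * R * R) (x z : G) (B : {set G}).

Lemma coord_inj x z : x.1%:Z = z.1%:Z -> x.2%:Z = z.2%:Z -> x = z.
Proof.
by case: x z => [i j] [i' j'] /= [h] [h']; congr pair; exact: val_inj.
Qed.

Lemma essential_setC B x : essential B x -> essential (~: B) x.
Proof.
have homN y z : hom (- y.1.1, - y.1.2, - y.2) z = - hom y z.
  by rewrite /hom /=; ring.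
case=> y yx hy; exists (- y.1.1, - y.1.2, - y.2); first by rewrite homN yx oppr0.
move=> z zx; have := hy z zx; rewrite finset.inE homN.
by case: ifP => _ /=; rewrite ?oppr_lt0 ?oppr_gt0.
Qed.

(* Three essential points outside [B] would all lie on the unique tangent, and the
   middle one cannot be the only one that vanishes. *)
Lemma three_essential B b z1 z2 z3 : b \in B ->
  z1 \notin B -> z2 \notin B -> z3 \notin B ->
  z1 != z2 -> z2 != z3 -> z3 != z1 ->
  essential B z1 -> essential B z2 -> essential B z3 -> False.
Proof.
move=> bB B1 B2 B3 n12 n23 n31 e1 e2 e3.
have [p [q [r [T1 l1 h1]]]] : exists p q r, [/\ tangent (grid_box m n) p q r,
    p * z1.1%:Z + q * z1.2%:Z = r & forall x, (x \in B) = (r < p * x.1%:Z + q * x.2%:Z)].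
  by apply: (@tangent_at_essential R m n B z1 z2 b); rewrite // eq_sym.
have on z z' : z \notin B -> z' \notin B -> z' != z -> essential B z -> essential B z' ->
    p * z.1%:Z + q * z.2%:Z = r.
  move=> zB z'B zz' ez ez'.
  have [p' [q' [r' [T' l' h']]]] := tangent_at_essential zB z'B zz' bB ez ez'.
  have [|//|-> -> ->] := tangent_unique T1 T' _ (grid_boxP b); last by [].
    move=> x1 x2 /grid_boxE[x [-> ->]]; by rewrite -h1 -h'.
  by rewrite -h1.
have l2 := on _ _ B2 B3 _ e2 e3; rewrite eq_sym in n23; move/(_ n23) in l2.
have l3 := on _ _ B3 B1 _ e3 e1; rewrite eq_sym in n31; move/(_ n31) in l3.
have [/coprimezP[[u v] /= uv] _] := T1.
(* The lattice coordinate along the common tangent; an essential point on it has the other two on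
   the same side. *)
pose k z := v * (z.1%:Z - z1.1%:Z) - u * (z.2%:Z - z1.2%:Z).
have par z : p * z.1%:Z + q * z.2%:Z = r ->
    z.1%:Z = z1.1%:Z + k z * q /\ z.2%:Z = z1.2%:Z - k z * p.
  move=> lz; have d : p * (z.1%:Z - z1.1%:Z) + q * (z.2%:Z - z1.2%:Z) = 0 by lia.
  split.
    have : z.1%:Z - z1.1%:Z = k z * q; last by lia.
    transitivity ((u * p + v * q) * (z.1%:Z - z1.1%:Z)); first by rewrite uv mul1r.
    transitivity (k z * q + u * (p * (z.1%:Z - z1.1%:Z) + q * (z.2%:Z - z1.2%:Z))).
      by rewrite /k; ring.
    by rewrite d mulr0 addr0.
  have : z.2%:Z - z1.2%:Z = - (k z * p); last by lia.
  transitivity ((u * p + v * q) * (z.2%:Z - z1.2%:Z)); first by rewrite uv mul1r.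
  transitivity (- (k z * p) + v * (p * (z.1%:Z - z1.1%:Z) + q * (z.2%:Z - z1.2%:Z))).
    by rewrite /k; ring.
  by rewrite d mulr0 addr0.
have mid z z' z2' : p * z.1%:Z + q * z.2%:Z = r -> p * z'.1%:Z + q * z'.2%:Z = r ->
    p * z2'.1%:Z + q * z2'.2%:Z = r -> essential B z -> z' \notin B -> z2' \notin B ->
    z' != z -> z2' != z -> 0 < (k z' - k z) * (k z2' - k z).
  move=> lz lz' lz2 [y yz hy] zB' zB2 nz' nz2.
  have [a1 a2] := par _ lz; have [b1 b2] := par _ lz'; have [c1 c2] := par _ lz2.
  have := hy _ nz'; rewrite (negbTE zB'); have := hy _ nz2; rewrite (negbTE zB2).
  rewrite -[hom y z']subr0 -[hom y z2']subr0 -yz !homB a1 a2 b1 b2 c1 c2.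
  rewrite (_ : z1.1%:Z + k z' * q - (z1.1%:Z + k z * q) = (k z' - k z) * q); last by ring.
  rewrite (_ : z1.1%:Z + k z2' * q - (z1.1%:Z + k z * q) = (k z2' - k z) * q); last by ring.
  rewrite (_ : z1.2%:Z - k z' * p - (z1.2%:Z - k z * p) = - ((k z' - k z) * p)); last by ring.
  rewrite (_ : z1.2%:Z - k z2' * p - (z1.2%:Z - k z * p) = - ((k z2' - k z) * p)); last by ring.
  set s := k z' - k z; set t := k z2' - k z.
  rewrite !intrN !intrM; set c := y.1.1 * q%:~R - y.1.2 * p%:~R.
  rewrite (_ : _ + _ = t%:~R * c); last by rewrite /c; ring.
  rewrite (_ : _ + _ = s%:~R * c); last by rewrite /c; ring.
  move=> tc sc; rewrite !yz in tc sc; rewrite -(ltr0z R) intrM.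
  have : 0 < (t%:~R * c) * (s%:~R * c) by rewrite nmulr_rgt0.
  rewrite (_ : t%:~R * c * _ = (s%:~R * t%:~R) * c ^+ 2); last by ring.
  have csq : 0 < c ^+ 2.
    by rewrite exprn_even_gt0//=; apply: contraTneq tc => ->; rewrite mulr0 ltxx.
  by rewrite pmulr_lgt0.
have := mid _ _ _ l1 l2 l3 e1 B2 B3; have := mid _ _ _ l2 l1 l3 e2 B1 B3.
have := mid _ _ _ l3 l1 l2 e3 B1 B2.
rewrite n12 n31 n23 [z2 == z1]eq_sym n12 [z3 == z1]eq_sym n31 [z2 == z3]eq_sym n23.
move=> /(_ isT isT) h3 /(_ isT isT) h2 /(_ isT isT) {}h1.
move: (k z1) (k z2) (k z3) h1 h2 h3 => a b' c; nia.
Qed.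

Definition essentials B : {set G} := [set x | `[< essential B x >]]%SET.

Lemma essentialsP B x : reflect (essential B x) (x \in essentials B).
Proof. by rewrite inE; apply: asboolP. Qed.

Lemma card_essentialsD B b : b \in B -> (#|essentials B :\: B| <= 2)%N.
Proof.
move=> bB; rewrite leqNgt; apply/negP => /card_gt2P[z1 [z2 [z3 [[]]]]].
move=> /finset.setDP[/essentialsP e1 B1] /finset.setDP[/essentialsP e2 B2].
move=> /finset.setDP[/essentialsP e3 B3] [n12 n23 n31].
exact: (three_essential bB B1 B2 B3 n12 n23 n31 e1 e2 e3).
Qed.

Lemma card_essentialsI B b : b \notin B -> (#|essentials B :&: B| <= 2)%N.
Proof.
move=> bB; rewrite leqNgt; apply/negP => /card_gt2P[z1 [z2 [z3 [[]]]]].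
move=> /finset.setIP[/essentialsP e1 B1] /finset.setIP[/essentialsP e2 B2].
move=> /finset.setIP[/essentialsP e3 B3] [n12 n23 n31].
have nB z : z \in B -> z \notin ~: B by rewrite finset.inE negbK.
have bC : b \in ~: B by rewrite finset.inE.
exact: (three_essential bC (nB _ B1) (nB _ B2) (nB _ B3) n12 n23 n31
  (essential_setC e1) (essential_setC e2) (essential_setC e3)).
Qed.

(** The tangent argument needs a point of [B]. When [B] is empty, a point with an interior
    coordinate is the midpoint of two neighbours in G, and two negative values do not average to
    zero; only the corners of the grid remain. *)
Lemma card_essentials0 : (#|essentials finset.set0| <= 4)%N.
Proof.
pose ends k := [set i : 'I_k | (i == 0 :> nat) || (i == k.-1 :> nat)]%SET.
have cards_ends k : (#|ends k| <= 2)%N.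
  case: k @ends => [|k] ends.
    by rewrite eq_card0// => -[].
  apply: leq_trans (subset_leq_card _) (_ : #|[set ord0; ord_max : 'I_k.+1]%SET| <= _)%N.
    by apply/fintype.subsetP => i; rewrite !inE -!val_eqE.
  by rewrite cards2; case: eqP.
have key x : essential finset.set0 x ->
    ((x.1 == 0 :> nat) || (x.1 == m.-1 :> nat)) /\
    ((x.2 == 0 :> nat) || (x.2 == n.-1 :> nat)).
  move=> [y yx hy].
  have hneg z : z != x -> hom y z < 0 by move=> /hy; rewrite inE.
  split; apply/negPn/negP; rewrite negb_or => /andP[x0 x1]; rewrite -lt0n in x0.
    have a : (x.1.-1 < m)%N by have := ltn_ord x.1; lia.
    have b : (x.1.+1 < m)%N by have := ltn_ord x.1; lia.
    have h1 : hom y (Ordinal b, x.2) < 0.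
      by apply: hneg; rewrite -pair_eqE /pair_eq /= eqxx andbT -val_eqE /=; lia.
    have h2 : hom y (Ordinal a, x.2) < 0.
      by apply: hneg; rewrite -pair_eqE /pair_eq /= eqxx andbT -val_eqE /=; lia.
    have e : (x.1.-1%:R : R) + 1 = x.1%:R by rewrite natr1 prednK.
    by move: h1 h2 yx; rewrite /hom /= -!natr1 -e; lra.
  have a : (x.2.-1 < n)%N by have := ltn_ord x.2; lia.
  have b : (x.2.+1 < n)%N by have := ltn_ord x.2; lia.
  have h1 : hom y (x.1, Ordinal b) < 0.
    by apply: hneg; rewrite -pair_eqE /pair_eq /= eqxx /= -val_eqE /=; lia.
  have h2 : hom y (x.1, Ordinal a) < 0.
    by apply: hneg; rewrite -pair_eqE /pair_eq /= eqxx /= -val_eqE /=; lia.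
  have e : (x.2.-1%:R : R) + 1 = x.2%:R by rewrite natr1 prednK.
  by move: h1 h2 yx; rewrite /hom /= -!natr1 -e; lra.
apply: leq_trans (subset_leq_card _) (_ : #|finset.setX (ends m) (ends n)| <= _)%N; last first.
  by rewrite cardsX (leq_mul (cards_ends m) (cards_ends n)).
apply/fintype.subsetP => x /essentialsP/key[h1 h2].
by rewrite !inE h1 h2.
Qed.

Lemma card_essentials_le4 B b : b \notin B -> (#|essentials B| <= 4)%N.
Proof.
move=> bB; have [->|[b' b'B]] := set_0Vmem B; first exact: card_essentials0.
by rewrite -(cardsID B) (leq_add (card_essentialsI bB) (card_essentialsD b'B)).
Qed.

End Bounds.

(** * At least three essential points *)

Definition lin (R : realType) (c y : R * R * R) : R :=
  c.1.1 * y.1.1 + c.1.2 * y.1.2 + c.2 * y.2.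

(** A form [c] that vanishes at the current point is made nonzero by a small step along its own
    coefficient vector, since [lin c c > 0]; the forms already nonzero keep their signs. *)
Lemma generic_point (R : realType) (l k : seq (R * R * R)) y :
  all (fun c => c != 0) l -> (forall c, c \in k -> lin c y != 0) ->
  exists z, (forall c, c \in l -> lin c z != 0) /\
            (forall c, c \in k -> 0 < lin c y * lin c z).
Proof.
move=> + yk; elim: l => [_|c l IHl /= /andP[c0 /IHl[z [zl zk]]]].
  by exists y; split=> // c /yk; rewrite -expr2 exprn_even_gt0.
have cc : 0 < lin c c.
  case: c c0 => [[c1 c2] c3] /= c0; rewrite lt_neqAle eq_sym /lin /=.
  rewrite !addr_ge0 -?expr2 ?sqr_ge0// andbT !paddr_eq0 ?addr_ge0 ?sqr_ge0//.
  apply: contra c0; rewrite !sqrf_eq0 => /andP[/andP[/eqP -> /eqP ->] /eqP ->].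
  by [].
have linD a t : lin a (z.1.1 + t * c.1.1, z.1.2 + t * c.1.2, z.2 + t * c.2) =
    lin a z + t * lin a c by rewrite /lin /=; ring.
have [cz|cz] := eqVneq (lin c z) 0; last first.
  by exists z; split=> // a; rewrite inE => /orP[/eqP -> //|/zl].
have zk0 a : a \in k -> lin a z != 0.
  by move=> /zk; apply: contraTneq => ->; rewrite mulr0 ltxx.
have [|e e0 he] := @sign_stable R [seq (lin a z, lin a c) | a <- l ++ k].
  apply/allP => p /mapP[a]; rewrite mem_cat => /orP[/zl|/zk0] ? -> //.
have {}he a : a \in l ++ k -> 0 < lin a z * (lin a z + e * lin a c).
  move=> alk; apply: (he e _ (lin a z, lin a c)); first by rewrite gtr0_norm.
  by apply/mapP; exists a.
exists (z.1.1 + e * c.1.1, z.1.2 + e * c.1.2, z.2 + e * c.2); split=> a.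
  rewrite linD inE => /orP[/eqP ->|al].
    by rewrite cz add0r mulf_neq0 ?gt_eqF.
  have := he a; rewrite mem_cat al => /(_ isT).
  by apply: contraTneq => ->; rewrite mulr0 ltxx.
move=> ak; rewrite linD; have := he a; rewrite mem_cat ak orbT => /(_ isT).
have := zk a ak; move: (lin a y) (lin a z) (_ + _) => u v w uv vw.
have : 0 < (u * w) * v ^+ 2.
  have -> : (u * w) * v ^+ 2 = (u * v) * (v * w) by ring.
  exact: mulr_gt0.
by rewrite pmulr_lgt0// exprn_even_gt0//=; apply: contraTneq uv => ->; rewrite mulr0 ltxx.
Qed.

Section LowerBound.
Variables (R : realType) (m n : nat).
Hypotheses (m2 : (2 <= m)%N) (n2 : (2 <= n)%N).
Local Notation G := ('I_m * 'I_n)%type.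
Local Notation hom := (@hom R m n).
Local Notation essentials := (@essentials R m n).
Implicit Types (y : R * R * R) (x z : G) (B : {set G}).

Definition separates y B := forall x, if x \in B then 0 < hom y x else hom y x < 0.

Let vec x : R * R * R := (x.1%:R, x.2%:R, -1).

Let homE y x : hom y x = lin (vec x) y.
Proof. by rewrite /hom /lin /vec /=; ring. Qed.

Lemma two_points_cover (E : {set G}) : (#|E| <= 2)%N ->
  exists x x', x != x' /\ {subset E <= [set x; x']%SET}.
Proof.
have hm : (0 < m)%N by exact: leq_trans m2.
have hn : (0 < n)%N by exact: leq_trans n2.
pose a : G := (Ordinal hm, Ordinal hn); pose b : G := (Ordinal hm, Ordinal n2).
have ab : a != b by apply/eqP => /(congr1 (fun x : G => val x.2)).
rewrite leq_eqVlt => /orP[/cards2P[x [x' [xx' ->]]]|].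
  by exists x, x'; split=> // z; rewrite !inE.
rewrite ltnS leq_eqVlt => /orP[/cards1P[x ->]|].
  have [->|xa] := eqVneq x a.
    by exists a, b; split=> // z; rewrite !inE => ->.
  by exists x, a; split=> // z; rewrite !inE => ->.
rewrite ltnS leqn0 cards_eq0 => /eqP ->.
by exists a, b; split=> // z; rewrite inE.
Qed.

(* If at most [x] and [x'] were essential, then, moving a generic [y] along a
   direction annihilating both, the first wall hit would be a third one. *)
Lemma card_essentials_ge3 B y0 : separates y0 B -> (3 <= #|essentials B|)%N.
Proof.
move=> sep; rewrite leqNgt; apply/negP => /two_points_cover[x [x' [xx' cov]]].
(* The line through [x] and [x'], as a cross product: moving along [g0] leaves the values at [x] and
   [x'] unchanged. *)
pose g0 : R * R * R := (- (x'.2%:R - x.2%:R), x'.1%:R - x.1%:R,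
  (x'.1%:R - x.1%:R) * x.2%:R - (x'.2%:R - x.2%:R) * x.1%:R).
have g0x : hom g0 x = 0 by rewrite /hom /g0 /=; ring.
have g0x' : hom g0 x' = 0 by rewrite /hom /g0 /=; ring.
have hm : (0 < m)%N by exact: leq_trans m2.
have hn : (0 < n)%N by exact: leq_trans n2.
have [w g0w] : exists w, hom g0 w != 0.
  apply/existsP; rewrite -negb_forall; apply/negP => /forallP h.
  have := h (Ordinal hm, Ordinal hn); have := h (Ordinal m2, Ordinal hn).
  have := h (Ordinal hm, Ordinal n2).
  rewrite /hom /= !mulr0 !mulr1 !addr0 !add0r => /eqP h1 /eqP h2 /eqP h3.
  case/eqP: xx'; apply: coord_inj; congr Posz; apply/eqP; rewrite -(eqr_nat R).
    by apply/eqP; lra.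
  by apply/eqP; lra.
have y0n z : hom y0 z != 0.
  by have := sep z; case: ifP => _ h; [rewrite gt_eqF|rewrite lt_eqF].
(* The sign of the direction is chosen so that some wall lies ahead. *)
have [g [gx gx' [w' gw]]] : exists g, [/\ hom g x = 0, hom g x' = 0 &
    exists w', hom g w' * hom y0 w' < 0].
  have [h|h|h] := ltrgt0P (hom g0 w * hom y0 w).
  - have homN z : hom (- g0.1.1, - g0.1.2, - g0.2) z = - hom g0 z.
      by rewrite /hom /=; ring.
    exists (- g0.1.1, - g0.1.2, - g0.2); rewrite !homN g0x g0x' oppr0; split=> //.
    by exists w; rewrite homN mulNr oppr_lt0.
  - by exists g0; split=> //; exists w.
  by move/eqP: h; rewrite mulf_eq0 (negbTE g0w) (negbTE (y0n w)).
(* The form [pc z z'] vanishes at [y] when the walls of [z] and [z'] are hit at the same time;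
   avoiding all these zeros makes the first wall unique. *)
pose pc (z z' : G) : R * R * R :=
  (hom g z' * z.1%:R - hom g z * z'.1%:R, hom g z' * z.2%:R - hom g z * z'.2%:R,
   hom g z - hom g z').
have pcE z z' y : lin (pc z z') y = hom g z' * hom y z - hom g z * hom y z'.
  by rewrite /lin /pc /= /hom; ring.
pose l := [seq pc p.1 p.2 | p <- enum {: G * G} & (p.1 != p.2) && (hom g p.2 != 0)].
pose k := [seq vec z | z <- enum {: G}].
have [||y [yl yk]] := @generic_point R l k y0.
- apply/allP => c /mapP[[z z']]; rewrite mem_filter /= => /andP[/andP[zz' gz'] _] ->.
  apply: contra zz' => /eqP; rewrite /pc => -[e1 e2 /eqP]; rewrite subr_eq0 => /eqP e3.
  rewrite e3 in e1 e2; apply/eqP/coord_inj.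
    by congr Posz; apply/eqP; rewrite -(eqr_nat R); apply/eqP/(mulfI gz')/eqP; rewrite -subr_eq0 e1.
  by congr Posz; apply/eqP; rewrite -(eqr_nat R); apply/eqP/(mulfI gz')/eqP; rewrite -subr_eq0 e2.
- by move=> c /mapP[z _ ->]; rewrite -homE.
have ys z : 0 < hom y0 z * hom y z.
  by rewrite !homE; apply: yk; apply/mapP; exists z; rewrite ?mem_enum.
have sepy z : if z \in B then 0 < hom y z else hom y z < 0.
  have := sep z; have := ys z; case: ifP => _ h1 h2.
    by rewrite -(pmulr_rgt0 _ h2).
  by rewrite -(nmulr_rgt0 _ h2).
have gen z z' : z != z' -> hom g z' != 0 -> hom g z' * hom y z != hom g z * hom y z'.
  move=> zz' gz'; rewrite -subr_eq0 -pcE; apply: yl; apply/mapP.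
  by exists (z, z') => //; rewrite mem_filter /= zz' gz' mem_enum.
have yn z : hom y z != 0.
  by have := sepy z; case: ifP => _ h; [rewrite gt_eqF|rewrite lt_eqF].
pose P := [pred z | hom g z * hom y z < 0].
have Pw' : P w'.
  rewrite /P /=; have := ys w'; move: gw; have := y0n w'.
  move: (hom g w') (hom y0 w') (hom y w') => a b c.
  by case: (ltrgt0P b) => // hb _; nra.
pose s z := - (hom y z / hom g z).
have [z0 Pz0 min0] := @Order.TotalTheory.arg_minP _ _ _ w' P s Pw'.
have gP z : P z -> hom g z != 0.
  by apply: contraTneq => h; rewrite /= h mul0r ltxx.
have gz0 := gP _ Pz0.
pose y1 : R * R * R := (y.1.1 + s z0 * g.1.1, y.1.2 + s z0 * g.1.2, y.2 + s z0 * g.2).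
have hom1 z : hom y1 z = hom y z + s z0 * hom g z by rewrite /hom /y1 /=; ring.
have s0 : 0 < s z0.
  rewrite /s oppr_gt0 -(pmulr_llt0 _ (_ : 0 < hom g z0 ^+ 2)); last by rewrite exprn_even_gt0.
  by rewrite expr2 mulrA divfK// mulrC.
have : z0 \in essentials B.
  apply/essentialsP; exists y1; first by rewrite hom1 /s mulNr divfK// subrr.
  move=> z zz0; have main : 0 < hom y z * hom y1 z.
    rewrite hom1; have [Pz|] := boolP (P z); last first.
      rewrite /= -leNgt => hz; rewrite mulrDr.
      apply: ltr_wpDr; first by rewrite mulrCA; apply: mulr_ge0; [exact: ltW|rewrite mulrC].
      by rewrite -expr2 exprn_even_gt0 // yn orbT.
    have gz := gP _ Pz.
    have sz : s z0 < s z.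
      rewrite lt_neqAle min0// andbT /s eqr_opp eqr_div//.
      by rewrite mulrC [X in _ != X]mulrC gen// eq_sym.
    have e : hom y z = - s z * hom g z by rewrite /s opprK divfK.
    have g2 : 0 < hom g z ^+ 2 by rewrite exprn_even_gt0.
    have sz0 : 0 < s z by exact: lt_trans sz.
    rewrite e; move: (s z) (s z0) (hom g z) sz sz0 g2 => a c d ca a0 d0.
    have -> : - a * d * (- a * d + c * d) = a * (a - c) * d ^+ 2 by ring.
    by apply: mulr_gt0 => //; apply: mulr_gt0 => //; rewrite subr_gt0.
  have := sepy z; case: ifP => _ h.
    by rewrite -(pmulr_rgt0 _ h).
  by rewrite -(nmulr_rgt0 _ h).
move/cov; rewrite !inE => /orP[]/eqP e; move: gz0; rewrite e ?gx ?gx' eqxx//.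
Qed.

End LowerBound.

(** * Cones over polygons *)

Section Dot.
Variable R : realType.
Implicit Types (u v x y z : 'rV[R]_3) (L : 'M[R]_3).

Definition row3 (a b c : R) : 'rV[R]_3 := \row_(i < 3) nth 0 [:: a; b; c] i.

Lemma row3P v : exists a b c, v = row3 a b c.
Proof.
exists (v 0 (inord 0)), (v 0 (inord 1)), (v 0 (inord 2)).
apply/rowP => -[[|[|[|i]]] hi]; rewrite !mxE //=; congr (v 0 _);
  by apply: val_inj; rewrite /= inordK.
Qed.

Lemma dot_row3 a b c a' b' c' :
  dot (row3 a b c) (row3 a' b' c') = a * a' + b * b' + c * c'.
Proof. by rewrite /dot !big_ord_recl big_ord0 !mxE /= addr0 addrA. Qed.

Lemma row3D a b c a' b' c' :
  row3 a b c + row3 a' b' c' = row3 (a + a') (b + b') (c + c').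
Proof. by apply/rowP => -[[|[|[|i]]] hi]; rewrite !mxE. Qed.

Lemma row3Z t a b c : t *: row3 a b c = row3 (t * a) (t * b) (t * c).
Proof. by apply/rowP => -[[|[|[|i]]] hi]; rewrite !mxE. Qed.

Lemma row3_inj a b c a' b' c' :
  row3 a b c = row3 a' b' c' -> [/\ a = a', b = b' & c = c'].
Proof.
move=> /rowP e; have := e (inord 0); have := e (inord 1); have := e (inord 2).
by rewrite !mxE !inordK.
Qed.

Lemma dotC u v : dot u v = dot v u.
Proof. by apply: eq_bigr => i _; rewrite mulrC. Qed.

Lemma dotDr u v w : dot u (v + w) = dot u v + dot u w.
Proof. by rewrite -big_split; apply: eq_bigr => i _; rewrite !mxE mulrDr. Qed.

Lemma dotZr u t v : dot u (t *: v) = t * dot u v.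
Proof. by rewrite big_distrr; apply: eq_bigr => i _; rewrite !mxE mulrCA. Qed.

Lemma dotNr u v : dot u (- v) = - dot u v.
Proof. by rewrite -scaleN1r dotZr mulN1r. Qed.

Lemma dotBr u v w : dot u (v - w) = dot u v - dot u w.
Proof. by rewrite dotDr dotNr. Qed.

Lemma dotNl u v : dot (- u) v = - dot u v.
Proof. by rewrite dotC dotNr dotC. Qed.

Lemma dot0r u : dot u 0 = 0.
Proof. by rewrite -(scale0r 0) dotZr mul0r. Qed.

Lemma dot_mulmx u v : u *m v^T = (dot u v)%:M.
Proof.
apply/matrixP => i j; rewrite !mxE !ord1 eqxx mulr1n.
by apply: eq_bigr => k _; rewrite !mxE.
Qed.

Lemma dot_mulmxr u y L : dot u (y *m L) = dot (u *m L^T) y.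
Proof.
have : (dot u (y *m L))%:M = (dot (u *m L^T) y)%:M :> 'M[R]_1.
  by rewrite -!dot_mulmx trmx_mul mulmxA.
by move=> /matrixP /(_ 0 0); rewrite !mxE !eqxx !mulr1n.
Qed.

Lemma dot_gt0 u : u != 0 -> 0 < dot u u.
Proof.
move=> u0; rewrite lt_neqAle eq_sym sumr_ge0 ?andbT; last first.
  by move=> i _; rewrite -expr2 sqr_ge0.
apply: contra u0; rewrite psumr_eq0; last by move=> i _; rewrite -expr2 sqr_ge0.
move=> /allP h; apply/eqP/rowP => i; have := h i; rewrite mem_index_enum /=.
by move=> /(_ isT); rewrite -expr2 sqrf_eq0 mxE => /eqP.
Qed.

Lemma normal_unique (a b u u' : 'rV[R]_3) : row_free (col_mx a b) -> u != 0 ->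
  dot u a = 0 -> dot u b = 0 -> dot u' a = 0 -> dot u' b = 0 ->
  exists k, u' = k *: u.
Proof.
move=> ab u0 ua ub ua' ub'; pose M := (col_mx a b)^T.
have inK v : dot v a = 0 -> dot v b = 0 -> (v <= kermx M)%MS.
  move=> va vb; apply/sub_kermxP; rewrite /M tr_col_mx mul_mx_row !dot_mulmx va vb.
  by rewrite !raddf0 row_mx0.
have rK : \rank (kermx M) = 1%N.
  by rewrite mxrank_ker mxrank_tr; move/eqP: ab => ->.
have : (kermx M <= u)%MS.
  by rewrite -(geq_leqif (mxrank_leqif_sup (inK _ ua ub))) rK rank_rV u0.
by move=> /(submx_trans (inK _ ua' ub')) /sub_rVP.
Qed.

Lemma row_free_col_mx2 (a b c1 c2 : 'rV[R]_3) :
  dot a c1 = 1 -> dot a c2 = 0 -> dot b c1 = 0 -> dot b c2 = 1 ->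
  row_free (col_mx a b).
Proof.
move=> h11 h12 h21 h22; apply/row_freeP; exists (row_mx c1^T c2^T).
rewrite mul_col_row !dot_mulmx h11 h12 h21 h22.
by rewrite [RHS](scalar_mx_block 1 1) raddf0.
Qed.

Definition affine_map p L y : 'rV[R]_3 := p + y *m L.

Lemma face_preimage (C F : set 'rV[R]_3) p L : L \in unitmx -> two_dim_face C F ->
  two_dim_face (affine_map p L @^-1` C) (affine_map p L @^-1` F).
Proof.
move=> uL [u [c [u0 hu -> [x [y [z [Fx Fy Fz fr]]]]]]]; set phi := affine_map p L.
have dphi w : dot u (phi w) = dot u p + dot (u *m L^T) w.
  by rewrite dotDr dot_mulmxr.
exists (u *m L^T), (c - dot u p); split.
- apply: contra u0 => /eqP e; rewrite -[u]mulmx1 -(mulmxV (_ : L^T \in unitmx)) ?unitmx_tr//.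
  by rewrite mulmxA e mul0mx.
- by move=> w /hu; rewrite dphi lerBrDl.
- apply/seteqP; split => w [Cw /= e]; split=> //.
    by rewrite -e dphi addrC addKr.
  by rewrite dphi e addrC subrK.
pose psi w := (w - p) *m invmx L.
have psiK w : phi (psi w) = w by rewrite /phi /affine_map /psi mulmxKV// addrC subrK.
have psiB v w : psi v - psi w = (v - w) *m invmx L.
  by rewrite /psi -mulmxBl opprB addrA subrK.
exists (psi x), (psi y), (psi z); split; rewrite /preimage/= ?psiK//.
rewrite !psiB -mul_col_mx /row_free mxrankMfree//.
by rewrite row_free_unit unitmx_inv.
Qed.

Lemma card_faces_preimage (C : set 'rV[R]_3) p L : L \in unitmx ->
  (two_dim_face (affine_map p L @^-1` C) #= two_dim_face C)%card.
Proof.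
move=> uL; set phi := affine_map p L.
pose psi := affine_map (- (p *m invmx L)) (invmx L).
have phiK w : psi (phi w) = w.
  by rewrite /psi /phi /affine_map mulmxDl mulmxK// addKr.
have psiK w : phi (psi w) = w.
  by rewrite /psi /phi /affine_map mulmxDl mulNmx !mulmxKV// addNKr.
have -> : two_dim_face (phi @^-1` C) = (preimage phi) @` two_dim_face C.
  apply/seteqP; split => [F fF|_ [F fF <-]]; last exact: face_preimage.
  have uiL : invmx L \in unitmx by rewrite unitmx_inv.
  have := face_preimage (- (p *m invmx L)) uiL fF; rewrite -/psi.
  have -> : psi @^-1` (phi @^-1` C) = C.
    by apply/seteqP; split => w; rewrite /preimage /= psiK.
  move=> h; exists (psi @^-1` F) => //.
  by apply/seteqP; split => w; rewrite /preimage /= phiK.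
apply: inj_card_eq => F F' _ _ e.
by apply/seteqP; split => w; rewrite -(psiK w); have /seteqP[h1 h2] := e;
  [apply: h1|apply: h2].
Qed.

End Dot.

(** * The number of faces is determined by the section *)

Section Polygon.
Variable R : realType.
Implicit Types (C : set 'rV[R]_3) (Q : set (R * R)).

(** In the coordinates [v], [w], [o - p] centred at the apex, the secant plane is the plane of
    height one, so all cones with section [Q] live in one frame. The map is invertible since [h]
    separates [o - p] from [v] and [w]. *)
Lemma polygon_normal_form k Q : generalized_polygon k Q ->
  exists C (U : seq 'rV[R]_3),
    [/\ C = [set y | forall u, u \in U -> dot u y <= 0],
        (two_dim_face C #= `I_k)%card,
        forall a b c, C (row3 a b c) -> 0 <= c &
        Q = [set a | C (row3 a.1 a.2 1)]].
Proof.
case=> p [C [ o [v [w [h [[[U CE] Ck] [vv ww vw] [hv hw hop] -> hC]]]]]].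
pose L : 'M[R]_3 := \matrix_(i < 3) nth 0 [:: v; w; o - p] i.
have LE a b c : row3 a b c *m L = a *: v + b *: w + c *: (o - p).
  rewrite mulmx_sum_row !big_ord_recl big_ord0 !rowK !mxE /= addr0 addrA.
  by [].
have uL : L \in unitmx.
  rewrite -row_free_unit; apply: inj_row_free => y.
  have [a [b [c ->]]] := row3P y; rewrite LE => e.
  have c0 : c = 0.
    have := congr1 (dot h) e; rewrite dot0r !dotDr !dotZr hv hw !mulr0 !add0r.
    by move/eqP; rewrite mulf_eq0 (gt_eqF hop) orbF => /eqP.
  have a0 : a = 0.
    have := congr1 (dot v) e; rewrite c0 scale0r addr0 dot0r dotDr !dotZr vv vw.
    by rewrite mulr0 mulr1 addr0.
  have b0 : b = 0.
    have := congr1 (dot w) e; rewrite c0 scale0r addr0 dot0r dotDr !dotZr ww dotC vw.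
    by rewrite mulr0 mulr1 add0r.
  by rewrite a0 b0 c0; apply/rowP => -[[|[|[|i]]] hi]; rewrite !mxE.
exists (affine_map p L @^-1` C), [seq u *m L^T | u <- U]; split.
- rewrite CE; apply/seteqP; split=> y /= hy.
    move=> _ /mapP[u uU ->]; rewrite -dot_mulmxr.
    by have := hy u uU; rewrite /affine_map addrC addKr.
  move=> u uU; rewrite /affine_map addrC addKr dot_mulmxr.
  by apply: hy; apply/mapP; exists u.
- by apply: card_eq_trans Ck; exact: card_faces_preimage.
- move=> a b c; rewrite /preimage /affine_map /= LE => /hC.
  rewrite addrC addKr !dotDr !dotZr hv hw !mulr0 !add0r pmulr_lge0//.
have e (a : R * R) : p + row3 a.1 a.2 1 *m L = o + a.1 *: v + a.2 *: w.
  by rewrite LE scale1r addrCA [p + _]addrC subrK addrC addrA.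
by apply/seteqP; split => a; rewrite /preimage /affine_map /= e.
Qed.

(* [C] is the closure of the cone spanned by [Q] in the plane of height one, so [Q]
   determines it. *)
Lemma polygon_unique k k' Q : Q !=set0 ->
  generalized_polygon k Q -> generalized_polygon k' Q -> k = k'.
Proof.
move=> [q Qq] /polygon_normal_form[C [U [CE Ck Cpos QC]]].
move=> /polygon_normal_form[C' [U' [CE' Ck' Cpos' QC']]].
suff CC' : C = C'.
  by apply/card_eq_II; apply: card_eq_trans Ck'; rewrite -CC' card_eq_sym.
(* Membership in the cone is expressed through [Q] alone. Adding [e] times a point of [Q] raises the
   height to [c + e > 0], so that the limit directions [c = 0] are covered as well. *)
have key C0 (U0 : seq 'rV[R]_3) : C0 = [set y | forall u, u \in U0 -> dot u y <= 0] ->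
    (forall a b c, C0 (row3 a b c) -> 0 <= c) -> Q = [set a | C0 (row3 a.1 a.2 1)] ->
    forall a b c, C0 (row3 a b c) <-> 0 <= c /\ forall e, 0 < e ->
      Q ((a + e * q.1) / (c + e), (b + e * q.2) / (c + e)).
  move=> CE0 pos QC0 a b c.
  have scl e : 0 <= c -> 0 < e ->
      Q ((a + e * q.1) / (c + e), (b + e * q.2) / (c + e)) <->
      C0 (row3 a b c + e *: row3 q.1 q.2 1).
    move=> c0 e0; have ce : 0 < c + e by rewrite ltr_wpDl.
    rewrite {1}QC0 /= row3Z row3D mulr1.
    rewrite (_ : row3 (a + e * q.1) _ _ = (c + e) *:
        row3 ((a + e * q.1) / (c + e)) ((b + e * q.2) / (c + e)) 1); last first.
      by rewrite row3Z mulr1 ![_ * (_ / _)]mulrC !divfK// gt_eqF.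
    rewrite CE0; split=> /= h u uU0; have := h u uU0; rewrite dotZr.
      by rewrite pmulr_rle0.
    by rewrite pmulr_rle0.
  have C0q : C0 (row3 q.1 q.2 1) by move: Qq; rewrite QC0.
  split=> [Cy|[c0 h]].
    have c0 := pos _ _ _ Cy; split=> // e e0; apply/(scl e c0 e0).
    move: Cy C0q; rewrite CE0 /= => h1 h2 u uU0.
    by rewrite dotDr dotZr; have := h1 u uU0; have := h2 u uU0; nra.
  rewrite CE0 /= => u uU0; rewrite leNgt; apply/negP => du.
  have hq : dot u (row3 q.1 q.2 1) <= 0 by move: C0q; rewrite CE0 /=; apply.
  (* With this [e] the form [u] takes the value [e > 0] at the shifted point. *)
  pose e := dot u (row3 a b c) / (1 - dot u (row3 q.1 q.2 1)).
  have d0 : 0 < 1 - dot u (row3 q.1 q.2 1) by lra.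
  have e0 : 0 < e by rewrite divr_gt0.
  have := h e e0; move/(scl e c0 e0); rewrite CE0 /= => /(_ u uU0).
  rewrite dotDr dotZr leNgt => /negP; apply.
  have : e * (1 - dot u (row3 q.1 q.2 1)) = dot u (row3 a b c) by rewrite divfK ?gt_eqF.
  by lra.
apply/seteqP; split => y; have [a [b [c ->]]] := row3P y.
  by move/(key _ _ CE Cpos QC) => ?; apply/(key _ _ CE' Cpos' QC').
by move/(key _ _ CE' Cpos' QC') => ?; apply/(key _ _ CE Cpos QC).
Qed.

End Polygon.

(** * Faces of the cone over a cell *)

Section CellPolygon.
Variables (R : realType) (m n : nat).
Local Notation G := ('I_m * 'I_n)%type.
Local Notation hom := (@hom R m n).
Local Notation essential := (@essential R m n).
Local Notation essentials := (@essentials R m n).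
Implicit Types (x : G) (B : {set G}).

Definition weak_sign_of B x (t : R) := if x \in B then 0 <= t else t <= 0.

Definition normal x : 'rV[R]_3 := row3 x.1%:R x.2%:R (-1).

Lemma dot_normal x (y : R * R * R) : dot (normal x) (row3 y.1.1 y.1.2 y.2) = hom y x.
Proof. by rewrite dot_row3 /hom; ring. Qed.

Lemma normal_neq0 x : normal x != 0.
Proof.
apply/eqP => /rowP /(_ (inord 2)); rewrite !mxE inordK//= => /eqP.
by rewrite oppr_eq0 oner_eq0.
Qed.

Definition region_cone B : set 'rV[R]_3 :=
  [set y | forall x, weak_sign_of B x (dot (normal x) y)].

Lemma weak_signD B x s t : weak_sign_of B x s -> weak_sign_of B x t ->
  weak_sign_of B x (s + t).
Proof. by rewrite /weak_sign_of; case: ifP => _; [apply: addr_ge0|move=> ? ?; lra]. Qed.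

Lemma weak_signZ B x s t : 0 <= s -> weak_sign_of B x t -> weak_sign_of B x (s * t).
Proof. by rewrite /weak_sign_of => s0; case: ifP => _ ?; [apply: mulr_ge0|nra]. Qed.

(** The witness of an essential [x] is a relatively interior point of [F x]: small moves within the
    plane of [x] stay in the cone and span a two-dimensional face. Distinct essential points give
    distinct faces, as a witness lies on no other wall. *)
Lemma region_cone_faces B (y0 : R * R * R) : separates y0 B ->
  (two_dim_face (region_cone B) #= `I_#|essentials B|)%card.
Proof.
move=> sep; pose C := region_cone B.
pose F x := C `&` [set y | dot (normal x) y = 0].
have C0 : C 0 by move=> x; rewrite dot0r /weak_sign_of; case: ifP.
have CD y z : C y -> C z -> C (y + z).
  by move=> Cy Cz x; rewrite dotDr; apply: weak_signD.
have CZ t y : 0 <= t -> C y -> C (t *: y).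
  by move=> t0 Cy x; rewrite dotZr; apply: weak_signZ.
have strict x : essential B x -> exists y, [/\ C y, dot (normal x) y = 0 &
    forall z, z != x -> if z \in B then 0 < dot (normal z) y else dot (normal z) y < 0].
  move=> [[[y1 y2] y3] yx hy]; exists (row3 y1 y2 y3).
  have e z : dot (normal z) (row3 y1 y2 y3) = hom (y1, y2, y3) z by rewrite -dot_normal.
  split; rewrite ?e//; last by move=> z zx; rewrite e; apply: hy.
  move=> z; rewrite e /weak_sign_of; have [->|zx] := eqVneq z x; first by rewrite yx; case: ifP.
  by have := hy z zx; case: ifP => _ /ltW.
have face x : essential B x -> two_dim_face C (F x).
  move=> /strict[y [Cy yx hy]].
  have move_in p : dot (normal x) p = 0 -> exists2 e, 0 < e & F x (y + e *: p).
    move=> px.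
    have [|e e0 he] := @sign_stable R
        [seq (dot (normal z) y, dot (normal z) p) | z <- enum {: G} & z != x].
      apply/allP => w /mapP[z]; rewrite mem_filter => /andP[zx _] -> /=.
      by have := hy z zx; case: ifP => _ h; [rewrite gt_eqF|rewrite lt_eqF].
    exists e => //; split=> /=; last by rewrite dotDr dotZr yx px mulr0 addr0.
    move=> z; rewrite dotDr dotZr /weak_sign_of.
    have [->|zx] := eqVneq z x; first by rewrite yx px mulr0 addr0; case: ifP.
    have hz : 0 < dot (normal z) y * (dot (normal z) y + e * dot (normal z) p).
      apply: (he e _ (_, _)); first by rewrite gtr0_norm.
      by apply/mapP; exists z => //; rewrite mem_filter zx mem_enum.
    have := hy z zx; case: ifP => _ h; first by rewrite -(pmulr_rge0 _ h) ltW.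
    by rewrite -(nmulr_rge0 _ h) ltW.
  have [|e1 e10 F1] := move_in (row3 1 0 x.1%:R); first by rewrite dot_row3; ring.
  have [|e2 e20 F2] := move_in (row3 0 1 x.2%:R); first by rewrite dot_row3; ring.
  exists (if x \in B then - normal x else normal x), 0; split.
  - by case: ifP => _; rewrite ?oppr_eq0 normal_neq0.
  - by move=> z /(_ x); rewrite /weak_sign_of; case: ifP => _; rewrite ?dotNl ?oppr_le0.
  - apply/seteqP; split=> z [Cz /= e]; split=> //=; move: e; case: ifP => _ //; rewrite dotNl.
      by move=> ->; rewrite oppr0.
    by move/eqP; rewrite oppr_eq0 => /eqP.
  exists y, (y + e1 *: row3 1 0 x.1%:R), (y + e2 *: row3 0 1 x.2%:R); split=> //.
  rewrite ![y + _]addrC !addrK.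
  by apply: (@row_free_col_mx2 _ _ _ (row3 e1^-1 0 0) (row3 0 e2^-1 0));
    rewrite !row3Z !dot_row3 !(mulr0, mul0r, mulr1, addr0, add0r) ?mulfV// gt_eqF.
have hom_row3 x y : exists y', forall z, dot (normal z) y = hom y' z.
  by have [a [b [c ->]]] := row3P y; exists (a, b, c) => z; rewrite -dot_normal.
have faceP Fc : two_dim_face C Fc -> exists2 x, essential B x & Fc = F x.
  move=> [u [c [u0 hu FE [y1 [y2 [y3 [F1 F2 F3 fr]]]]]]].
  have := F1; have := F2; have := F3; rewrite FE => -[C3 /= u3] [C2 /= u2] [C1 /= u1].
  have c0 : c = 0.
    apply: le_anti; apply/andP; split.
      have := hu _ (CD _ _ C1 C1); rewrite dotDr u1; lra.
    by have := hu _ C0; rewrite dot0r.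
  (* A relatively interior point of the face. Some wall passes through it, as otherwise a step along
     [u] would leave the supporting half-space. A wall through [g] contains all three points, so its
     normal is a multiple of [u]; normals end in [-1], hence there is only one such wall and [g]
     witnesses it. *)
  pose g := y1 + y2 + y3; have Cg : C g by exact: CD _ _ (CD _ _ C1 C2) C3.
  have ug : dot u g = 0 by rewrite !dotDr u1 u2 u3 c0 !addr0.
  have [x gx] : exists x, dot (normal x) g = 0.
    apply: contrapT => /forallNP ng.
    have [|e e0 he] := @sign_stable R
        [seq (dot (normal z) g, dot (normal z) u) | z <- enum {: G}].
      by apply/allP => w /mapP[z _ ->] /=; apply/eqP/ng.
    have := hu (g + e *: u) _; rewrite dotDr dotZr ug add0r c0 leNgt mulr_gt0 ?dot_gt0//.
    move=> /(_ _) h; suff : false by []; apply: h.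
    move=> z; rewrite dotDr dotZr /weak_sign_of.
    have hz : 0 < dot (normal z) g * (dot (normal z) g + e * dot (normal z) u).
      apply: (he e _ (_, _)); first by rewrite gtr0_norm.
      by apply/mapP; exists z => //; rewrite mem_enum.
    have gz : dot (normal z) g != 0 by apply/eqP/ng.
    have := Cg z; rewrite /weak_sign_of; case: ifP => _ h.
      by rewrite -(pmulr_rge0 _ (_ : 0 < dot (normal z) g)) ?ltW// lt_neqAle eq_sym gz.
    by rewrite -(nmulr_rge0 _ (_ : dot (normal z) g < 0)) ?ltW// lt_neqAle gz.
  have prop z : dot (normal z) g = 0 -> exists2 k, k != 0 & normal z = k *: u.
    move=> gz; have [n1 n2 n3] : [/\ dot (normal z) y1 = 0, dot (normal z) y2 = 0 &
        dot (normal z) y3 = 0].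
      have := C1 z; have := C2 z; have := C3 z; move: gz; rewrite !dotDr /weak_sign_of.
      by case: ifP => _ *; split; lra.
    have [k ek] : exists k, normal z = k *: u.
      by apply: (normal_unique fr u0); rewrite dotBr ?n1 ?n2 ?n3 ?u1 ?u2 ?u3 subrr.
    exists k => //; apply: contra (normal_neq0 z) => /eqP k0.
    by rewrite ek k0 scale0r.
  have [k k0 ek] := prop _ gx.
  exists x; last first.
    apply/seteqP; split=> z [Cz /= e]; split=> //=.
      by rewrite ek dotC dotZr dotC e c0 mulr0.
    move/eqP: e; rewrite ek dotC dotZr dotC mulf_eq0 (negbTE k0) /= => /eqP ->.
    by rewrite c0.
  have [y' hy'] := hom_row3 x g.
  exists y'; first by rewrite -hy'.
  move=> z zx; have := Cg z; rewrite /weak_sign_of hy'.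
  have : hom y' z != 0.
    rewrite -hy'; apply: contra zx => /eqP /prop[k' k'0 ek'].
    have e : k *: normal z = k' *: normal x by rewrite ek ek' !scalerA mulrC.
    move: e; rewrite /normal !row3Z => /row3_inj[e1 e2 e3].
    have kk : k = k' by lra.
    rewrite -kk in e1 e2; apply/eqP/coord_inj; congr Posz; apply/eqP; rewrite -(eqr_nat R);
      by apply/eqP/(mulfI k0).
  by case: ifP => _ h0 h; rewrite lt_neqAle h andbT// eq_sym.
have -> : two_dim_face C = [set F x | x in [set` essentials B]].
  apply/seteqP; split=> [Fc /faceP[x ex ->]|_ [x /= /essentialsP ex <-]]; last exact: face.
  by exists x => //=; apply/essentialsP.
apply: card_eq_trans (_ : ([set` essentials B] #= `I__)%card).
  apply: inj_card_eq => x x'; rewrite !inE /= => /essentialsP ex /essentialsP ex' e.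
  have [y [Cy yx hy]] := strict _ ex.
  have : F x' y by rewrite -e; split.
  case=> _ /= yx'; apply/eqP/negPn/negP => xx'.
  by have := hy x'; rewrite eq_sym xx' yx' ltxx; case: ifP => _ /(_ isT).
have -> : [set` essentials B] = [set` [fset x in essentials B]%fset].
  by apply/seteqP; split=> x /=; rewrite !inE.
by apply/card_eq_fsetP; rewrite card_imfset//= cardE.
Qed.

Definition cell B : set (R * R) :=
  [set a | forall x, weak_sign_of B x (hom (a.1, a.2, 1) x)].

(** The inequality of the grid origin reads [0 <= c]: it puts the cone on the side of the secant
    plane, as the last clause of [generalized_polygon] demands, and when the origin is essential it
    is the face parallel to that plane. *)
Lemma cell_polygon B (y0 : R * R * R) x0 : x0.1 = 0%N :> nat -> x0.2 = 0%N :> nat -> x0 \notin B ->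
  separates y0 B -> generalized_polygon #|essentials B| (cell B).
Proof.
move=> x01 x02 x0B sep.
have e3 (a : R * R) : row3 0 0 1 + a.1 *: row3 1 0 0 + a.2 *: row3 0 1 0 = row3 a.1 a.2 1.
  by rewrite !row3Z !row3D !(mulr0, mulr1, addr0, add0r).
exists 0, (region_cone B), (row3 0 0 1), (row3 1 0 0), (row3 0 1 0), (row3 0 0 1).
split.
- split; last exact: region_cone_faces sep.
  exists [seq (if x \in B then - normal x else normal x) | x <- enum {: G}].
  apply/seteqP; split=> y /= h.
    move=> _ /mapP[x _ ->]; have := h x; rewrite subr0 /weak_sign_of.
    by case: ifP => _; rewrite ?dotNl ?oppr_le0.
  move=> x; have := h (if x \in B then - normal x else normal x).
  rewrite subr0 /weak_sign_of => /(_ _) {}h.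
  have := h (map_f _ (mem_enum _ x)).
  by case: ifP => _; rewrite ?dotNl ?oppr_le0.
- by rewrite !dot_row3; split; ring.
- by rewrite subr0 !dot_row3; split; [ring|ring|lra].
- by apply/seteqP; split=> a h x; have := h x; rewrite e3 -dot_normal.
- move=> y; have [a [b [c ->]]] := row3P y; move/(_ x0).
  rewrite /weak_sign_of (negbTE x0B) /normal x01 x02 subr0 !dot_row3; lra.
Qed.

End CellPolygon.

(** * Counting regions of the grid arrangement *)

Section GridLines.
Variables (R : realType) (m n : nat).
Local Notation G := ('I_m * 'I_n)%type.
Implicit Types (x y z : G) (A B Y : {set G}) (a b : R * R).

Definition point_form x : R * R * R := (x.1%:R, x.2%:R, -1).

Definition nonzero x := (x.1 != 0%N :> nat) || (x.2 != 0%N :> nat).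

Definition dual_line x : set (R * R) := setT `&` [set a | aff (point_form x) a = 0].

Definition cross x y z : int :=
  (y.1%:Z - x.1%:Z) * (z.2%:Z - x.2%:Z) - (y.2%:Z - x.2%:Z) * (z.1%:Z - x.1%:Z).

Definition det x y : int := x.1%:Z * y.2%:Z - x.2%:Z * y.1%:Z.

(** Cramer's rule; for parallel lines, [det x y = 0], the value is [(0, 0)]. *)
Definition vert x y : R * R :=
  ((y.2%:R - x.2%:R) / (det x y)%:~R, (x.1%:R - y.1%:R) / (det x y)%:~R).

Lemma detR x y : (det x y)%:~R = x.1%:R * y.2%:R - x.2%:R * y.1%:R :> R.
Proof. by rewrite /det intrB !intrM. Qed.

Lemma crossR x y z : (cross x y z)%:~R =
  (y.1%:R - x.1%:R) * (z.2%:R - x.2%:R) - (y.2%:R - x.2%:R) * (z.1%:R - x.1%:R) :> R.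
Proof. by rewrite /cross intrB !intrM !intrB. Qed.

Lemma affE x a : aff (point_form x) a = a.1 * x.1%:R + a.2 * x.2%:R - 1.
Proof. by []. Qed.

Lemma neq_coordR x y : x != y -> (x.1%:R != y.1%:R :> R) || (x.2%:R != y.2%:R :> R).
Proof.
move=> xy; rewrite !eqr_nat -negb_and; apply: contra xy => /andP[/eqP h1 /eqP h2].
by apply/eqP/coord_inj; rewrite ?h1 ?h2.
Qed.

Lemma cross_det x y z : cross x y z = det x y + det y z - det x z.
Proof. by rewrite /cross /det; ring. Qed.

Lemma vert_on x y : det x y != 0 ->
  aff (point_form x) (vert x y) = 0 /\ aff (point_form y) (vert x y) = 0.
Proof.
move=> d; have d' : (det x y)%:~R != 0 :> R by rewrite intr_eq0.
by rewrite !affE /vert /=; move: d'; rewrite detR => d'; split; field.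
Qed.

Lemma vert_unique x y a : det x y != 0 ->
  aff (point_form x) a = 0 -> aff (point_form y) a = 0 -> a = vert x y.
Proof.
move=> d; have d' : (det x y)%:~R != 0 :> R by rewrite intr_eq0.
rewrite !affE => /eqP; rewrite subr_eq0 => /eqP ax /eqP; rewrite subr_eq0 => /eqP ay.
case: a ax ay => a1 a2 /= ax ay; rewrite /vert; congr pair; apply/(mulIf d').
  have ax' : a1 * x.1%:R = 1 - a2 * x.2%:R by move: ax; lra.
  have ay' : a1 * y.1%:R = 1 - a2 * y.2%:R by move: ay; lra.
  transitivity (y.2%:R * (a1 * x.1%:R) - x.2%:R * (a1 * y.1%:R)); first by rewrite detR; ring.
  by rewrite ax' ay' divfK//; ring.
have ax' : a2 * x.2%:R = 1 - a1 * x.1%:R by move: ax; lra.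
have ay' : a2 * y.2%:R = 1 - a1 * y.1%:R by move: ay; lra.
transitivity (x.1%:R * (a2 * y.2%:R) - y.1%:R * (a2 * x.2%:R)); first by rewrite detR; ring.
by rewrite ax' ay' divfK//; ring.
Qed.

Lemma det_trans x y z : nonzero x -> det x y = 0 -> det x z = 0 -> det y z = 0.
Proof.
move=> nx xy xz.
have e1 : x.1%:Z * det y z = y.1%:Z * det x z - z.1%:Z * det x y by rewrite /det; ring.
have e2 : x.2%:Z * det y z = y.2%:Z * det x z - z.2%:Z * det x y by rewrite /det; ring.
move: nx e1 e2; rewrite xy xz !mulr0 subrr /nonzero => /orP[] h /eqP + /eqP;
  rewrite !mulf_eq0 !eqz_nat (negbTE h) /=; first by move=> /eqP.
by move=> _ /eqP.
Qed.

Lemma det_neq0 x y a : x != y ->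
  aff (point_form x) a = 0 -> aff (point_form y) a = 0 -> det x y != 0.
Proof.
move=> xy; rewrite !affE => /eqP; rewrite subr_eq0 => /eqP ax /eqP; rewrite subr_eq0 => /eqP ay.
apply: contraNneq xy => d0; have dR : x.1%:R * y.2%:R - x.2%:R * y.1%:R = 0 :> R by rewrite -detR d0.
have e1 : x.1%:R * (a.1 * y.1%:R + a.2 * y.2%:R) - y.1%:R * (a.1 * x.1%:R + a.2 * x.2%:R)
    = a.2 * (x.1%:R * y.2%:R - x.2%:R * y.1%:R) by ring.
have e2 : x.2%:R * (a.1 * y.1%:R + a.2 * y.2%:R) - y.2%:R * (a.1 * x.1%:R + a.2 * x.2%:R)
    = - a.1 * (x.1%:R * y.2%:R - x.2%:R * y.1%:R) by ring.
apply/eqP/coord_inj; congr Posz; apply/eqP; rewrite -(eqr_nat R) -subr_eq0.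
  by move: e1; rewrite ax ay !mulr1 dR mulr0 => ->.
by move: e2; rewrite ax ay !mulr1 dR mulr0 => ->.
Qed.

Lemma collinear_aff x y z a : x != y -> cross x y z = 0 ->
  aff (point_form x) a = 0 -> aff (point_form y) a = 0 -> aff (point_form z) a = 0.
Proof.
move=> xy c0 ax ay.
have cR := crossR x y z; rewrite c0 in cR.
have e1 : a.1 * (y.1%:R - x.1%:R) + a.2 * (y.2%:R - x.2%:R) = 0.
  by move: ax ay; rewrite !affE; lra.
have : a.1 * (z.1%:R - x.1%:R) + a.2 * (z.2%:R - x.2%:R) = 0.
  case/orP: (neq_coordR xy) => h; rewrite eq_sym -subr_eq0 in h; apply: (mulfI h); rewrite mulr0.
    transitivity ((z.1%:R - x.1%:R) * (a.1 * (y.1%:R - x.1%:R) + a.2 * (y.2%:R - x.2%:R)) +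
      a.2 * ((y.1%:R - x.1%:R) * (z.2%:R - x.2%:R) - (y.2%:R - x.2%:R) * (z.1%:R - x.1%:R))).
      by ring.
    by rewrite e1 -cR !mulr0 addr0.
  transitivity ((z.2%:R - x.2%:R) * (a.1 * (y.1%:R - x.1%:R) + a.2 * (y.2%:R - x.2%:R)) -
      a.1 * ((y.1%:R - x.1%:R) * (z.2%:R - x.2%:R) - (y.2%:R - x.2%:R) * (z.1%:R - x.1%:R))).
    by ring.
  by rewrite e1 -cR !mulr0 subr0.
by move: ax; rewrite !affE; lra.
Qed.

Lemma cross_aff x y z a :
  aff (point_form x) a = 0 -> aff (point_form y) a = 0 -> aff (point_form z) a = 0 ->
  cross x y z = 0.
Proof.
move=> ax ay az; apply/eqP; rewrite -(intr_eq0 R) crossR.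
have e1 : a.1 * (y.1%:R - x.1%:R) + a.2 * (y.2%:R - x.2%:R) = 0.
  by move: ax ay; rewrite !affE; lra.
have e2 : a.1 * (z.1%:R - x.1%:R) + a.2 * (z.2%:R - x.2%:R) = 0.
  by move: ax az; rewrite !affE; lra.
have : (a.1 != 0) || (a.2 != 0).
  rewrite -negb_and; apply/negP => /andP[/eqP a1 /eqP a2].
  by move: ax; rewrite affE a1 a2 !(mul0r, add0r) => /eqP; rewrite oppr_eq0 oner_eq0.
case/orP => h; apply/eqP/(mulfI h); rewrite mulr0.
  transitivity ((a.1 * (y.1%:R - x.1%:R) + a.2 * (y.2%:R - x.2%:R)) * (z.2%:R - x.2%:R) -
     (y.2%:R - x.2%:R) * (a.1 * (z.1%:R - x.1%:R) + a.2 * (z.2%:R - x.2%:R))); first by ring.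
  by rewrite e1 e2 mul0r mulr0 subr0.
transitivity ((y.1%:R - x.1%:R) * (a.1 * (z.1%:R - x.1%:R) + a.2 * (z.2%:R - x.2%:R)) -
    (a.1 * (y.1%:R - x.1%:R) + a.2 * (y.2%:R - x.2%:R)) * (z.1%:R - x.1%:R)); first by ring.
by rewrite e1 e2 mul0r mulr0 subr0.
Qed.

Lemma flat_dual_line x : flat (dual_line x).
Proof. by apply: flatI_zero. Qed.

Lemma dual_line_two_points x : nonzero x ->
  exists a b, [/\ dual_line x a, dual_line x b & a <> b].
Proof.
move=> nx; pose X : R := x.1%:R; pose Y : R := x.2%:R.
have N0 : X ^+ 2 + Y ^+ 2 != 0.
  rewrite paddr_eq0 ?sqr_ge0// !sqrf_eq0 /X /Y !pnatr_eq0.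
  by rewrite negb_and.
exists (X / (X ^+ 2 + Y ^+ 2), Y / (X ^+ 2 + Y ^+ 2)).
exists (X / (X ^+ 2 + Y ^+ 2) - Y, Y / (X ^+ 2 + Y ^+ 2) + X); split.
- by split=> //=; rewrite affE /= -/X -/Y; field.
- by split=> //=; rewrite affE /= -/X -/Y; field.
case=> h1 h2; case/eqP: N0; have -> : X = 0 by lra.
by have -> : Y = 0 by [lra]; rewrite expr0n addr0.
Qed.

(* A piece boundary on the line of [x] is a direction seen from [x]; the direction
   of the origin gives no boundary, which compensates for the extra piece. *)
Lemma line_regions (o : G) x A Y : o.1 = 0%N :> nat -> o.2 = 0%N :> nat ->
  nonzero x -> x \notin A -> o \notin A ->
  Y \subset o |: A ->
  {in Y &, forall y y', y != y' -> cross x y y' != 0} ->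
  {in o |: A, forall z, exists2 y, y \in Y & cross x y z = 0} ->
  #|regions point_form (dual_line x) A| = #|Y|.
Proof.
move=> o1 o2 nx xA oA /fintype.subsetP YA Ycr Yex.
have xo : x != o.
  by apply: contraTneq nx => ->; rewrite /nonzero o1 o2.
(* [y0] represents the direction of the origin. Grid points in that direction are dual to parallels
   of the line of [x], so [y0] is the one representative that yields no vertex. *)
have [y0 y0Y cy0] := Yex o (setU11 _ _).
have Yx y : y \in Y -> x != y.
  move=> /YA; rewrite !inE => /orP[/eqP -> //|yA].
  by apply: contraNneq xA => ->.
have cdet y : cross x y o = det x y by rewrite /cross /det o1 o2; ring.
have on0 a : aff (point_form x) a = 0 -> aff (point_form o) a <> 0.
  by move=> _; rewrite affE o1 o2 !(mulr0, add0r) => /eqP; rewrite oppr_eq0 oner_eq0.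
have dY y : y \in Y -> y != y0 -> det x y != 0.
  move=> yY yy0; apply/negP => /eqP d0.
  have := Ycr _ _ y0Y yY; rewrite eq_sym yy0 => /(_ isT) /eqP; apply.
  by rewrite cross_det d0 subr0 -cdet cy0 add0r (det_trans nx _ d0)// -cdet.
pose Y' := (Y :\ y0)%SET.
have Y'P y : y \in Y' -> [/\ y \in Y, y != y0, det x y != 0 & y \in A].
  rewrite !inE => /andP[yy0 yY]; have d := dY y yY yy0; split=> //.
  have := YA _ yY; rewrite !inE => /orP[/eqP yo|//].
  by move: d; rewrite yo /det o1 o2 !mulr0 subrr eqxx.
have vertP y : y \in Y' -> aff (point_form x) (vert x y) = 0 /\ aff (point_form y) (vert x y) = 0.
  by move=> /Y'P[_ _ d _]; exact: vert_on.
rewrite (@regions_line _ _ _ _ _ [seq vert x y | y <- enum Y']).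
- by rewrite size_map -cardE [RHS](cardsD1 y0) y0Y.
- exact: flat_dual_line.
- exact: dual_line_two_points.
- move=> i a b iA [_ ax] [_ bx] ai bi.
  have xi : x != i by apply: contraNneq xA => ->.
  have d := det_neq0 xi ax ai.
  by rewrite (vert_unique d ax ai) (vert_unique d bx bi).
- rewrite map_inj_in_uniq ?enum_uniq// => y y'; rewrite !mem_enum => yY' yY2 e.
  have [h1 h2] := vertP _ yY'; have [h3 h4] := vertP _ yY2; rewrite -e in h4.
  apply/eqP/negPn/negP => yy'.
  have [yY _ _ _] := Y'P _ yY'; have [yY3 _ _ _] := Y'P _ yY2.
  by have := Ycr _ _ yY yY3 yy'; rewrite (cross_aff h1 h2 h4) eqxx.
move=> a; split.
  move=> /mapP[y]; rewrite mem_enum => yY' ->; have [h1 h2] := vertP _ yY'.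
  have [_ _ _ yA] := Y'P _ yY'; split; first by split.
  by exists y.
move=> [[_ /= ax] [i iA ai]].
have xi : x != i by apply: contraNneq xA => ->.
have [|y yY cyi] := Yex i; first by rewrite !inE iA orbT.
have ay : aff (point_form y) a = 0.
  by apply: (collinear_aff xi _ ax ai); rewrite /cross; move: cyi; rewrite /cross; lia.
have yy0 : y != y0.
  apply/eqP => e; apply: (on0 _ ax); apply: (collinear_aff (Yx _ y0Y) cy0 ax).
  by rewrite -e.
apply/mapP; exists y; first by rewrite mem_enum !inE yy0.
by apply: vert_unique => //; apply: dY.
Qed.

End GridLines.

Lemma card_pairs (T1 T2 : finType) (P : T1 -> T2 -> bool) :
  #|[set p | P p.1 p.2]%SET| = (\sum_x #|[set y | P x y]%SET|)%N.
Proof.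
rewrite -sum1dep_card -(pair_big_dep xpredT P (fun _ _ => 1%N)) /=.
by apply: eq_bigr => x _; rewrite sum1dep_card.
Qed.

Lemma coprimez_collinear (d1 d2 e1 e2 : int) : coprimez d1 d2 -> coprimez e1 e2 ->
  d1 * e2 - d2 * e1 = 0 -> (e1 = d1 /\ e2 = d2) \/ (e1 = - d1 /\ e2 = - d2).
Proof.
move=> /coprimezP[[u v] /= uv] /coprimezP[[u' v'] /= uv'] c.
pose k := u * e1 + v * e2.
have E1 : e1 = k * d1.
  transitivity ((u * d1 + v * d2) * e1); first by rewrite uv mul1r.
  transitivity (k * d1 - v * (d1 * e2 - d2 * e1)); first by rewrite /k; ring.
  by rewrite c mulr0 subr0.
have E2 : e2 = k * d2.
  transitivity ((u * d1 + v * d2) * e2); first by rewrite uv mul1r.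
  transitivity (k * d2 + u * (d1 * e2 - d2 * e1)); first by rewrite /k; ring.
  by rewrite c mulr0 addr0.
have k1 : k * (u' * d1 + v' * d2) = 1 by rewrite -uv' E1 E2; ring.
have := congr1 absz k1; rewrite abszM => /eqP; rewrite muln_eq1 => /andP[/eqP h _].
have [k'|k'] : k = 1 \/ k = -1 by lia.
  by left; rewrite E1 E2 k' !mul1r.
by right; rewrite E1 E2 k' !mulN1r.
Qed.

Section GridCounts.
Variables (R : realType) (m n : nat).
Local Notation G := ('I_m * 'I_n)%type.
Local Notation point_form := (@point_form R m n).
Local Notation dual_line := (@dual_line R m n).
Implicit Types (x y z : G) (A B Y : {set G}) (a b : R * R).

Definition rank x : nat := (x.1 * n + x.2)%N.

Lemma rank_inj : injective rank.
Proof.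
move=> x y; rewrite /rank => e.
have x2 := ltn_ord x.2; have y2 := ltn_ord y.2.
have e1 : x.1 = y.1 :> nat.
  by rewrite -[LHS](addn0) -(divn_small x2) -divnMDl ?e ?divnMDl ?divn_small ?addn0//; lia.
by apply: coord_inj; congr Posz => //; move: e; rewrite e1 => /addnI.
Qed.

Definition prim x y := coprimez (y.1%:Z - x.1%:Z) (y.2%:Z - x.2%:Z).

Definition reflectable x y :=
  [&& y.1 <= x.1.*2, x.1.*2 < y.1 + m, y.2 <= x.2.*2 & x.2.*2 < y.2 + n]%N.

Lemma reflectableP x y : reflect
  (exists z : G, z.1%:Z = x.1%:Z *+ 2 - y.1%:Z /\ z.2%:Z = x.2%:Z *+ 2 - y.2%:Z)
  (reflectable x y).
Proof.
apply: (iffP and4P) => [[h1 h2 h3 h4]|[z [e1 e2]]].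
  have k1 : (x.1.*2 - y.1 < m)%N by lia.
  have k2 : (x.2.*2 - y.2 < n)%N by lia.
  by exists (Ordinal k1, Ordinal k2) => /=; split; lia.
by have := ltn_ord z.1; have := ltn_ord z.2; split; lia.
Qed.

Lemma prim_neq x y : prim x y -> x != y.
Proof. by apply: contraTneq => ->; rewrite /prim !subrr. Qed.

(** [y] is the first lattice point after [x] on the segment to [z], hence in the grid. As [rank] is
    affine, its comparison with [rank x] depends on the direction only. *)
Lemma prim_toward x z : x != z ->
  exists y, [/\ prim x y, cross x y z = 0 & (rank y < rank x)%N = (rank z < rank x)%N].
Proof.
move=> xz; pose e1 := z.1%:Z - x.1%:Z; pose e2 := z.2%:Z - x.2%:Z.
pose c := gcdz e1 e2.
have c0 : 0 < c.
  rewrite lt_neqAle le0z_nat andbT eq_sym gcdz_eq0; apply: contra xz.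
  by rewrite !subr_eq0 => /andP[/eqP h1 /eqP h2]; apply/eqP/coord_inj.
pose d1 := (e1 %/ c)%Z; pose d2 := (e2 %/ c)%Z.
have E1 : e1 = d1 * c by rewrite divzK// dvdz_gcdl.
have E2 : e2 = d2 * c by rewrite divzK// dvdz_gcdr.
have [y [y1 y2]] : exists y : G, x.1%:Z + d1 = y.1%:Z /\ x.2%:Z + d2 = y.2%:Z.
  apply: grid_boxE.
  apply: (@in_box_conv3 _ c 0 _ _ z.1%:Z z.1%:Z x.1%:Z z.2%:Z z.2%:Z x.2%:Z);
    rewrite ?grid_boxP//; move: E1 E2; rewrite /e1 /e2; lia.
exists y; split.
- rewrite /prim -y1 -y2 ![_ + _ - _]addrAC !subrr !add0r.
  apply/eqP/(mulIf (lt0r_neq0 c0)).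
  by rewrite mul1r -[X in _ * X](gez0_abs (ltW c0)) mulz_gcdl -E1 -E2.
- rewrite /cross -y1 -y2 -/e1 -/e2 E1 E2; ring.
have r w : (rank w)%:Z = w.1%:Z * n%:Z + w.2%:Z by rewrite /rank PoszD PoszM.
rewrite -!ltz_nat -[LHS]subr_lt0 -[RHS]subr_lt0 !r.
have -> : z.1%:Z * n + z.2%:Z - (x.1%:Z * n + x.2%:Z) = e1 * n + e2 by rewrite /e1 /e2; ring.
have -> : y.1%:Z * n + y.2%:Z - (x.1%:Z * n + x.2%:Z) = d1 * n + d2 by rewrite -y1 -y2; ring.
by rewrite E1 E2 (_ : _ + d2 * c = (d1 * n + d2) * c) ?pmulr_llt0//; ring.
Qed.

Lemma prim_collinear x y y' : prim x y -> prim x y' -> cross x y y' = 0 -> y <> y' ->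
  [/\ y'.1%:Z = x.1%:Z *+ 2 - y.1%:Z, y'.2%:Z = x.2%:Z *+ 2 - y.2%:Z,
      reflectable x y & reflectable x y'].
Proof.
move=> p p' c yy'; have [[e1 e2]|[e1 e2]] := coprimez_collinear p p' c.
  by case: yy'; apply: coord_inj; lia.
by split; [lia|lia|apply/reflectableP; exists y'; split; lia|
  apply/reflectableP; exists y; split; lia].
Qed.

Lemma reflect_rank x y y' : y'.1%:Z = x.1%:Z *+ 2 - y.1%:Z ->
  y'.2%:Z = x.2%:Z *+ 2 - y.2%:Z -> (rank y' + rank y)%N = (rank x).*2.
Proof.
move=> h1 h2; have a1 : (y'.1 + y.1 = x.1.*2)%N by lia.
have a2 : (y'.2 + y.2 = x.2.*2)%N by lia.
by rewrite /rank addnACA -mulnDl a1 a2 doubleD -doubleMl.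
Qed.

Section WithOrigin.
Variable o : G.
Hypotheses (o1 : o.1 = 0%N :> nat) (o2 : o.2 = 0%N :> nat).

Lemma rank_origin : rank o = 0%N.
Proof. by rewrite /rank o1 o2. Qed.

Lemma nonzeroE x : nonzero x = (x != o).
Proof.
apply/idP/idP => [|xo].
  by apply: contraTneq => ->; rewrite /nonzero o1 o2.
rewrite /nonzero -negb_and; apply: contra xo => /andP[/eqP h1 /eqP h2].
by apply/eqP/coord_inj; rewrite ?h1 ?h2 ?o1 ?o2.
Qed.

Lemma rank_gt0 x : (0 < rank x)%N = nonzero x.
Proof. by rewrite nonzeroE lt0n -(inj_eq rank_inj) rank_origin. Qed.

Definition lower x : {set G} := [set y | (rank y < rank x)%N && prim x y]%SET.

Definition prefix_points k : {set G} := [set x | nonzero x && (rank x < k)%N]%SET.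

(** Opposite primitive neighbours have ranks with mean [rank x], so at most one of them is lower,
    and every earlier point is seen in the direction of a lower one: [lower x] represents each
    direction once. *)
Lemma regions_lower x : nonzero x ->
  #|regions point_form (dual_line x) (prefix_points (rank x))| = #|lower x|.
Proof.
move=> nx; apply: (@line_regions R m n o) => //.
- by rewrite inE ltnn andbF.
- by rewrite inE nonzeroE eqxx.
- apply/fintype.subsetP => y; rewrite !inE => /andP[-> _].
  by rewrite nonzeroE andbT orbN.
- move=> y y'; rewrite !inE => /andP[yx p] /andP[yx' p'] yy'; apply/eqP => c.
  have [h1 h2 _ _] := prim_collinear p p' c (elimN eqP yy').
  by have := reflect_rank h1 h2; lia.
move=> z zA; have zx : (rank z < rank x)%N.
  by move: zA; rewrite !inE => /orP[/eqP ->|/andP[]//]; rewrite rank_origin rank_gt0.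
have [|y [py cy ry]] := @prim_toward x z; first by apply: contraTneq zx => ->; rewrite ltnn.
by exists y => //; rewrite inE ry zx.
Qed.

Lemma regions_prefix k : #|regions point_form setT (prefix_points k)| =
  (1 + \sum_(x : G | (rank x < k)%N) #|lower x|)%N.
Proof.
elim: k => [|k IHk].
  rewrite big_pred0 // (_ : prefix_points 0 = finset.set0); last first.
    by apply/setP => x; rewrite !inE ltn0 andbF.
  by rewrite regions0//; exists (0, 0).
have [[x rx]|nok] := pselect (exists x, rank x = k); last first.
  rewrite (_ : prefix_points k.+1 = prefix_points k).
    rewrite IHk; congr addn; apply: eq_bigl => x; rewrite [RHS]ltnS [RHS]leq_eqVlt.
    by case: eqP => // e; case: nok; exists x.
  apply/setP => x; rewrite !inE ltnS leq_eqVlt.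
  by case: eqP => // e; case: nok; exists x.
rewrite (bigD1 x) /=; last by rewrite rx.
have -> : (\sum_(i : G | (rank i < k.+1) && (i != x)) #|lower i| =
           \sum_(i : G | rank i < k) #|lower i|)%N.
  apply: eq_bigl => i; rewrite ltnS leq_eqVlt -rx (inj_eq rank_inj).
  by case: eqVneq => [->|]; rewrite ?ltnn ?andbF ?andbT.
have [nx|zx] := boolP (nonzero x).
  have -> : prefix_points k.+1 = x |: prefix_points k.
    apply/setP => i; rewrite !inE ltnS leq_eqVlt -rx (inj_eq rank_inj).
    by case: eqVneq => [->|]; rewrite ?nx.
  rewrite regionsU1 ?IHk; last 3 first.
  - by [].
  - by rewrite inE rx ltnn andbF.
  - exists (0, 0) => //; rewrite affE /= !mul0r !add0r oppr_eq0; exact: oner_neq0.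
  by rewrite -rx (regions_lower nx) -addnA [(_ + #|lower x|)%N]addnC.
have xo : x = o by move: zx; rewrite nonzeroE negbK => /eqP.
have -> : prefix_points k.+1 = prefix_points k.
  apply/setP => i; rewrite !inE -rx xo rank_origin ltn0 ltnS leqn0 andbF.
  by rewrite -rank_gt0 lt0n andNb.
rewrite IHk (_ : #|lower x| = 0%N) ?add0n//.
by apply: eq_card0 => y; rewrite inE xo rank_origin.
Qed.

Lemma rank_lt x : (rank x < m * n)%N.
Proof.
have x1 := ltn_ord x.1; have x2 := ltn_ord x.2.
apply: (@leq_trans ((x.1).+1 * n)); first by rewrite /rank mulSn addnC ltn_add2r.
by rewrite leq_mul2r x1 orbT.
Qed.

Definition nonzeros : {set G} := [set x | nonzero x]%SET.

Lemma card_regions : #|regions point_form setT nonzeros| =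
  (1 + #|[set p : G * G | (rank p.2 < rank p.1)%N && prim p.1 p.2]%SET|)%N.
Proof.
have -> : nonzeros = prefix_points (m * n).
  by apply/setP => x; rewrite !inE rank_lt andbT.
rewrite regions_prefix (card_pairs (fun x y => (rank y < rank x)%N && prim x y)).
by congr addn; apply: eq_bigl => x; rewrite rank_lt.
Qed.

(** A direction through [x] carries at most two primitive neighbours, [y] and [2x - y]. When both
    are in G the lower one is kept, otherwise the only one. *)
Lemma card_line_regions x : nonzero x ->
  #|regions point_form (dual_line x) (nonzeros :\ x)| =
  #|[set y | prim x y && ((rank y < rank x)%N || ~~ reflectable x y)]%SET|.
Proof.
move=> nx; apply: (@line_regions R m n o) => //.
- by rewrite !inE eqxx.
- by rewrite !inE nonzeroE eqxx andbF.
- apply/fintype.subsetP => y; rewrite !inE => /andP[/prim_neq xy _].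
  by rewrite [y == x]eq_sym xy nonzeroE orbN.
- move=> y y'; rewrite !inE => /andP[p h] /andP[p' h'] yy'; apply/eqP => c.
  have [h1 h2 r r'] := prim_collinear p p' c (elimN eqP yy').
  by move: h h'; rewrite r r' !orbF; have := reflect_rank h1 h2; lia.
move=> z zA; have zx : x != z.
  move: zA; rewrite !inE => /orP[/eqP ->|/andP[]//]; last by rewrite eq_sym.
  by rewrite -nonzeroE.
have [y [py cy ry]] := prim_toward zx.
have [hy|] := boolP ((rank y < rank x)%N || ~~ reflectable x y).
  by exists y => //; rewrite inE py.
rewrite negb_or negbK -leqNgt => /andP[xy /reflectableP[y' [h1 h2]]].
exists y'; last first.
  by rewrite -[RHS]oppr0 -cy /cross h1 h2; ring.
have py' : prim x y'.
  rewrite /prim h1 h2 (_ : _ - _ = - (y.1%:Z - x.1%:Z)); last by ring.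
  rewrite (_ : _ *+ 2 - _ - _ = - (y.2%:Z - x.2%:Z)); last by ring.
  by rewrite /coprimez gcdzN gcdNz.
rewrite inE py' /=; apply/orP; left.
have := reflect_rank h1 h2; have := prim_neq py; rewrite -(inj_eq rank_inj); lia.
Qed.

End WithOrigin.
End GridCounts.

(** * Pairs of grid points by the gcd of their difference *)

Lemma sum_open_rangeS (V : zmodType) (h : int -> V) m :
  \sum_(i <- open_range m.+2) h i =
  \sum_(i <- open_range m.+1) h i + h m.+1%:Z + h (- m.+1%:Z).
Proof.
have iotaSS N : iota 0 N.+2 = 0%N :: rcons [seq k.+1 | k <- iota 0 N] N.+1.
  have -> : iota 0 N.+2 = 0%N :: iota 1 (N + 1) by rewrite addn1.
  by rewrite iotaD cats1 -[X in iota X N](addn0 1) iotaDl !add1n.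
rewrite /open_range !big_map (_ : (m.+2).*2.-1 = (m.+1).*2.-1.+2); last by lia.
rewrite iotaSS big_cons big_rcons big_map addrC.
rewrite (eq_bigr (fun k => h (k.+1%:Z - m.+1%:Z))); last by move=> k _; congr h; lia.
by congr (_ + h _ + h _); lia.
Qed.

(** The weight [m - |i|] is the number of pairs in [E_m] with difference [i]; this turns [f] into a
    count of ordered pairs of grid points. *)
Lemma sum_differences (h : int -> int) m :
  \sum_(a < m) \sum_(b < m) h (b%:Z - a%:Z) =
  \sum_(i <- open_range m) (m%:Z - `|i|) * h i.
Proof.
case: m => [|m]; first by rewrite big_ord0 /open_range big_nil.
elim: m => [|m IHm].
  by rewrite !big_ord1 /open_range /= big_seq1 !subrr normr0 subr0 mul1r.
(* The row and the column added to the square realize each difference of the new range exactly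
   once. *)
have E : \sum_(a < m.+1) h (m.+1%:Z - a%:Z) + \sum_(a < m.+1) h (a%:Z - m.+1%:Z) + h 0 =
    \sum_(i <- open_range m.+2) h i.
  elim: m {IHm} => [|m IHm].
    by rewrite sum_open_rangeS /open_range /= !big_ord1 big_seq1 !subr0 sub0r subrr; ring.
  rewrite sum_open_rangeS -IHm [in LHS]big_ord_recl [X in _ + X + _]big_ord_recl /=.
  rewrite (eq_bigr (fun a : 'I_m.+1 => h (m.+1%:Z - a%:Z))); last first.
    by move=> a _; congr h; rewrite /bump /= add1n; lia.
  rewrite [X in _ + (_ + X) + _ = _](eq_bigr (fun a : 'I_m.+1 => h (a%:Z - m.+1%:Z))); last first.
    by move=> a _; congr h; rewrite /bump /= add1n; lia.
  by rewrite !subr0 sub0r; ring.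
rewrite big_ord_recr /= (eq_bigr (fun a : 'I_m.+1 =>
    \sum_(b < m.+1) h (b%:Z - a%:Z) + h (m.+1%:Z - a%:Z))); last first.
  by move=> a _; rewrite big_ord_recr.
rewrite big_split IHm [X in _ + X = _]big_ord_recr subrr /=.
transitivity (\sum_(i <- open_range m.+2) h i + \sum_(i <- open_range m.+1) (m.+1%:Z - `|i|) * h i).
  by rewrite -E; ring.
rewrite !sum_open_rangeS (eq_bigr (fun i => h i + (m.+1%:Z - `|i|) * h i) (r := open_range m.+1)
  (F1 := fun i => (m.+2%:Z - `|i|) * h i)); last first.
  by move=> i _; rewrite (_ : m.+2%:Z = m.+1%:Z + 1); [ring|lia].
rewrite big_split /= normrN (_ : m.+2%:Z - `|m.+1%:Z| = 1); first by ring.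
by lia.
Qed.

Section PairCounts.
Variables (m n : nat).
Local Notation G := ('I_m * 'I_n)%type.
Local Notation rank := (@rank m n).
Local Notation prim := (@prim m n).
Local Notation reflectable := (@reflectable m n).
Implicit Types (x y z : G).

Definition gcd2 x y := gcdz (y.1%:Z - x.1%:Z) (y.2%:Z - x.2%:Z).

Lemma card_gcd_pairs q :
  #|[set p : G * G | gcd2 p.1 p.2 == q%:Z]%SET|%:Z = f q m n.
Proof.
rewrite (card_pairs (fun x y => gcd2 x y == q%:Z)).
pose F x y : int := (gcd2 x y == q%:Z)%:R.
transitivity (\sum_(x : G) \sum_(y : G) F x y).
  rewrite (big_morph Posz PoszD (erefl 0)); apply: eq_bigr => x _.
  rewrite -sum1dep_card (big_morph Posz PoszD (erefl 0)) big_mkcond /=.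
  by apply: eq_bigr => y _; rewrite /F; case: eqP.
pose h (i j : int) : int := (gcdz i j == q%:Z)%:R.
transitivity (\sum_(i < m) \sum_(i' < m) \sum_(j < n) \sum_(j' < n)
    h (i'%:Z - i%:Z) (j'%:Z - j%:Z)).
  rewrite -(pair_bigA _ (fun (i : 'I_m) (j : 'I_n) => \sum_(y : G) h (y.1%:Z - i%:Z) (y.2%:Z - j%:Z))) /=.
  apply: eq_bigr => i _; rewrite exchange_big /=.
  rewrite -(pair_bigA _ (fun (i' : 'I_m) (j' : 'I_n) => \sum_(j < n) h (i'%:Z - i%:Z) (j'%:Z - j%:Z))) /=.
  by apply: eq_bigr => i' _; rewrite exchange_big.
transitivity (\sum_(i < m) \sum_(i' < m) (\sum_(j <- open_range n) (n%:Z - `|j|) * h (i'%:Z - i%:Z) j)).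
  by apply: eq_bigr => i _; apply: eq_bigr => i' _; rewrite (sum_differences (h _)).
rewrite (sum_differences (fun i => \sum_(j <- open_range n) (n%:Z - `|j|) * h i j)).
apply: eq_bigr => i _; rewrite big_distrr /= [RHS]big_mkcond /=.
by apply: eq_bigr => j _; rewrite /h; case: eqP; rewrite ?mulr1 ?mulr0.
Qed.

Lemma primE x y : prim x y = (gcd2 x y == 1%:Z).
Proof. by []. Qed.

Lemma gcd2_sym x y : gcd2 x y = gcd2 y x.
Proof. by rewrite /gcd2 -(opprB x.1%:Z) -(opprB x.2%:Z) gcdzN gcdNz. Qed.

Definition below q : {set G * G} :=
  [set p | (rank p.2 < rank p.1)%N && (gcd2 p.1 p.2 == q%:Z)]%SET.

Definition above q : {set G * G} :=
  [set p | (rank p.1 < rank p.2)%N && (gcd2 p.1 p.2 == q%:Z)]%SET.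

Lemma card_above q : #|above q| = #|below q|.
Proof.
pose sw (p : G * G) := (p.2, p.1).
have swI : injective sw by move=> [a b] [c d] [-> ->].
rewrite -(card_imset _ swI); apply: eq_card => -[a b].
apply/imsetP/idP => [[[c d]]|]; rewrite !inE /=.
  by rewrite gcd2_sym => /andP[h1 h2] [-> ->]; rewrite h1.
by rewrite gcd2_sym => h; exists (b, a); rewrite ?inE.
Qed.

Lemma card_gcd_half q : (0 < q)%N ->
  #|[set p : G * G | gcd2 p.1 p.2 == q%:Z]%SET| = (2 * #|below q|)%N.
Proof.
move=> q0; rewrite mul2n -addnn -{2}card_above -cardsUI.
rewrite [X in (_ + X)%N]eq_card0 ?addn0; last first.
  by move=> p; rewrite !inE; case: ltngtP; rewrite /= ?andbF.
apply: eq_card => p; rewrite !inE -andb_orl.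
case: ltngtP => //= /(@rank_inj m n) ->.
by rewrite /gcd2 !subrr gcd0z; apply/negbTE; move: q0; case: (q).
Qed.

Definition middles : {set G * G} :=
  [set p | [&& (rank p.1 < rank p.2)%N, prim p.1 p.2 & reflectable p.1 p.2]]%SET.

(** [x] is the midpoint of [2x - y] and [y], whose difference is twice a primitive vector;
    conversely a pair with gcd 2 has a midpoint in the grid. The default value in [rf] is never
    taken on [middles]. *)
Lemma card_middles : #|middles| = #|above 2|.
Proof.
pose rf x y : G := odflt x [pick z : G | (z.1%:Z == x.1%:Z *+ 2 - y.1%:Z) &&
   (z.2%:Z == x.2%:Z *+ 2 - y.2%:Z)].
have rfP x y : reflectable x y -> (rf x y).1%:Z = x.1%:Z *+ 2 - y.1%:Z /\
    (rf x y).2%:Z = x.2%:Z *+ 2 - y.2%:Z.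
  move=> /reflectableP[z [h1 h2]]; rewrite /rf; case: pickP => [w /andP[/eqP -> /eqP ->]//|].
  by move=> /(_ z); rewrite h1 h2 !eqxx.
have injrf : {in middles &, injective (fun p => (rf p.1 p.2, p.2))}.
  move=> [x y] [x' y']; rewrite !inE /= => /and3P[_ _ r] /and3P[_ _ r'] [e ey].
  have [h1 h2] := rfP _ _ r; have [h3 h4] := rfP _ _ r'.
  rewrite e -ey in h1 h2; rewrite -ey in h3 h4.
  by congr pair => //; apply: coord_inj; lia.
rewrite -(card_in_imset injrf); apply: eq_card => -[u y].
apply/imsetP/idP => [[[x y']]|]; rewrite !inE /=.
  move=> /and3P[h p r] [-> ->]; have [h1 h2] := rfP _ _ r.
  have hr := reflect_rank h1 h2; apply/andP; split; first by lia.
  rewrite /gcd2 h1 h2; rewrite /prim in p.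
  have -> : y'.1%:Z - (x.1%:Z *+ 2 - y'.1%:Z) = 2 * (y'.1%:Z - x.1%:Z) by ring.
  have -> : y'.2%:Z - (x.2%:Z *+ 2 - y'.2%:Z) = 2 * (y'.2%:Z - x.2%:Z) by ring.
  by rewrite -mulz_gcdr (eqP p).
move=> /andP[h /eqP g].
have d1 : (2 %| y.1%:Z - u.1%:Z)%Z by rewrite -[2]g dvdz_gcdl.
have d2 : (2 %| y.2%:Z - u.2%:Z)%Z by rewrite -[2]g dvdz_gcdr.
have k1 : ((u.1 + y.1) %/ 2 < m)%N by have := ltn_ord u.1; have := ltn_ord y.1; lia.
have k2 : ((u.2 + y.2) %/ 2 < n)%N by have := ltn_ord u.2; have := ltn_ord y.2; lia.
pose x : G := (Ordinal k1, Ordinal k2).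
have half (a b : nat) : (2 %| b%:Z - a%:Z)%Z -> a%:Z = ((a + b) %/ 2)%N%:Z *+ 2 - b%:Z.
  by move=> /dvdzP[k ek]; rewrite mulr2n; lia.
have e1 : u.1%:Z = x.1%:Z *+ 2 - y.1%:Z by exact: half.
have e2 : u.2%:Z = x.2%:Z *+ 2 - y.2%:Z by exact: half.
have r : reflectable x y by apply/reflectableP; exists u.
exists (x, y); last first.
  by have [h1 h2] := rfP _ _ r; congr pair; apply: coord_inj; rewrite ?h1 ?h2.
rewrite inE /= r andbT; have hr := reflect_rank e1 e2; apply/andP; split; first by lia.
rewrite /prim /coprimez; apply/eqP.
have : 2 * gcdz (y.1%:Z - x.1%:Z) (y.2%:Z - x.2%:Z) = 2 * 1; last by apply: mulfI.
rewrite mulr1 -[RHS]g /gcd2 e1 e2 (_ : 2 = `|2|%:Z)// mulz_gcdr.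
by congr gcdz; ring.
Qed.

Section Origin.
Variable o : G.
Hypotheses (o1 : o.1 = 0%N :> nat) (o2 : o.2 = 0%N :> nat).

Definition primitives : {set G} := [set y | prim o y]%SET.

Lemma card_primitives : (2 <= m)%N -> (2 <= n)%N -> #|primitives| = (s m n + 2)%N.
Proof.
move=> m2 n2; have n0 : (0 < n)%N by exact: leq_trans n2.
have m0 : (0 < m)%N by exact: leq_trans m2.
pose p1 : G := (Ordinal m0, Ordinal n2); pose p2 : G := (Ordinal m2, Ordinal n0).
have E : primitives = ([set x : G | [&& (0 < x.1)%N, (0 < x.2)%N & coprime x.1 x.2]]
    :|: [set p1; p2])%SET.
  apply/setP => y; rewrite !inE /prim o1 o2 !subr0 /coprimez /gcdz /= eqz_nat.
  rewrite -/(coprime _ _); case: y => [[i hi] [j hj]] /=.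
  rewrite -!pair_eqE /pair_eq /= -!val_eqE /= /coprime.
  by case: i hi => [|i] hi; case: j hj => [|j] hj; rewrite /= ?gcd0n ?gcdn0 ?andbF ?orbF ?andbT.
rewrite E cardsU [X in (_ - X)%N](_ : _ = 0%N); last first.
  apply: eq_card0 => x; rewrite !inE; apply/negbTE/negP.
  by move=> /andP[/and3P[h1 h2 _] /orP[]/eqP e]; move: h1 h2; rewrite e.
rewrite subn0 cards2; by congr addn; rewrite cardsE.
Qed.

Lemma reflectable_origin y : reflectable o y -> ~~ prim o y.
Proof.
rewrite /reflectable o1 o2 !leqn0 => /and4P[/eqP h1 _ /eqP h2 _].
by rewrite /prim o1 o2 h1 h2.
Qed.

(** The ordered primitive pairs that the edge count omits are those with [y] after [x] and [2x - y]
    in G. The origin has no line, and none of its neighbours is reflectable, so it accounts for all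
    [primitives]. *)
Lemma card_edge_pairs :
  ((\sum_(x : G | nonzero x)
     #|[set y | prim x y && ((rank y < rank x) || ~~ reflectable x y)]%SET|) +
   #|primitives| + #|middles| = #|[set p : G * G | gcd2 p.1 p.2 == 1%:Z]%SET|)%N.
Proof.
have -> : #|primitives| = #|[set y | prim o y && ((rank y < rank o) || ~~ reflectable o y)%N]%SET|.
  apply: eq_card => y; rewrite !inE (rank_origin o1 o2) ltn0 /=.
  by case: (boolP (prim o y)) => // p; apply/esym; apply: contraL p; apply: reflectable_origin.
have -> : (\sum_(x : G | nonzero x)
     #|[set y | prim x y && ((rank y < rank x) || ~~ reflectable x y)]%SET| +
   #|[set y | prim o y && ((rank y < rank o) || ~~ reflectable o y)]%SET| =
   \sum_(x : G) #|[set y | prim x y && ((rank y < rank x) || ~~ reflectable x y)]%SET|)%N.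
  rewrite [RHS](bigD1 o) //= addnC; congr addn; apply: eq_bigl => x.
  by rewrite (nonzeroE o1 o2).
rewrite -(card_pairs (fun x y => prim x y && ((rank y < rank x) || ~~ reflectable x y))%N).
rewrite -cardsUI [X in (_ + X)%N]eq_card0 ?addn0.
  apply: eq_card => p; rewrite !inE /= -primE.
  have [pp|_] := boolP (prim p.1 p.2); last by rewrite /= ?andbF.
  rewrite /= ?andbT.
  have := prim_neq pp; rewrite -(inj_eq (@rank_inj m n)).
  by case: ltngtP; case: reflectable.
by move=> p; rewrite !inE; case: ltngtP; case: reflectable; rewrite ?andbF ?andbT.
Qed.

(** A vertex is dual to a line that misses the origin and carries at least two grid points; it is
    encoded by the first two in rank order. A missing reflection says that [x] comes first. *)
Definition vertex_pairs : {set G * G} :=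
  [set p | [&& nonzero p.1, (rank p.1 < rank p.2)%N, prim p.1 p.2 & ~~ reflectable p.1 p.2]]%SET.

Lemma card_vertex_pairs : (#|vertex_pairs| + #|primitives| + #|middles| = #|above 1|)%N.
Proof.
have -> : #|primitives| = #|[set p : G * G | (p.1 == o) && prim p.1 p.2]%SET|.
  rewrite (card_pairs (fun x y => (x == o) && prim x y)) (bigD1 o) //= big1 ?addn0.
    by apply: eq_card => y; rewrite !inE eqxx.
  by move=> x xo; apply: eq_card0 => y; rewrite inE (negbTE xo).
rewrite -cardsUI [X in (_ + X + _)%N]eq_card0 ?addn0; last first.
  move=> p; rewrite !inE (nonzeroE o1 o2); case: eqP; rewrite //= ?andbF//.
rewrite -cardsUI [X in (_ + X)%N]eq_card0 ?addn0; last first.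
  move=> [x y]; rewrite !inE /=; apply/negbTE/negP => /andP[h /and3P[_ p r]].
  case/orP: h => [/and4P[_ _ _]|/andP[/eqP e _]]; first by rewrite r.
  by move: p; apply/negP; rewrite e; apply: reflectable_origin; rewrite -e.
apply: eq_card => -[x y]; rewrite !inE /= -primE (nonzeroE o1 o2).
have [p|] := boolP (prim x y); rewrite ?andbF//= !andbT.
have [xo|] := eqVneq x o; rewrite /= ?orbF.
  have := prim_neq p; rewrite xo (rank_origin o1 o2) => yo.
  by rewrite (rank_gt0 o1 o2) (nonzeroE o1 o2) eq_sym yo.
by case: reflectable; rewrite ?andbF ?andbT ?orbF.
Qed.

End Origin.
End PairCounts.

(** * Regions at infinity *)

Section Central.
Variables (R : realType) (m n : nat).
Hypotheses (m2 : (2 <= m)%N) (n2 : (2 <= n)%N).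
Local Notation G := ('I_m * 'I_n)%type.
Local Notation rank := (@rank m n).
Local Notation prim := (@prim m n).
Variable o : G.
Hypotheses (o1 : o.1 = 0%N :> nat) (o2 : o.2 = 0%N :> nat).
Implicit Types (x y z : G).

Definition direction_form x : R * R * R := (x.1%:R, x.2%:R, 0).

Lemma direction_affE x a : aff (direction_form x) a = a.1 * x.1%:R + a.2 * x.2%:R.
Proof. by rewrite /aff /= addr0. Qed.

Lemma primitive_multiple z : nonzero z -> exists y (c : nat),
  [/\ prim o y, (0 < c)%N, z.1 = (c * y.1)%N :> nat & z.2 = (c * y.2)%N :> nat].
Proof.
move=> nz; pose c := gcdn z.1 z.2.
have c0 : (0 < c)%N by rewrite gcdn_gt0 !lt0n.
have d1 : (c %| z.1)%N by exact: dvdn_gcdl.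
have d2 : (c %| z.2)%N by exact: dvdn_gcdr.
have k1 : (z.1 %/ c < m)%N by apply: leq_ltn_trans (leq_div _ _) (ltn_ord _).
have k2 : (z.2 %/ c < n)%N by apply: leq_ltn_trans (leq_div _ _) (ltn_ord _).
exists (Ordinal k1, Ordinal k2), c; split=> //=; try by rewrite mulnC divnK.
rewrite /prim o1 o2 !subr0 /coprimez /gcdz /= eqz_nat.
by rewrite -(eqn_pmul2r c0) mul1n muln_gcdl !divnK.
Qed.

Lemma nonzero_prim x : prim o x -> nonzero x.
Proof. by move=> /prim_neq; rewrite (nonzeroE o1 o2) eq_sym. Qed.

Definition prim_prefix k : {set G} := [set x | prim o x && (rank x < k)%N]%SET.

Lemma prim_prefix_eq0 k : (#|prim_prefix k| == 0%N) = (@prefix_points m n k == finset.set0).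
Proof.
rewrite cards_eq0; apply/eqP/eqP => h; apply/setP => x; rewrite !inE.
  apply/negbTE/negP => /andP[nx rx]; have [y [c [py c0 e1 e2]]] := primitive_multiple nx.
  move/setP/(_ y): h; rewrite !inE py /= => /negbT; rewrite -leqNgt => ky.
  suff : (rank y <= rank x)%N by lia.
  by rewrite /rank e1 e2 leq_add ?leq_mul2r ?leq_pmull ?orbT.
apply/negbTE/negP => /andP[px rx]; move/setP/(_ x): h.
by rewrite !inE rx nonzero_prim.
Qed.

Lemma direction_det x i a : a <> (0, 0) ->
  aff (direction_form x) a = 0 -> aff (direction_form i) a = 0 -> det x i = 0.
Proof.
rewrite !direction_affE => a0 ax ai; apply/eqP; rewrite -(intr_eq0 R) detR.
have : (a.1 != 0) || (a.2 != 0).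
  rewrite -negb_and; apply/negP => /andP[/eqP h1 /eqP h2]; apply: a0.
  by case: a h1 h2 {ax ai} => ? ? /= -> ->.
case/orP => h; apply/eqP/(mulfI h); rewrite mulr0.
  transitivity ((a.1 * x.1%:R + a.2 * x.2%:R) * i.2%:R - x.2%:R * (a.1 * i.1%:R + a.2 * i.2%:R)).
    by ring.
  by rewrite ax ai; ring.
transitivity (x.1%:R * (a.1 * i.1%:R + a.2 * i.2%:R) - (a.1 * x.1%:R + a.2 * x.2%:R) * i.1%:R).
  by ring.
by rewrite ax ai; ring.
Qed.

Lemma prim_det_le x i : prim o x -> nonzero i -> det x i = 0 -> (rank x <= rank i)%N.
Proof.
move=> px ni d; have [y [c [py c0 e1 e2]]] := primitive_multiple ni.
have yx : y = x.
  have d' : det x y = 0.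
    apply/eqP; have : c%:Z * det x y = 0 by rewrite -d /det e1 e2 !PoszM; ring.
    by move/eqP; rewrite mulf_eq0 eqz_nat eqn0Ngt c0.
  have [] := coprimez_collinear px py.
  - by move: d'; rewrite /det o1 o2 !subr0; lia.
  - by rewrite o1 o2 !subr0 => -[? ?]; apply: coord_inj.
  move=> [h1 h2]; have := nonzero_prim py; move: h1 h2; rewrite o1 o2 !subr0 /nonzero.
  move: (y.1 : nat) (y.2 : nat) (x.1 : nat) (x.2 : nat) => *; lia.
by rewrite /rank e1 e2 yx leq_add ?leq_mul2r ?leq_pmull ?orbT.
Qed.

(** All these lines pass through [(0, 0)], so a new one is cut at that single point and adds two
    regions, the very first adding one. A non-primitive point repeats the line of its primitive
    divisor, which has smaller rank. *)
Lemma regions_direction_prefix k :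
  #|regions direction_form setT (@prefix_points m n k)| =
  if #|prim_prefix k| == 0%N then 1%N else (2 * #|prim_prefix k|)%N.
Proof.
elim: k => [|k IHk].
  have -> : prim_prefix 0 = finset.set0 by apply/setP => x; rewrite !inE ltn0 andbF.
  have -> : @prefix_points m n 0 = finset.set0 by apply/setP => x; rewrite !inE ltn0 andbF.
  by rewrite cards0 eqxx regions0//; exists (0, 0).
have [[x [rx nx]]|nok] := pselect (exists x, rank x = k /\ nonzero x); last first.
  have ltE x : nonzero x -> (rank x < k.+1)%N = (rank x < k)%N.
    by move=> nx; rewrite ltnS leq_eqVlt; case: eqP => // e; case: nok; exists x.
  have -> : prim_prefix k.+1 = prim_prefix k.
    by apply/setP => x; rewrite !inE; case: (boolP (prim o x)) => //= /nonzero_prim /ltE.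
  have -> : @prefix_points m n k.+1 = @prefix_points m n k.
    by apply/setP => x; rewrite !inE; case: (boolP (nonzero x)) => //= /ltE.
  exact: IHk.
have -> : @prefix_points m n k.+1 = x |: @prefix_points m n k.
  apply/setP => i; rewrite !inE ltnS leq_eqVlt -rx (inj_eq (@rank_inj m n)).
  by case: eqVneq => [->|]; rewrite ?nx.
have xk : x \notin @prefix_points m n k by rewrite inE rx ltnn andbF.
have N0 : (x.1%:R : R) ^+ 2 + x.2%:R ^+ 2 != 0.
  rewrite paddr_eq0 ?sqr_ge0// !sqrf_eq0 !pnatr_eq0.
  by rewrite negb_and.
rewrite regionsU1// ?IHk; last first.
  by exists (x.1%:R, x.2%:R) => //; rewrite direction_affE /= -!expr2.
have [px|npx] := boolP (prim o x); last first.
  have [y [c [py c0 e1 e2]]] := primitive_multiple nx.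
  have c1 : (1 < c)%N.
    rewrite ltn_neqAle c0 andbT; apply: contra npx => /eqP c1.
    suff -> : x = y by [].
    by apply: coord_inj; rewrite ?e1 ?e2 -c1 mul1n.
  have ry : (rank y < k)%N.
    have y0 : (0 < rank y)%N by rewrite (rank_gt0 o1 o2) nonzero_prim.
    have -> : k = (c * rank y)%N by rewrite -rx /rank e1 e2 mulnDr mulnA.
    by rewrite ltn_Pmull.
  rewrite (@regions_null _ _ _ _ _ y); first last.
  - move=> a [_ /=]; rewrite !direction_affE e1 e2 !natrM => h.
    have cR : (c%:R : R) != 0 by rewrite pnatr_eq0 -lt0n.
    by apply: (mulfI cR); rewrite mulr0 -h; ring.
  - by rewrite !inE (nonzero_prim py) ry.
  rewrite addn0; have -> // : prim_prefix k.+1 = prim_prefix k.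
  apply/setP => i; rewrite !inE ltnS leq_eqVlt -rx (inj_eq (@rank_inj m n)).
  by case: eqVneq => [->|//]; rewrite (negbTE npx).
have -> : prim_prefix k.+1 = x |: prim_prefix k.
  apply/setP => i; rewrite !inE ltnS leq_eqVlt -rx (inj_eq (@rank_inj m n)).
  by case: eqVneq => [->|]; rewrite ?px.
rewrite cardsU1 inE rx ltnn andbF add1n /=.
have fW : flat (setT `&` [set a | aff (direction_form x) a = 0]) by exact: flatI_zero.
rewrite prim_prefix_eq0; case: eqP => [A0|/eqP].
  rewrite A0 regions0; last by exists (0, 0); split=> //=; rewrite direction_affE /= !mul0r addr0.
  by have /eqP -> : #|prim_prefix k| == 0%N by rewrite prim_prefix_eq0 A0.
move=> /set0Pn[i iA].
rewrite (@regions_line _ _ _ _ _ [:: (0, 0)])//; first by rewrite /=; lia.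
- exists (0, 0), (x.2%:R, - x.1%:R); split.
  + by split=> //=; rewrite direction_affE /= !mul0r addr0.
  + by split=> //=; rewrite direction_affE /=; ring.
  move=> [h1 h2]; case/eqP: N0; rewrite -h1 (_ : x.1%:R = 0); first by ring.
  by apply/eqP; rewrite -oppr_eq0 -h2.
- have zero j a : j \in @prefix_points m n k -> aff (direction_form x) a = 0 ->
      aff (direction_form j) a = 0 -> a = (0, 0).
    rewrite inE => /andP[nj rj] ax aj; apply: contrapT => a0.
    by have := prim_det_le px nj (direction_det a0 ax aj); lia.
  by move=> j a b jA [_ ax] [_ bx] aj bj; rewrite (zero j a)// (zero j b).
move=> a; rewrite inE; split=> [/eqP ->|[[_ /= ax] [j]]].
  by split; [split=> //=|exists i => //]; rewrite direction_affE /= !mul0r addr0.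
rewrite inE => /andP[nj rj] aj; apply/eqP; apply: contrapT => a0.
by have := prim_det_le px nj (direction_det a0 ax aj); lia.
Qed.

Lemma card_direction_regions :
  #|regions direction_form setT (@nonzeros m n)| = (2 * #|primitives o|)%N.
Proof.
have -> : @nonzeros m n = @prefix_points m n (m * n).
  by apply/setP => x; rewrite !inE rank_lt andbT.
have -> : primitives o = prim_prefix (m * n).
  by apply/setP => x; rewrite !inE rank_lt andbT.
rewrite regions_direction_prefix; case: eqP => // /eqP.
rewrite prim_prefix_eq0 => /eqP /setP.
have n0 : (0 < n)%N by exact: leq_trans n2.
by move=> /(_ (Ordinal m2, Ordinal n0)); rewrite !inE rank_lt.
Qed.

End Central.

(** * Exact counts *)

Section Assembly.
Variables (R : realType) (m n : nat).
Hypotheses (m2 : (2 <= m)%N) (n2 : (2 <= n)%N).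
Local Notation G := ('I_m * 'I_n)%type.
Local Notation hom := (@hom R m n).
Local Notation rank := (@rank m n).
Local Notation prim := (@prim m n).
Local Notation essential := (@essential R m n).
Local Notation essentials := (@essentials R m n).
Local Notation point_form := (@point_form R m n).
Local Notation direction_form := (@direction_form R m n).
Local Notation dual_line := (@dual_line R m n).
Local Notation nonzeros := (@nonzeros m n).
Local Notation vert := (@vert R m n).
Implicit Types (x y z : G) (A B : {set G}) (a b : R * R).

Definition origin : G :=
  (Ordinal (leq_trans (isT : (0 < 2)%N) m2), Ordinal (leq_trans (isT : (0 < 2)%N) n2)).

Let o1 : origin.1 = 0%N :> nat. Proof. by []. Qed.
Let o2 : origin.2 = 0%N :> nat. Proof. by []. Qed.

Definition cell_regions := regions point_form setT nonzeros.

Lemma in_nonzeros x : (x \in nonzeros) = (x != origin).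
Proof. by rewrite inE (nonzeroE o1 o2). Qed.

Lemma dual_lineE x : dual_line x = line R (x.1 : nat, x.2 : nat).
Proof.
apply/seteqP; split=> a; rewrite /dual_line /line /= affE.
  by move=> [_ /eqP]; rewrite subr_eq0 => /eqP.
by move=> ->; split=> //; rewrite subrr.
Qed.

Lemma linesP L : lines R m n L <-> exists2 x, x \in nonzeros & L = dual_line x.
Proof.
split=> [[[i j] [/= im jn ij] <-]|[x x0 ->]].
  exists (Ordinal im, Ordinal jn); last by rewrite dual_lineE.
  by rewrite inE /nonzero /=; move: ij; rewrite xpair_eqE negb_and.
exists (x.1 : nat, x.2 : nat); last by rewrite dual_lineE.
split=> /=; rewrite ?ltn_ord// xpair_eqE negb_and.
by move: x0; rewrite inE.
Qed.

Lemma dual_line_inj x z : x \in nonzeros -> dual_line x = dual_line z -> x = z.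
Proof.
rewrite inE => nx e; have [a [b [xa xb ab]]] := dual_line_two_points R nx.
apply/eqP/negPn/negP => xz; apply: ab.
have za : dual_line z a by rewrite -e.
have zb : dual_line z b by rewrite -e.
have d := det_neq0 xz xa.2 za.2.
by rewrite (vert_unique d xa.2 za.2) (vert_unique d xb.2 zb.2).
Qed.

Lemma complement_lines :
  (~` \bigcup_(L in lines R m n) L) = setT `&` [set a | generic point_form nonzeros a].
Proof.
apply/seteqP; split=> a.
  move=> h; split=> //; apply/genericP => x x0; apply/eqP => ax; apply: h.
  by exists (dual_line x); [apply/linesP; exists x|split].
by move=> [_ /= /genericP h] [L /linesP[x x0 ->] [_ /= ax]]; have := h x x0; rewrite ax eqxx.
Qed.

Lemma cellsE : cells R m n =
  [set closed_region point_form setT nonzeros B | B in [set` cell_regions]].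
Proof.
rewrite /cells complement_lines closures_of_components //; exact: closedT.
Qed.

(** The origin belongs to no line of the arrangement, yet it counts in [separates]: at a finite
    point its form is [-1], so it always lies outside [B]. *)
Lemma separates_region B : B \in cell_regions ->
  origin \notin B /\ exists y : R * R * R, separates y B.
Proof.
move=> /regionsP[a [_ /genericP ga ->]]; split.
  by rewrite !inE negb_and (nonzeroE o1 o2) eqxx.
exists (a.1, a.2, 1) => x; rewrite !inE.
have homE : hom (a.1, a.2, 1) x = aff (point_form x) a by [].
rewrite homE; have := ga x; rewrite inE; case: (boolP (nonzero x)) => /= [_ /(_ isT)|].
  by case: ltrgt0P.
rewrite (nonzeroE o1 o2) negbK => /eqP -> _.
by rewrite affE o1 o2 !(mulr0, add0r) ltrN10.
Qed.

Lemma closed_region_cell B : origin \notin B ->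
  closed_region point_form setT nonzeros B = @cell R m n B.
Proof.
move=> oB; apply/seteqP; split=> [a [_ h] x|a h].
  have [->|xo] := eqVneq x origin; last first.
    by have := h x; rewrite in_nonzeros => /(_ xo).
  by rewrite /weak_sign_of (negbTE oB) /hom /= !(mulr0, add0r) oppr_le0 ler01.
by split=> // x _; have := h x.
Qed.

Lemma region_polygon B : B \in cell_regions ->
  generalized_polygon #|essentials B| (closed_region point_form setT nonzeros B).
Proof.
move=> /separates_region[oB [y sep]]; rewrite closed_region_cell//.
exact: (cell_polygon o1 o2 oB sep).
Qed.

Lemma closed_region_nonempty B : B \in cell_regions ->
  closed_region point_form setT nonzeros B !=set0.
Proof.
move=> /regionsP[a [_ ga ->]]; exists a; split=> // x xA; rewrite !inE.
by move: xA; rewrite inE => -> /=; case: ltrgt0P.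
Qed.

Lemma region_polygonP k B : B \in cell_regions ->
  generalized_polygon k (closed_region point_form setT nonzeros B) <-> k = #|essentials B|.
Proof.
move=> BR; split=> [h|->]; last exact: region_polygon.
exact: (polygon_unique (closed_region_nonempty BR) h (region_polygon BR)).
Qed.

Lemma card_essentials_bounds B : B \in cell_regions -> (3 <= #|essentials B| <= 4)%N.
Proof.
move=> /separates_region[oB [y sep]].
by rewrite (card_essentials_ge3 m2 n2 sep) (card_essentials_le4 R oB).
Qed.

Lemma number_cells : finite_set (cells R m n) /\ num_cells R m n = #|cell_regions|.
Proof.
rewrite /num_cells cellsE; apply: number_image; exact: closed_region_inj.
Qed.

Lemma num_polygonsE k :
  num_polygons R k m n = #|[set B in cell_regions | #|essentials B| == k]%SET|.
Proof.
rewrite /num_polygons.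
have -> : [set Q | cells R m n Q /\ generalized_polygon k Q] =
  [set closed_region point_form setT nonzeros B | B in
    [set` [set B in cell_regions | #|essentials B| == k]%SET]].
  rewrite cellsE; apply/seteqP; split=> Q.
    move=> [[B /= BR <-] /(region_polygonP _ BR) ->]; exists B => //=.
    by rewrite inE BR eqxx.
  move=> [B /=]; rewrite inE => /andP[BR /eqP <-] <-; split; first by exists B.
  exact: region_polygon.
apply: (proj2 (number_image _)) => B C; rewrite !inE => /andP[hB _] /andP[hC _].
by apply: closed_region_inj; rewrite inE.
Qed.

(* [x] is essential in [B] when [B] borders an edge on the line of [x], and each
   edge borders two regions. *)
Lemma card_essential_at x : x \in nonzeros ->
  #|[set B in cell_regions | x \in essentials B]%SET| =
  (2 * #|regions point_form (dual_line x) (nonzeros :\ x)|)%N.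
Proof.
move=> x0; set S := regions _ _ _.
have xS B : B \in S -> x \notin B.
  by move=> /regionsP[a [_ _ ->]]; rewrite !inE eqxx.
have key B : (B \in [set B in cell_regions | x \in essentials B]%SET) = ((B :\ x)%SET \in S).
  rewrite inE; apply/andP/regionsP => [[BR /essentialsP[y yx hy]]|[a [[_ /= ax] ga e]]].
    have [oB _] := separates_region BR.
    have xo : origin != x by rewrite eq_sym -in_nonzeros.
    have y2 : 0 < y.2.
      by have := hy _ xo; rewrite (negbTE oB) /hom o1 o2 !(mulr0, add0r) oppr_lt0.
    have yE z : aff (point_form z) (y.1.1 / y.2, y.1.2 / y.2) = hom y z / y.2.
      by rewrite affE /hom /=; field; rewrite gt_eqF.
    exists (y.1.1 / y.2, y.1.2 / y.2); split.
    - by split=> //=; rewrite yE yx mul0r.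
    - apply/genericP => z; rewrite !inE => /andP[zx _]; rewrite yE; apply: mulf_neq0;
        last by rewrite invr_eq0 gt_eqF.
      by have := hy z zx; case: ifP => _ h; [rewrite gt_eqF|rewrite lt_eqF].
    apply/setP => z; rewrite !inE yE pmulr_lgt0 ?invr_gt0//.
    have [//|zx] := eqVneq z x; have := hy z zx; rewrite /=.
    have [->|zo] := eqVneq z origin.
      by rewrite (negbTE oB) (nonzeroE o1 o2) eqxx.
    by rewrite (nonzeroE o1 o2) zo; case: ifP => // _; case: ltrgt0P.
  have xo : origin != x by rewrite eq_sym -in_nonzeros.
  have oB : origin \notin B.
    have := congr1 (fun C : {set G} => origin \in C) e.
    by rewrite !inE (nonzeroE o1 o2) eqxx !andbF xo /= => ->.
  have ez z : z != x -> (z \in B) = (z != origin) && (0 < aff (point_form z) a).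
    move=> zx; have := congr1 (fun C : {set G} => z \in C) e.
    by rewrite !inE zx /= (nonzeroE o1 o2).
  split; last first.
    apply/essentialsP; exists (a.1, a.2, 1); first exact: ax.
    move=> z zx; rewrite ez//; have [->|zo] := eqVneq z origin.
      by rewrite /= /hom o1 o2 !(mulr0, add0r) oppr_lt0 ltr01.
    rewrite /= -/(aff (point_form z) a); have := genericP _ _ _ ga z.
    rewrite !inE zx (nonzeroE o1 o2) zo => /(_ isT).
    by rewrite /hom /= -/(aff (point_form z) a) affE; case: ltrgt0P.
  have [d d0 hd] := perturb (@flat_setT R) (I : setT a) (I : setT (0, 0)) ga.
  (* The form of [x] is 0 at [a] and [-1] at [(0, 0)], hence [- t] after the step; the sign of [t]
     puts [x] on the side prescribed by [B]. *)
  pose t := if x \in B then - d else d.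
  have td : `|t| <= d by rewrite /t; case: ifP; rewrite ?normrN gtr0_norm.
  have [_ gt et] := hd t td.
  have xt : aff (point_form x) (along a (0, 0) t) = - t.
    by rewrite aff_along ax affE /= !mul0r; ring.
  apply/regionsP; exists (along a (0, 0) t); split=> //.
    rewrite -(finset.setD1K x0) genericU1 gt andbT xt oppr_eq0 /t.
    by case: ifP; rewrite ?oppr_eq0 gt_eqF.
  rewrite -[in RHS](finset.setD1K x0) patternU1 xt et -e oppr_gt0 /t.
  case xB : (x \in B); first by rewrite oppr_lt0 d0 finset.setD1K.
  rewrite ltNge (ltW d0) /=; apply/setP => z; rewrite !inE.
  by have [->|] := eqVneq z x; rewrite ?xB.
rewrite -[LHS](cardsID [set B : {set G} | x \in B]%SET) mul2n -addnn; congr addn.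
  rewrite -(@card_in_imset _ _ (fun B : {set G} => x |: B) (mem S)); last first.
    move=> B C hB hC /(congr1 (fun D : {set G} => D :\ x)%SET).
    by rewrite !setU1K ?xS.
  apply: eq_card => B; apply/idP/imsetP => [/finset.setIP[]|[C CS ->]].
    by rewrite key inE => BS xB; exists (B :\ x)%SET; rewrite ?finset.setD1K.
  by apply/finset.setIP; rewrite key setU1K ?xS//; split=> //; rewrite inE setU11.
apply: eq_card => B; apply/finset.setDP/idP => [[]|BS].
  rewrite key inE => BS xB; suff <- : (B :\ x)%SET = B by [].
  by apply/setP => z; rewrite !inE; have [->|] := eqVneq z x; rewrite ?(negbTE xB).
rewrite key inE; split; last exact: xS.
suff -> : (B :\ x)%SET = B by [].
by apply/setP => z; rewrite !inE; have [->|] := eqVneq z x; rewrite ?(negbTE (xS _ BS)).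
Qed.

(** A witness that the origin is essential has [y.2 = 0]: it is a direction generic for the central
    arrangement. Conversely, far out in a generic direction [b], at [b / d] with [d] small, the
    constant term no longer affects the signs. *)
Lemma card_essential_at_origin :
  [set B in cell_regions | origin \in essentials B]%SET = regions direction_form setT nonzeros.
Proof.
apply/setP => B; rewrite inE; apply/andP/regionsP => [[BR /essentialsP[y yo hy]]|[b [_ /genericP gb e]]].
  have y2 : y.2 = 0.
    by move: yo; rewrite /hom o1 o2 !(mulr0, add0r) => /eqP; rewrite oppr_eq0 => /eqP.
  have yE z : aff (direction_form z) y.1 = hom y z.
    by rewrite direction_affE /hom y2 subr0.
  exists y.1; split=> //.
    apply/genericP => z; rewrite in_nonzeros => /hy; rewrite yE.
    by case: ifP => _ h; [rewrite gt_eqF|rewrite lt_eqF].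
  apply/setP => z; rewrite !inE yE (nonzeroE o1 o2).
  have [->|/hy] := eqVneq z origin.
    by have [/negbTE -> _] := separates_region BR.
  by case: ifP => // _; case: ltrgt0P.
have ez z : (z \in B) = (z != origin) && (0 < aff (direction_form z) b).
  by rewrite e inE in_nonzeros.
split; last first.
  apply/essentialsP; exists (b.1, b.2, 0).
    by rewrite /hom o1 o2 /= !mulr0 add0r subrr.
  move=> z zo; have := gb z; rewrite in_nonzeros => /(_ zo).
  rewrite ez zo /= (_ : hom _ _ = aff (direction_form z) b); first by case: ltrgt0P.
  by rewrite direction_affE /hom subr0.
have [|d d0 hd] := @sign_stable R [seq (aff (direction_form z) b, -1) | z <- enum nonzeros].
  by apply/allP => w /mapP[z]; rewrite mem_enum => /gb ? ->.
have sgn z : z \in nonzeros -> 0 < aff (direction_form z) b * (aff (direction_form z) b - d).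
  move=> z0; rewrite -[- d]mulrN1; apply: (hd d _ (_, -1)); first by rewrite gtr0_norm.
  by apply/mapP; exists z; rewrite ?mem_enum.
have zE z : aff (point_form z) (b.1 / d, b.2 / d) = (aff (direction_form z) b - d) / d.
  by rewrite affE direction_affE /=; field; rewrite gt_eqF.
apply/regionsP; exists (b.1 / d, b.2 / d); split=> //.
  apply/genericP => z /sgn h; rewrite zE; apply: mulf_neq0; last by rewrite invr_eq0 gt_eqF.
  by apply: contraTneq h => ->; rewrite mulr0 ltxx.
apply/setP => z; rewrite ez -in_nonzeros [RHS]inE.
case: (boolP (z \in nonzeros)) => // z0; rewrite !andTb zE.
rewrite pmulr_lgt0 ?invr_gt0//; have := sgn z z0.
case: (ltrgt0P (aff (direction_form z) b)) => h; last by rewrite h mul0r ltxx.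
  by rewrite pmulr_rgt0// => ->.
by rewrite nmulr_rgt0// => h'; rewrite ltNge ltW.
Qed.

Lemma sum_card_essentials :
  (\sum_(B in cell_regions) #|essentials B| =
   2 * (\sum_(x in nonzeros) #|regions point_form (dual_line x) (nonzeros :\ x)|)
   + 2 * #|primitives origin|)%N.
Proof.
transitivity (\sum_(x : G) #|[set B in cell_regions | x \in essentials B]%SET|)%N.
  under eq_bigr => B _ do rewrite -sum1_card big_mkcond.
  rewrite exchange_big; apply: eq_bigr => x _ /=.
  by rewrite -sum1dep_card -big_mkcondr.
rewrite (bigID (mem nonzeros)) /= big_distrr /=; congr addn.
  by apply: eq_bigr => x; exact: card_essential_at.
rewrite (bigD1 origin) /= ?in_nonzeros ?eqxx// big_pred0 ?addn0.
  by rewrite card_essential_at_origin (card_direction_regions R m2 n2 o1 o2).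
by move=> x; rewrite in_nonzeros negbK andbN.
Qed.

End Assembly.

(** * Edges, vertices and the linear system for the counts *)

Section EdgesVertices.
Variables (R : realType) (m n : nat).
Hypotheses (m2 : (2 <= m)%N) (n2 : (2 <= n)%N).
Local Notation G := ('I_m * 'I_n)%type.
Local Notation rank := (@rank m n).
Local Notation prim := (@prim m n).
Local Notation point_form := (@point_form R m n).
Local Notation dual_line := (@dual_line R m n).
Local Notation nonzeros := (@nonzeros m n).
Local Notation vert := (@vert R m n).
Local Notation origin := (origin m2 n2).
Implicit Types (x y z : G) (A B : {set G}) (a b : R * R).

Let o1 : origin.1 = 0%N :> nat. Proof. by []. Qed.
Let o2 : origin.2 = 0%N :> nat. Proof. by []. Qed.

Lemma verticesP a : vertices R m n a <-> exists x z,
  [/\ x \in nonzeros, z \in nonzeros, x != z, aff (point_form x) a = 0 &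
      aff (point_form z) a = 0].
Proof.
split=> [[L [L' [/linesP[x x0 ->] /linesP[z z0 ->] ne [_ xa] [_ za]]]]|].
  exists x, z; split=> //; apply: contra_notN ne => /eqP -> //.
move=> [x [z [x0 z0 xz xa za]]]; exists (dual_line x), (dual_line z); split.
- by apply/linesP; exists x.
- by apply/linesP; exists z.
- by move/(dual_line_inj x0)/eqP; apply/negP.
- by split.
- by split.
Qed.

Lemma line_minus_vertices x : x \in nonzeros ->
  dual_line x `\` vertices R m n =
  dual_line x `&` [set a | generic point_form (nonzeros :\ x) a].
Proof.
move=> x0; apply/seteqP; split=> a [xa h]; split=> //=.
  apply/genericP => z; rewrite !inE => /andP[zx z0]; apply/eqP => za; apply: h.
  apply/verticesP; exists x, z; split=> //; [by rewrite inE|by rewrite eq_sym|exact: xa.2].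
move=> /verticesP[u [v [u0 v0 uv ua va]]].
have g z : z \in nonzeros -> z != x -> aff (point_form z) a = 0 -> False.
  move=> z0 zx za; have := genericP _ _ _ h z; rewrite !inE zx /=.
  by rewrite inE in z0; move=> /(_ z0); rewrite za eqxx.
have [ux|ux] := eqVneq u x; last exact: (g u).
by apply: (g v) => //; rewrite -ux eq_sym.
Qed.

Lemma closed_dual_line x : closed (dual_line x).
Proof.
apply: closedI; first exact: closedT.
apply: (@closed_comp _ _ (aff (point_form x)) [set 0]); last exact: closed_eq.
by move=> a _; exact: continuous_aff.
Qed.

Definition edge_regions : {set G * {set G}} :=
  [set p | (p.1 \in nonzeros) &&
     (p.2 \in regions point_form (dual_line p.1) (nonzeros :\ p.1))]%SET.

Definition edge_of (p : G * {set G}) : set (R * R) :=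
  closed_region point_form (dual_line p.1) (nonzeros :\ p.1) p.2.

Lemma edgesE : edges R m n = [set edge_of p | p in [set` edge_regions]].
Proof.
have comp x : x \in nonzeros ->
    [set closure K | K in components (dual_line x `\` vertices R m n)] =
    [set closed_region point_form (dual_line x) (nonzeros :\ x) B |
      B in [set` regions point_form (dual_line x) (nonzeros :\ x)]].
  move=> x0; rewrite line_minus_vertices// closures_of_components//.
    exact: flat_dual_line.
  exact: closed_dual_line.
apply/seteqP; split=> E.
  move=> [L /linesP[x x0 ->]]; rewrite comp// => -[B /= hB <-].
  by exists (x, B) => //=; rewrite inE /= x0.
move=> [[x B] /=]; rewrite inE /= => /andP[x0 hB] <-.
exists (dual_line x); first by apply/linesP; exists x.
by rewrite comp//; exists B.
Qed.

(** An edge determines its line, because its generic points lie on no other line of the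
    arrangement. *)
Lemma edge_of_inj : {in edge_regions &, injective edge_of}.
Proof.
have inP x B : (x, B) \in edge_regions ->
    x \in nonzeros /\ B \in regions point_form (dual_line x) (nonzeros :\ x).
  by rewrite inE => /andP[].
move=> [x B] [z C] /inP[x0 hB] /inP[z0 hC] e.
have [xz|xz] := eqVneq x z.
  by rewrite -xz in hC e *; rewrite (closed_region_inj hB hC e).
have /regionsP[a [xa ga eB]] := hB.
have : edge_of (x, B) a.
  split=> //= i iA; rewrite eB inE iA /=.
  by case: ltrgt0P.
rewrite e => -[[_ /= za] _].
have := genericP _ _ _ ga z; rewrite finset.in_setD1 eq_sym xz z0.
by move=> /(_ isT); rewrite za eqxx.
Qed.

Lemma number_edges : finite_set (edges R m n) /\
  num_edges R m n =
  (\sum_(x in nonzeros) #|regions point_form (dual_line x) (nonzeros :\ x)|)%N.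
Proof.
rewrite /num_edges edgesE.
have [fE ->] := number_image edge_of_inj; split=> //.
rewrite (card_pairs (fun x B => (x \in nonzeros) &&
  (B \in regions point_form (dual_line x) (nonzeros :\ x)))).
rewrite [RHS]big_mkcond; apply: eq_bigr => x _; case: ifP => x0.
  by apply: eq_card => B; rewrite inE.
by apply: eq_card0 => B; rewrite inE.
Qed.

(** If [x] and [y] were aligned with the origin, [x] would be a positive multiple of the primitive
    vector [y - x], and [2x - y] would lie between the origin and [x], hence in G. *)
Lemma prim_det_neq0 x y : nonzero x -> (rank x < rank y)%N -> prim x y ->
  ~~ reflectable x y -> det x y != 0.
Proof.
move=> nx rxy p; apply: contraNneq => d0.
pose d1 := y.1%:Z - x.1%:Z; pose d2 := y.2%:Z - x.2%:Z.
have /coprimezP[[u v] /= uv] := p; rewrite -/d1 -/d2 in uv.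
have c : x.1%:Z * d2 = x.2%:Z * d1 by move: d0; rewrite /det /d1 /d2; lia.
pose k := u * x.1%:Z + v * x.2%:Z.
have E1 : x.1%:Z = k * d1.
  transitivity ((u * d1 + v * d2) * x.1%:Z); first by rewrite uv mul1r.
  transitivity (u * d1 * x.1%:Z + v * (x.1%:Z * d2)); first by ring.
  by rewrite c /k; ring.
have E2 : x.2%:Z = k * d2.
  transitivity ((u * d1 + v * d2) * x.2%:Z); first by rewrite uv mul1r.
  transitivity (u * (x.2%:Z * d1) + v * d2 * x.2%:Z); first by ring.
  by rewrite -c /k; ring.
have rd : 0 < d1 * n%:Z + d2.
  move: rxy; rewrite /rank -ltz_nat !PoszD !PoszM /d1 /d2; lia.
have rx : 0 < k * (d1 * n%:Z + d2).
  rewrite mulrDr mulrA -E1 -E2 -PoszM -PoszD -/(rank x) ltz_nat.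
  by rewrite (rank_gt0 o1 o2).
have k0 : 0 < k by rewrite pmulr_lgt0 in rx.
have [w [w1 w2]] : exists w : G, x.1%:Z - d1 = w.1%:Z /\ x.2%:Z - d2 = w.2%:Z.
  apply: grid_boxE.
  apply: (@in_box_conv3 _ k 0 _ _ origin.1%:Z origin.1%:Z x.1%:Z
    origin.2%:Z origin.2%:Z x.2%:Z); rewrite ?grid_boxP// ?o1 ?o2.
  - by rewrite mulrBr -E1; ring.
  - by rewrite mulrBr -E2; ring.
by apply/reflectableP; exists w; rewrite -w1 -w2 /d1 /d2 !mulr2n; split; ring.
Qed.

Lemma vertex_pairsP x y : (x, y) \in vertex_pairs m n ->
  [/\ nonzero x, (rank x < rank y)%N, prim x y, ~~ reflectable x y &
      aff (point_form x) (vert x y) = 0 /\ aff (point_form y) (vert x y) = 0].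
Proof.
rewrite inE /= => /and4P[h1 h2 h3 h4]; split=> //.
exact/vert_on/prim_det_neq0.
Qed.

(** Among the grid points whose lines pass through the vertex, the one of least rank has no
    reflection of its primitive neighbour in G, as that reflection would rank lower. *)
Lemma verticesE : vertices R m n =
  [set vert p.1 p.2 | p in [set` vertex_pairs m n]].
Proof.
apply/seteqP; split=> [a /verticesP[x [z [x0 z0 xz xa za]]]|_ [[x y] /= /vertex_pairsP[nx rxy p _ [h1 h2]] <-]].
  pose P := [pred w : G | `[< aff (point_form w) a = 0 >]].
  have Px : P x by apply/asboolP.
  have [u /asboolP ua minu] := @arg_minnP _ x P rank Px.
  have min w : aff (point_form w) a = 0 -> (rank u <= rank w)%N.
    by move=> wa; apply: minu; apply/asboolP.
  have nu : nonzero u.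
    rewrite (nonzeroE o1 o2); apply: contra_eqN ua => /eqP ->.
    by rewrite affE o1 o2 !(mulr0, add0r) oppr_eq0 oner_eq0.
  have [v [va uv]] : exists v, aff (point_form v) a = 0 /\ u != v.
    by have [ux|ux] := eqVneq u x; [exists z; rewrite ux|exists x].
  have [y [p c r]] := prim_toward uv.
  have ya : aff (point_form y) a = 0.
    by apply: (collinear_aff uv _ ua va); rewrite -[RHS]oppr0 -c /cross; ring.
  have uy := prim_neq p.
  have ruy : (rank u < rank y)%N.
    by rewrite ltn_neqAle (inj_eq (@rank_inj m n)) uy min.
  exists (u, y); last by rewrite /= -(vert_unique (det_neq0 uy ua ya) ua ya).
  rewrite /= inE /= nu ruy p /=; apply/negP => /reflectableP[w [w1 w2]].
  have wa : aff (point_form w) a = 0.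
    by apply: (collinear_aff uy _ ua ya); rewrite /cross w1 w2 !mulr2n; ring.
  by have := min w wa; have := reflect_rank w1 w2; lia.
apply/verticesP; exists x, y; split; rewrite ?inE//; last exact: prim_neq.
by rewrite -(rank_gt0 o1 o2) (leq_ltn_trans _ rxy).
Qed.

(** The first entry has least rank among the grid points aligned with the pair: a lower one would
    bring a primitive neighbour opposite to the second entry. The second entry is then forced by the
    direction. *)
Lemma vert_inj : {in vertex_pairs m n &, injective (fun p => vert p.1 p.2)}.
Proof.
have key x y x' y' : (x, y) \in vertex_pairs m n -> (x', y') \in vertex_pairs m n ->
    vert x y = vert x' y' -> (rank x' <= rank x)%N.
  move=> /vertex_pairsP[_ _ _ _ [xa ya]] /vertex_pairsP[_ rx p r [xa' ya']] e.
  rewrite -e in xa' ya'; rewrite leqNgt; apply/negP => lt.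
  have xx : x' != x by apply: contraTneq lt => ->; rewrite ltnn.
  have [w [pw cw rw]] := prim_toward xx.
  have wa := collinear_aff xx _ xa' xa.
  have {}wa : aff (point_form w) (vert x y) = 0.
    by apply: wa; rewrite -[RHS]oppr0 -cw /cross; ring.
  have yw : y' <> w by move=> yw; move: rw; rewrite lt -yw; lia.
  have [_ _ r' _] := prim_collinear p pw (cross_aff xa' ya' wa) yw.
  by rewrite r' in r.
move=> [x y] [x' y'] h h' /= e.
have xx : x = x'.
  by apply: (@rank_inj m n); apply/eqP; rewrite eqn_leq (key _ _ _ _ h h' e) (key _ _ _ _ h' h).
subst x'; congr pair; apply: contrapT => yy.
have [_ _ p r [xa ya]] := vertex_pairsP h; have [_ _ p' _ [_ ya']] := vertex_pairsP h'.
rewrite -e in ya'.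
by have [_ _ r' _] := prim_collinear p p' (cross_aff xa ya ya') yy; rewrite r' in r.
Qed.

Lemma number_vertices : finite_set (vertices R m n) /\
  num_vertices R m n = #|vertex_pairs m n|.
Proof.
by rewrite /num_vertices verticesE; exact: (number_image vert_inj).
Qed.

Lemma exact_counts :
  [/\ (num_cells R m n)%:Z *+ 2 = f 1 m n + 2,
      (num_polygons R 3 m n)%:Z = f 2 m n + 4,
      num_cells R m n = (num_polygons R 3 m n + num_polygons R 4 m n)%N,
      (num_edges R m n)%:Z *+ 2 = f 1 m n *+ 2 - f 2 m n - (s m n)%:Z *+ 2 - 4 &
      (num_vertices R m n)%:Z *+ 2 = f 1 m n - f 2 m n - (s m n)%:Z *+ 2 - 4].
Proof.
have [_ cE] := number_cells R m n; have [_ eE] := number_edges; have [_ vE] := number_vertices.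
have cU : num_cells R m n = (1 + #|below m n 1|)%N.
  rewrite cE /cell_regions (card_regions R o1 o2); congr addn.
have F1 : f 1 m n = (2 * #|below m n 1|)%N%:Z by rewrite -card_gcd_pairs card_gcd_half.
have F2 : f 2 m n = (2 * #|middles m n|)%N%:Z.
  by rewrite -card_gcd_pairs card_gcd_half// -card_above -card_middles.
have K : #|primitives origin| = (s m n + 2)%N by exact: card_primitives.
have E : (num_edges R m n + #|primitives origin| + #|middles m n| = 2 * #|below m n 1|)%N.
  rewrite -card_gcd_half// -(card_edge_pairs o1 o2) eE; congr (_ + _ + _)%N.
  apply: eq_big => x; first by rewrite inE.
  by rewrite inE => nx; rewrite (card_line_regions R o1 o2).
have V : (num_vertices R m n + #|primitives origin| + #|middles m n| = #|below m n 1|)%N.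
  by rewrite vE card_vertex_pairs// card_above.
have memE k B : (B \in [set B in cell_regions R m n | #|essentials R B| == k]%SET) =
    (B \in cell_regions R m n) && (#|essentials R B| == k) by rewrite inE.
have c34 : num_cells R m n = (num_polygons R 3 m n + num_polygons R 4 m n)%N.
  rewrite cE !num_polygonsE// -cardsUI [X in (_ + X)%N]eq_card0 ?addn0; last first.
    by move=> B; rewrite finset.in_setI !memE; case: eqP => [->|]; rewrite ?andbF.
  apply: eq_card => B; rewrite finset.in_setU !memE -andb_orr.
  have hb := @card_essentials_bounds R m n m2 n2 B.
  case: (boolP (B \in cell_regions R m n)) => [/hb|//].
  by case: #|essentials R B| => [|[|[|[|[|]]]]].
have sum : (3 * num_polygons R 3 m n + 4 * num_polygons R 4 m n =
    2 * num_edges R m n + 2 * #|primitives origin|)%N.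
  rewrite eE -(sum_card_essentials R m2 n2).
  rewrite (bigID (fun B => #|essentials R B| == 3%N)) /= !num_polygonsE//.
  congr addn.
    rewrite mulnC -sum_nat_const; apply: eq_big => B; first by rewrite memE.
    by rewrite inE => /andP[_ /eqP ->].
  rewrite mulnC -sum_nat_const; apply: eq_big => B.
    have hb := @card_essentials_bounds R m n m2 n2 B.
    rewrite memE; case: (boolP (B \in cell_regions R m n)) => [/hb|//].
    by case: #|essentials R B| => [|[|[|[|[|]]]]].
  by rewrite inE => /andP[_ /eqP ->].
(* From the two equations [c_3 = 4 c - 2 e - 2 (s + 2)]. With [N = #|below m n 1|] and
   [M = #|middles m n|], [c = 1 + N] and [e = 2 N - (s + 2) - M] give [c_3 = 4 + 2 M], where [2 M]
   is [f 2 m n]. *)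
by split=> //; lia.
Qed.

End EdgesVertices.

(** * The Basel sum *)

Section Basel.
Variable R : realType.
Implicit Types x : R.

Lemma sin_le_id x : 0 < x < pi / 2 -> sin x <= x.
Proof.
move=> /andP[x0 x1]; have [|c _] := @MVT R sin cos 0 x x0.
  exact/continuous_subspaceT/continuous_sin.
by rewrite sin0 !subr0 => ->; rewrite ler_piMl ?cos_le1 // ltW.
Qed.

Lemma id_le_tan x : 0 < x < pi / 2 -> x <= tan x.
Proof.
move=> /andP[x0 x1].
have cosp y : 0 <= y <= x -> 0 < cos y.
  move=> /andP[y0 yx]; have p0 := pi_gt0 R; apply: cos_gt0_pihalf; apply/andP; split; lra.
have [||c] := @MVT R tan (fun y => (cos y) ^- 2) 0 x x0.
- move=> y; rewrite in_itv /= => /andP[y0 yx]; apply: is_derive_tan.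
  by rewrite gt_eqF// cosp// !ltW.
- apply: continuous_in_subspaceT => y; rewrite inE /= in_itv /= => yx.
  by apply: continuous_tan; rewrite gt_eqF// cosp.
rewrite in_itv /= => /andP[c0 cx]; rewrite tan0 !subr0 => ->.
have cc : 0 < cos c by rewrite cosp// !ltW.
by rewrite ler_peMl ?(ltW x0)// invf_ge1 ?exprn_gt0// exprn_ile1 ?cos_le1// ltW.
Qed.

(** The upper bound is the square of [cot x <= 1 / x], since the inverse square of the sine is
    [1 + cot^2]. *)
Lemma inv_sin2_bounds x : 0 < x < pi / 2 ->
  x ^- 2 <= (sin x) ^- 2 <= x ^- 2 + 1.
Proof.
move=> hx; have /andP[x0 x1] := hx; have s0 := sin_gt0_pihalf hx.
have c0 : 0 < cos x by apply: cos_gt0_pihalf; apply/andP; split; lra.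
apply/andP; split.
  by rewrite lef_pV2 ?posrE ?exprn_gt0// ler_pXn2r ?nnegrE ?(ltW s0) ?(ltW x0)//; exact: sin_le_id.
have := id_le_tan hx; rewrite /tan ler_pdivlMr// => h.
have h2 : x ^+ 2 * cos x ^+ 2 <= sin x ^+ 2.
  by rewrite -exprMn ler_pXn2r ?nnegrE ?mulr_ge0 ?(ltW s0) ?(ltW x0) ?(ltW c0).
have e := cos2Dsin2 x.
rewrite -lerBlDr; rewrite -(ler_pM2r (_ : 0 < x ^+ 2 * sin x ^+ 2)) ?mulr_gt0 ?exprn_gt0//.
have -> : (sin x ^- 2 - 1) * (x ^+ 2 * sin x ^+ 2) = x ^+ 2 * (1 - sin x ^+ 2).
  by field; rewrite gt_eqF.
have -> : x ^- 2 * (x ^+ 2 * sin x ^+ 2) = sin x ^+ 2 by field; rewrite gt_eqF.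
by rewrite -cos2sin2.
Qed.

Definition angle n k : R := (k.*2.+1)%:R * pi / (2 ^ n.+2)%:R.

Lemma angle_bounds n k : (k < 2 ^ n)%N -> 0 < angle n k < pi / 2.
Proof.
move=> kn; have p0 := pi_gt0 R; rewrite /angle divr_gt0 ?mulr_gt0 ?ltr0n ?expn_gt0//=.
rewrite ltr_pdivrMr ?ltr0n ?expn_gt0// mulrC mulrAC -mulrA ltr_pM2l//.
rewrite ltr_pdivlMr// -natrM ltr_nat !expnS; lia.
Qed.

Lemma inv_sin2_half x : 0 < x < pi ->
  (sin (x / 2)) ^- 2 + (sin (pi / 2 - x / 2)) ^- 2 = 4 * (sin x) ^- 2.
Proof.
move=> /andP[x0 x1]; have -> : sin (pi / 2 - x / 2) = cos (x / 2).
  by rewrite -cosBpihalf -cosN; congr cos; ring.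
have h : 0 < x / 2 < pi / 2 by apply/andP; split; lra.
have s0 := sin_gt0_pihalf h.
have c0 : 0 < cos (x / 2) by apply: cos_gt0_pihalf; apply/andP; split; lra.
have -> : sin x = 2 * sin (x / 2) * cos (x / 2).
  have {1}-> : x = (x / 2) *+ 2 by rewrite mulr2n; field.
  by rewrite sin_mulr2n mulr2n; ring.
have e := cos2Dsin2 (x / 2).
have -> : 4 * (2 * sin (x / 2) * cos (x / 2)) ^- 2 =
    (cos (x / 2) ^+ 2 + sin (x / 2) ^+ 2) * (sin (x / 2) * cos (x / 2)) ^- 2.
  by rewrite e; field; rewrite !gt_eqF.
by field; rewrite !gt_eqF.
Qed.

Lemma sum_nat_fold (F : nat -> R) N :
  \sum_(0 <= k < N + N) F k = \sum_(0 <= k < N) (F k + F (N + N - k.+1)%N).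
Proof.
rewrite (big_cat_nat _ (n := N))//=; last by rewrite leq_addr.
rewrite big_split /=; congr (_ + _).
rewrite big_nat_rev /= -{1}[N]add0n big_addn addnK; apply: eq_big_nat => k /andP[_ kN].
by congr F; lia.
Qed.

(* The sum quadruples when the angles are halved; sin x <= x <= tan x then compares
   it with the sum of the inverse odd squares. *)
Lemma sum_inv_sin2 n : \sum_(0 <= k < 2 ^ n) (sin (angle n k)) ^- 2 = 2 * 4 ^+ n.
Proof.
have p0 := pi_gt0 R; elim: n => [|n IHn].
  have := @inv_sin2_half (pi / 2).
  rewrite big_nat1 /angle expr0 mulr1 sin_pihalf expr1n invr1 mulr1.
  have -> : pi / 2 - pi / 2 / 2 = pi / 2 / 2 :> R by field.
  have -> : 1%:R * pi / (2 ^ 2)%:R = pi / 2 / 2 :> R by field.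
  by move=> /(_ _) h; have := h ltac:(apply/andP; split; lra); lra.
(* At level [n + 1] the angles of index [k] and [2^(n+1) - 1 - k] add up to [pi / 2], and each is
   folded with the other into four times the term [k] of level [n]. *)
rewrite expnS mul2n -addnn sum_nat_fold exprS mulrCA -IHn big_distrr /=.
apply: eq_big_nat => k /andP[_ kn].
rewrite -inv_sin2_half; last first.
  by have /andP[h1 h2] := angle_bounds kn; rewrite h1 /=; lra.
have e2 : (2 ^ n.+2)%:R != 0 :> R by rewrite pnatr_eq0 expn_eq0.
have e3 : (2 ^ n.+3)%:R = 2 * (2 ^ n.+2)%:R :> R by rewrite [in LHS]expnS natrM.
congr (sin _ ^- 2 + sin _ ^- 2); first by rewrite /angle e3; field.
rewrite /angle e3.
have -> : ((2 ^ n + 2 ^ n - k.+1).*2.+1 = 2 ^ n.+2 - k.*2.+1)%N by rewrite !expnS; lia.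
rewrite natrB; first by field.
by rewrite !expnS; lia.
Qed.

Lemma odd_squares_bounds n :
  pi ^+ 2 / 8 - pi ^+ 2 / (16 * 2 ^+ n) <= (\sum_(0 <= k < 2 ^ n) (k.*2.+1)%:R ^- 2 : R) <= pi ^+ 2 / 8.
Proof.
have p0 := pi_gt0 R; have p2 : 0 < pi ^+ 2 :> R by rewrite exprn_gt0.
(* The factor between the inverse squares of the angles and of the odd numbers. The summand 1 in
   [inv_sin2_bounds], taken [2^n] times and divided by [c], is the error term. *)
pose c : R := 16 * 4 ^+ n / pi ^+ 2.
have q0 : 0 < 2 ^+ n :> R by rewrite exprn_gt0.
have q4 : 4 ^+ n = (2 ^+ n) ^+ 2 :> R by rewrite -exprM mulnC exprM; congr (_ ^+ _); ring.
have c0 : 0 < c by rewrite /c q4 divr_gt0 ?mulr_gt0 ?exprn_gt0.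
have E k : (angle n k) ^- 2 = c * (k.*2.+1)%:R ^- 2.
  have K0 : (k.*2.+1)%:R != 0 :> R by rewrite pnatr_eq0.
  rewrite /angle /c natrX !exprS q4; move: (_.+1%:R) K0 (2 ^+ n) q0 (@pi R) p0 => K K0 q q0 p p0'.
  by field; rewrite K0 !gt_eqF.
have lo : c * \sum_(0 <= k < 2 ^ n) (k.*2.+1)%:R ^- 2 <= 2 * 4 ^+ n.
  rewrite -sum_inv_sin2 big_distrr /=; apply: ler_sum_nat => k /andP[_ kn].
  by rewrite -E; have /andP[] := inv_sin2_bounds (angle_bounds kn).
have hi : 2 * 4 ^+ n <= c * \sum_(0 <= k < 2 ^ n) (k.*2.+1)%:R ^- 2 + 2 ^+ n.
  rewrite -sum_inv_sin2 big_distrr /=.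
  have -> : 2 ^+ n = \sum_(0 <= k < 2 ^ n) 1 :> R by rewrite sumr_const_nat subn0 natrX.
  rewrite -big_split /=; apply: ler_sum_nat => k /andP[_ kn].
  by rewrite -E; have /andP[] := inv_sin2_bounds (angle_bounds kn).
apply/andP; split; rewrite -(ler_pM2l c0).
  apply: le_trans (_ : 2 * 4 ^+ n - 2 ^+ n <= _); last by rewrite lerBlDr.
  rewrite le_eqVlt; apply/orP; left; apply/eqP; rewrite /c q4.
  by move: (2 ^+ n) q0 (@pi R) p0 => q q0' p p0'; field; rewrite !gt_eqF.
by apply: le_trans lo _; rewrite le_eqVlt; apply/orP; left; apply/eqP; rewrite /c;
  move: (@pi R) p0 => p p0'; field; rewrite gt_eqF.
Qed.

Definition zeta2 N : R := \sum_(1 <= k < N.+1) k%:R ^- 2.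

Lemma zeta2S N : zeta2 N.+1 = zeta2 N + N.+1%:R ^- 2.
Proof. by rewrite /zeta2 big_nat_recr. Qed.

Lemma zeta2_double N : zeta2 N.*2 = \sum_(0 <= k < N) (k.*2.+1)%:R ^- 2 + zeta2 N / 4.
Proof.
elim: N => [|N IHN]; first by rewrite /zeta2 double0 !big_nil mul0r addr0.
rewrite doubleS !zeta2S IHN big_nat_recr//= mulrDl.
have -> : N.*2.+2%:R = 2 * N.+1%:R :> R by rewrite -natrM; congr _%:R; lia.
have K0 : N.+1%:R != 0 :> R by rewrite pnatr_eq0.
by move: (N.+1%:R) K0 (\sum_(_ <= _ < _) _) (zeta2 N) (_%:R ^- 2) => K K0 a b c; field.
Qed.

Lemma zeta2_le M N : (M <= N)%N -> zeta2 M <= zeta2 N.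
Proof.
move=> MN; rewrite /zeta2 (@big_cat_nat _ _ _ M.+1 1 N.+1)//= ?ltnS// lerDl.
by apply: sumr_ge0 => k _; rewrite invr_ge0 sqr_ge0.
Qed.

(** [zeta2 N + 1 / N] is nonincreasing in [N], by comparison with a telescoping sum. *)
Lemma zeta2_tail M N : (0 < M)%N -> (M <= N)%N -> zeta2 N <= zeta2 M + M%:R^-1.
Proof.
move=> M0 MN; suff : zeta2 N + N%:R^-1 <= zeta2 M + M%:R^-1.
  by apply: le_trans; rewrite lerDl invr_ge0.
elim: N MN => [|N IHN]; first by rewrite leqn0 => /eqP ->.
rewrite leq_eqVlt => /orP[/eqP -> //|]; rewrite ltnS => MN.
apply: le_trans (IHN MN); rewrite zeta2S -addrA lerD2l.
have N0 : 0 < N%:R :> R by rewrite ltr0n (leq_trans M0).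
rewrite -natr1; have N1 : 0 < N%:R + 1 :> R by rewrite ltr_wpDl ?ltW.
rewrite -subr_ge0 (_ : _ - _ = (N%:R * (N%:R + 1) ^+ 2)^-1); last by field; rewrite !gt_eqF.
by rewrite invr_ge0 mulr_ge0 ?ltW// exprn_gt0.
Qed.

(** For [M = 2^N], [zeta2 M <= zeta2 (2 M)], which is the odd part plus [zeta2 M / 4]; the odd part
    is at most [pi^2 / 8], and solving for [zeta2 M] gives [pi^2 / 6]. *)
Lemma zeta2_ub N : zeta2 N <= pi ^+ 2 / 6.
Proof.
have le_N : (N <= 2 ^ N)%N by rewrite ltnW// ltn_expl.
have /andP[_ h] := odd_squares_bounds N.
have h1 := zeta2_double (2 ^ N).
have h2 : zeta2 (2 ^ N) <= zeta2 (2 ^ N).*2 by apply: zeta2_le; rewrite -addnn leq_addr.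
by apply: (le_trans (zeta2_le le_N)); move: h h1 h2; lra.
Qed.

(** The same relation, with the tail bound used from [M] to [2 M] and from [N] to [M]. The losses
    add up to [(pi^2 / 12 + 7 / 3) / N], rounded up generously. *)
Lemma zeta2_lb N : (0 < N)%N -> pi ^+ 2 / 6 - (pi ^+ 2 + 3) / N%:R <= zeta2 N.
Proof.
move=> N0; set M := (2 ^ N)%N; have NM : (N <= M)%N by rewrite ltnW// ltn_expl.
have M0 : (0 < M)%N by exact: leq_trans NM.
have /andP[h _] := odd_squares_bounds N.
have h1 := zeta2_double M.
have h2 : zeta2 M.*2 <= zeta2 M + M%:R^-1 by apply: zeta2_tail => //; rewrite -addnn leq_addr.
have h3 : zeta2 M <= zeta2 N + N%:R^-1 by exact: zeta2_tail.
have iM : M%:R^-1 <= N%:R^-1 :> R by rewrite lef_pV2 ?posrE ?ltr0n// ler_nat.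
have p2 : 0 <= pi ^+ 2 :> R by exact: sqr_ge0.
have e : pi ^+ 2 / (16 * 2 ^+ N) = pi ^+ 2 * M%:R^-1 / 16 :> R.
  by rewrite /M natrX invfM; ring.
have h4 : pi ^+ 2 * M%:R^-1 <= pi ^+ 2 * N%:R^-1 :> R by rewrite ler_wpM2l.
have h5 : 0 <= pi ^+ 2 * N%:R^-1 :> R by rewrite mulr_ge0// invr_ge0.
have h6 : 0 <= N%:R^-1 :> R by rewrite invr_ge0.
move: h h1 h2 h3 iM h4 h5 h6; rewrite e -/M mulrDl.
move: (pi ^+ 2) (\sum_(_ <= _ < _) _) => P S; move: (P / N%:R) (P / M%:R) => a b.
by move: (zeta2 M) (zeta2 M.*2) (zeta2 N) (M%:R^-1) (N%:R^-1) => *; lra.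
Qed.

End Basel.

(** * Moebius sums *)

Definition mobius (n : nat) : int :=
  \prod_(p <- primes n) (if logn p n == 1%N then -1 else 0).

Lemma mobius_norm n : `|mobius n| <= 1.
Proof.
rewrite /mobius; elim: (primes n) => [|p s IHs]; first by rewrite big_nil normr1.
rewrite big_cons normrM; case: ifP => _; last by rewrite normr0 mul0r.
by rewrite normrN1 mul1r.
Qed.

Lemma mobius_dvd_sqr p n : prime p -> (0 < n)%N -> (p ^ 2 %| n)%N -> mobius n = 0.
Proof.
move=> pp n0 d; have pn : p \in primes n.
  by rewrite mem_primes pp n0 (dvdn_trans _ d)// dvdn_exp.
rewrite /mobius (big_rem p)//=; case: eqP => [e|_]; last by rewrite mul0r.
by move: d; rewrite pfactor_dvdn// e.
Qed.

Lemma mobius_mul_prime p n : prime p -> (0 < n)%N -> ~~ (p %| n)%N ->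
  mobius (p * n) = - mobius n.
Proof.
move=> pp n0 d; have p0 := prime_gt0 pp.
have pn : p \notin primes n by rewrite mem_primes pp n0.
rewrite /mobius (perm_big (p :: primes n)) /=; last first.
  apply: uniq_perm; rewrite /= ?primes_uniq ?pn// => q.
  by rewrite primesM// primes_prime// !inE.
rewrite big_cons lognM// logn_prime// eqxx.
have -> : logn p n = 0%N by apply/eqP; rewrite -leqn0 leqNgt logn_gt0.
rewrite addn0 eqxx mulN1r; congr (- _); apply: eq_big_seq => q qn.
by rewrite lognM// logn_prime//; case: (q =P p) => // e; move: qn; rewrite e (negbTE pn).
Qed.

(** For a prime [p] dividing [n], divisors that are multiples of [p^2] contribute nothing and the
    others cancel in pairs [e], [p e]. *)
Lemma sum_mobius_divisors n : (0 < n)%N ->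
  \sum_(d <- divisors n) mobius d = (n == 1%N)%:R.
Proof.
move=> n0; have [n1|n1] := leqP n 1.
  have -> : n = 1%N by lia.
  by rewrite (_ : divisors 1 = [:: 1%N])// big_seq1 /mobius big_nil.
rewrite gtn_eqF//; pose p := pdiv n.
have pp : prime p by exact: pdiv_prime.
have pn : (p %| n)%N by exact: pdiv_dvd.
have p0 := prime_gt0 pp.
rewrite (bigID (fun d => p %| d)%N) /= (bigID (fun d => p ^ 2 %| d)%N) /=.
rewrite big1_seq ?add0r; last first.
  move=> d /andP[/andP[_ d2]]; rewrite -dvdn_divisors// => dn.
  by apply: (mobius_dvd_sqr pp _ d2); apply: dvdn_gt0 dn.
rewrite -big_filter (perm_big [seq (p * e)%N | e <- divisors n & ~~ (p %| e)%N]) /=.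
  rewrite big_map big_filter -big_split /= big1_seq// => e /andP[pe].
  rewrite -dvdn_divisors// => en.
  by rewrite mobius_mul_prime ?addNr//; apply: dvdn_gt0 en.
apply: uniq_perm; first by rewrite filter_uniq ?divisors_uniq.
  rewrite map_inj_uniq ?filter_uniq ?divisors_uniq// => a b /eqP.
  by rewrite eqn_pmul2l// => /eqP.
move=> d; rewrite mem_filter -dvdn_divisors//; apply/idP/mapP.
  case/andP => /andP[/dvdnP[e ->] pe] dn; exists e; last by rewrite mulnC.
  rewrite mem_filter -dvdn_divisors// (dvdn_trans (dvdn_mulr p (dvdnn e)) dn) andbT.
  by apply: contra pe => pe; rewrite expnS expn1 dvdn_pmul2r.
case=> e; rewrite mem_filter -dvdn_divisors// => /andP[pe en] ->.
rewrite dvdn_mulr//= expnS expn1 dvdn_pmul2l// pe /=.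
by rewrite Gauss_dvd ?pn ?en// prime_coprime.
Qed.

Lemma sum_mobius n M : (0 < n <= M)%N ->
  \sum_(1 <= d < M.+1 | (d %| n)%N) mobius d = (n == 1%N)%:R.
Proof.
move=> /andP[n0 nM]; rewrite -sum_mobius_divisors// -big_filter.
apply: perm_big; apply: uniq_perm; rewrite ?filter_uniq ?iota_uniq ?divisors_uniq// => d.
rewrite mem_filter mem_index_iota -dvdn_divisors//.
have [dn|//] := boolP (d %| n)%N; rewrite (dvdn_gt0 n0 dn) ltnS /=.
by rewrite (leq_trans (dvdn_leq n0 dn)).
Qed.

Lemma sum_mobius_mul q g M : (0 < q)%N -> (0 < g <= M)%N ->
  \sum_(1 <= d < M.+1 | (q * d %| g)%N) mobius d = (g == q)%:R.
Proof.
move=> q0 /andP[g0 gM]; have [/dvdnP[k e]|qg] := boolP (q %| g)%N; last first.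
  rewrite big1 => [|d dg].
    by case: eqP qg => // ->; rewrite dvdnn.
  by rewrite (dvdn_trans (dvdn_mulr d (dvdnn q)) dg) in qg.
have k0 : (0 < k)%N by move: g0; rewrite e muln_gt0 => /andP[].
rewrite (eq_bigl (fun d => d %| k)%N); last first.
  by move=> d; rewrite e mulnC dvdn_pmul2r.
rewrite sum_mobius; last by rewrite k0 (leq_trans _ gM)// e leq_pmulr.
by rewrite e -{2}[q]mul1n eqn_pmul2r.
Qed.

(** * Weighted sums over multiples and the bound on the sum of mu(d) / d *)

Section Sums.
Variable R : realType.

Local Notation mu d := ((mobius d)%:~R : R).

Lemma mu_norm d : `|mu d| <= 1.
Proof. by rewrite -intr_norm lerz1 mobius_norm. Qed.

Lemma norm_sum_mu (F : nat -> R) (c : R) M : (forall d, (1 <= d < M.+1)%N -> `|F d| <= c) ->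
  `|\sum_(1 <= d < M.+1) mu d * F d| <= M%:R * c.
Proof.
move=> hF; apply: le_trans (ler_norm_sum _ _ _) _.
apply: (@le_trans _ _ (\sum_(1 <= d < M.+1) c)).
  rewrite big_nat [leRHS]big_nat; apply: ler_sum => d /hF h; rewrite normrM.
  by rewrite -[c]mul1r ler_pM// mu_norm.
by rewrite sumr_const_nat subn1 mulr_natl.
Qed.

(** The one-dimensional factor of [f]: after Moebius inversion, the sum over [i] and [j] both
    divisible by [D] is a product of two of these. *)
Definition multiples_sum m D : R := \sum_(1 <= i < m | (D %| i)%N) (m%:R - i%:R).

(** The closed form of an arithmetic progression, doubled and written with quotient and remainder;
    the induction rests on the increment [m %/ D] from [m] to [m + 1]. *)
Lemma multiples_sumE m D : (0 < D)%N ->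
  2 * multiples_sum m D + m%:R = (m %/ D)%:R * (m + m %% D)%:R + (m %% D)%:R.
Proof.
move=> D0; elim: m => [|m IHm].
  by rewrite /multiples_sum big_geq// mulr0 div0n mul0r mod0n.
have step : multiples_sum m.+1 D = multiples_sum m D + (m %/ D)%:R.
  have [->|m0] := posnP m; first by rewrite /multiples_sum !big_geq// div0n addr0.
  have cnt : \sum_(1 <= i < m.+1 | (D %| i)%N) 1 = (m %/ D)%:R :> R.
    elim: (m) => [|j IHj]; first by rewrite big_geq// div0n.
    by rewrite big_mkcond big_nat_recr//= -big_mkcond IHj divnS// natrD addrC; case: (D %| _)%N.
  have mk (F : nat -> R) k : \sum_(1 <= i < k | (D %| i)%N) F i =
      \sum_(1 <= i < k) if (D %| i)%N then F i else 0 by exact: big_mkcond.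
  rewrite -cnt /multiples_sum !mk.
  rewrite !big_nat_recr//= addrA [X in _ = _ + X](_ : _ = if (D %| m)%N then m.+1%:R - m%:R else 0).
    congr (_ + _); rewrite -big_split /=; apply: eq_bigr => i _.
    by case: ifP => _; rewrite ?addr0// -natr1; ring.
  by case: ifP => // _; rewrite -natr1; ring.
have dv := divn_eq m D; have r := ltn_pmod m D0.
have [e|ne] := eqVneq (m %% D).+1 D.
  have d1 : (m.+1 %/ D = (m %/ D).+1)%N.
    by rewrite {1}dv -addnS e -mulSnr mulnK.
  have m1 : (m.+1 %% D = 0)%N.
    by rewrite {1}dv -addnS e -mulSnr modnMl.
  have key : (m.+1 = (m %/ D).+1 * (m %% D).+1)%N by rewrite {1}dv -addnS e mulSnr.
  rewrite step d1 m1 addn0 addr0 -!natr1.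
  move: IHm; move: (multiples_sum m D) (m %/ D)%N (m %% D)%N key => s k t key IH.
  have keyR : m%:R + 1 = (k%:R + 1) * (t%:R + 1) :> R by rewrite !natr1 -natrM key.
  move: IH; rewrite natrD.
  have -> : m%:R = (k%:R + 1) * (t%:R + 1) - 1 :> R by rewrite -keyR addrK.
  by move=> IH; lra.
have d1 : (m.+1 %/ D = m %/ D)%N.
  by rewrite {1}dv -addnS divnMDl// (@divn_small (m %% D).+1) ?addn0//; lia.
have m1 : (m.+1 %% D = (m %% D).+1)%N.
  by rewrite {1}dv -addnS modnMDl (@modn_small (m %% D).+1)//; lia.
rewrite step d1 m1; move: IHm; rewrite !natrD -!natr1; lra.
Qed.

Lemma multiples_sum_approx m D : (0 < D)%N -> exists t : R,
  [/\ multiples_sum m D = (m%:R ^+ 2 / D%:R - m%:R + t) / 2, 0 <= t, t <= m%:R & t <= D%:R / 4].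
Proof.
move=> D0; have D1 : 0 < D%:R :> R by rewrite ltr0n.
pose r : R := (m %% D)%:R; have r0 : 0 <= r by [].
have rD : r <= D%:R by rewrite ler_nat ltnW// ltn_pmod.
have rm : r <= m%:R by rewrite ler_nat leq_mod.
have mE : m%:R = (m %/ D)%:R * D%:R + r :> R by rewrite -natrM -natrD -divn_eq.
have := multiples_sumE m D0; rewrite natrD -/r => E.
(* [t = r (D - r) / D] for the remainder [r], at most [D / 4] by completing the square. This bound
   later cancels a factor [1 / D] and so avoids a harmonic sum. *)
exists (r - r ^+ 2 / D%:R); split.
- have -> : m%:R ^+ 2 / D%:R = (m %/ D)%:R * (m%:R + r) + r ^+ 2 / D%:R :> R.
    by rewrite mE; field; rewrite gt_eqF.
  by move: E; move: (r ^+ 2 / D%:R) => c; lra.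
- by rewrite subr_ge0 ler_pdivrMr// expr2 ler_wpM2l.
- by apply: le_trans rm; rewrite gerBl divr_ge0// sqr_ge0.
rewrite -subr_ge0 (_ : _ - _ = (D%:R / 2 - r) ^+ 2 / D%:R); last by field; rewrite gt_eqF.
by rewrite divr_ge0// sqr_ge0.
Qed.

Lemma sum_mu_multiples m : (0 < m)%N ->
  0 <= \sum_(1 <= d < m.+1) mu d * multiples_sum m d <= m%:R.
Proof.
move=> m0.
have -> : \sum_(1 <= d < m.+1) mu d * multiples_sum m d =
    \sum_(1 <= i < m) (m%:R - i%:R) * (i == 1%N)%:R.
  under eq_bigr => d _ do rewrite /multiples_sum big_distrr big_mkcond /=.
  rewrite exchange_big /= big_nat [RHS]big_nat; apply: eq_bigr => i /andP[i0 im].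
  have -> : (i == 1%N)%:R = ((i == 1%N)%:R : int)%:~R :> R by case: eqP.
  rewrite -(@sum_mobius i m) ?i0 1?ltnW// [in RHS]big_mkcond /= rmorph_sum big_distrr /=.
  by apply: eq_bigr => d _; case: ifP => _; rewrite ?mulr0// mulrC.
rewrite big_nat; apply/andP; split.
  apply: sumr_ge0 => i /andP[_ im]; rewrite mulr_ge0// subr_ge0 ler_nat ltnW//.
rewrite -big_nat; case: m m0 => [//|[|m] _]; first by rewrite big_geq.
rewrite big_ltn//= mulr1 big1_seq ?addr0 ?gerBl// => i /andP[_].
by rewrite mem_index_iota => /andP[i1 _]; rewrite gtn_eqF ?mulr0.
Qed.

(** Replacing [multiples_sum m d] by its approximation in [sum_mu_multiples] bounds [m^2] times the
    sum by [2 m + m^2], hence by [3 m^2]. *)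
Lemma sum_mu_inv m : (0 < m)%N -> `|\sum_(1 <= d < m.+1) mu d * d%:R^-1| <= 3.
Proof.
move=> m0; have mR : 0 < m%:R :> R by rewrite ltr0n.
have m1 : 1 <= m%:R :> R by rewrite ler1n.
have h := sum_mu_multiples m0.
pose t d : R := 2 * multiples_sum m d - m%:R ^+ 2 / d%:R + m%:R.
have tb d : (1 <= d < m.+1)%N -> `|m%:R - t d| <= m%:R.
  move=> /andP[d0 _]; have [s [e s0 s1 _]] := multiples_sum_approx m d0.
  have -> : t d = s by rewrite /t e; lra.
  by rewrite ger0_norm ?subr_ge0// gerBl.
have hb := norm_sum_mu tb.
have e : m%:R ^+ 2 * (\sum_(1 <= d < m.+1) mu d * d%:R^-1) =
    2 * (\sum_(1 <= d < m.+1) mu d * multiples_sum m d) +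
    \sum_(1 <= d < m.+1) mu d * (m%:R - t d).
  rewrite !big_distrr -big_split /=; apply: eq_bigr => d _; rewrite /t; ring.
rewrite -(ler_pM2l (_ : 0 < m%:R ^+ 2)) ?exprn_gt0// -[X in X * `|_|]ger0_norm ?sqr_ge0//.
rewrite -normrM e; apply: le_trans (ler_normD _ _) _.
have /andP[h0 h1] := h.
rewrite normrM (ger0_norm h0) ger0_norm//.
have : m%:R <= m%:R * m%:R :> R by rewrite ler_peMr.
by rewrite expr2; lra.
Qed.

End Sums.

(** * The density of pairs with a given gcd *)

Section Density.
Variable R : realType.
Local Notation mu d := ((mobius d)%:~R : R).
Local Notation zeta2 := (@zeta2 R).
Local Notation multiples_sum := (@multiples_sum R).

Lemma zeta2_multiples d D : (0 < d)%N ->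
  \sum_(1 <= k < D.+1 | (d %| k)%N) k%:R ^- 2 = d%:R ^- 2 * zeta2 (D %/ d).
Proof.
move=> d0; elim: D => [|D IHD].
  by rewrite big_geq// div0n /zeta2 big_geq// mulr0.
rewrite big_mkcond big_nat_recr//= -big_mkcond IHD divnS//.
case: ifP => [/dvdnP[k e]|_]; last by rewrite addr0.
have kE : ((D %/ d).+1 = k)%N by rewrite -[LHS]add1n -[1%N]/(true : nat) -(mulnK k d0) -e divnS// e dvdn_mull.
rewrite add1n zeta2S mulrDr; congr (_ + _).
by rewrite kE e mulnC natrM exprMn invfM.
Qed.

(** The finite form of [zeta(2) * sum mu(d) / d^2 = 1]: after exchanging the sums, Moebius
    cancellation leaves only [k = 1]. *)
Lemma sum_mu_zeta2 D : (0 < D)%N ->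
  \sum_(1 <= d < D.+1) mu d * (d%:R ^- 2 * zeta2 (D %/ d)) = 1.
Proof.
move=> D0; transitivity (\sum_(1 <= k < D.+1) k%:R ^- 2 * (k == 1%N)%:R : R); last first.
  rewrite big_ltn ?ltnS// expr1n invr1 mulr1 big1_seq ?addr0// => k /andP[_].
  by rewrite mem_index_iota => /andP[k1 _]; rewrite gtn_eqF ?mulr0.
transitivity (\sum_(1 <= d < D.+1) \sum_(1 <= k < D.+1)
    if (d %| k)%N then mu d * k%:R ^- 2 else 0).
  rewrite big_nat [RHS]big_nat; apply: eq_bigr => d /andP[d0 _].
  by rewrite -zeta2_multiples// big_distrr big_mkcond.
rewrite exchange_big /= big_nat [RHS]big_nat; apply: eq_bigr => k /andP[k0 kD].
have -> : (k == 1%N)%:R = ((k == 1%N)%:R : int)%:~R :> R by case: eqP.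
rewrite -(@sum_mobius k D) ?k0// [in RHS]big_mkcond /= rmorph_sum big_distrr /=.
by apply: eq_bigr => d _; case: ifP => _; rewrite ?mulr0// mulrC.
Qed.

(** Terms up to [T] are bounded by 1 and the later ones by [1 / T]; a logarithmic bound would not
    improve the use made of it. *)
Lemma sum_inv_sqr_le T : (0 < T)%N -> \sum_(1 <= d < (T ^ 2).+1) d%:R^-1 <= 2 * T%:R :> R.
Proof.
move=> T0; have TR : 0 < T%:R :> R by rewrite ltr0n.
apply: (@le_trans _ _ (\sum_(1 <= d < (T ^ 2).+1) ((d <= T)%:R + T%:R^-1))).
  rewrite big_nat [leRHS]big_nat; apply: ler_sum => d /andP[d0 _].
  have [dT|Td] := leqP d T.
    by rewrite ler_wpDr ?invr_ge0// invf_le1 ?ler1n// ltr0n.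
  by rewrite add0r lef_pV2 ?posrE ?ltr0n// ler_nat ltnW.
rewrite big_split /= sumr_const_nat subn1 /= -[T%:R^-1 *+ _]mulr_natr.
rewrite (_ : T%:R^-1 * (T ^ 2)%:R = T%:R); last by rewrite natrX; field; rewrite gt_eqF.
suff : \sum_(1 <= d < (T ^ 2).+1) ((d <= T)%:R : R) <= T%:R by lra.
rewrite (@big_cat_nat _ _ _ T.+1)//=; last by rewrite ltnS -{1}[T]expn1 leq_pexp2l.
rewrite [X in _ + X]big_nat [X in _ + X]big1 ?addr0; last first.
  by move=> d /andP[Td _]; rewrite leqNgt Td.
apply: (@le_trans _ _ (\sum_(1 <= d < T.+1) 1)); last by rewrite sumr_const_nat subn1.
by apply: ler_sum => d _; case: (_ <= _)%N.
Qed.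

Definition density_bound : R := 1 + 4 * (pi ^+ 2 + 3) / (pi ^+ 2 / 6).

(* The identity [sum_mu_zeta2] is used at D^2 rather than at D: the error of the
   truncated zeta sums is then D^-2 times the sum of 1/d for d <= D^2, which is
   O(1/D), like the tail from D to D^2. *)
Lemma sum_mu_inv_sqr D : (0 < D)%N ->
  `|\sum_(1 <= d < D.+1) mu d * d%:R ^- 2 - 6 / pi ^+ 2| <= density_bound / D%:R.
Proof.
move=> D0; have DR : 0 < D%:R :> R by rewrite ltr0n.
have p2 : 0 < pi ^+ 2 :> R by rewrite exprn_gt0// pi_gt0.
pose a E : R := \sum_(1 <= d < E.+1) mu d * d%:R ^- 2.
pose z : R := pi ^+ 2 / 6; pose C : R := pi ^+ 2 + 3.
have z0 : 0 < z by rewrite divr_gt0.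
have C0 : 0 < C by rewrite addr_gt0.
have DE : (D <= D ^ 2)%N by rewrite -{1}[D]expn1 leq_pexp2l.
have tail : `|a (D ^ 2)%N - a D| <= D%:R^-1.
  have cat (F : nat -> R) : \sum_(1 <= d < (D ^ 2).+1) F d =
      \sum_(1 <= d < D.+1) F d + \sum_(D.+1 <= d < (D ^ 2).+1) F d.
    by rewrite (@big_cat_nat _ _ _ D.+1).
  rewrite /a cat addrAC subrr add0r.
  apply: (le_trans (ler_norm_sum _ _ _)).
  apply: (@le_trans _ _ (zeta2 (D ^ 2) - zeta2 D)).
    rewrite /zeta2 cat addrAC subrr add0r.
    apply: ler_sum => d _; have d2 : 0 <= d%:R ^- 2 :> R by rewrite invr_ge0 sqr_ge0.
    by rewrite normrM (ger0_norm d2) ler_piMl// mu_norm.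
  by rewrite lerBlDl zeta2_tail.
have main : `|z * a (D ^ 2)%N - 1| <= 4 * C / D%:R.
  set E := (D ^ 2)%N; have E0 : (0 < E)%N by rewrite expn_gt0 D0.
  have ER : 0 < E%:R :> R by rewrite ltr0n.
  rewrite -[X in _ - X](sum_mu_zeta2 E0) /a big_distrr -sumrB /=.
  apply: (le_trans (ler_norm_sum _ _ _)).
  apply: (@le_trans _ _ (\sum_(1 <= d < E.+1) (2 * C / E%:R) * d%:R^-1)).
    rewrite big_nat [leRHS]big_nat; apply: ler_sum => d /andP[d0 dE].
    have dR : 0 < d%:R :> R by rewrite ltr0n.
    have k0 : (0 < E %/ d)%N by rewrite divn_gt0.
    have kR : 0 < (E %/ d)%:R :> R by rewrite ltr0n.
    have u0 : 0 <= z - zeta2 (E %/ d) by rewrite subr_ge0 zeta2_ub.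
    have u1 : z - zeta2 (E %/ d) <= C / (E %/ d)%:R.
      by have := zeta2_lb R k0; rewrite -/z -/C; lra.
    have -> : z * (mu d * d%:R ^- 2) - mu d * (d%:R ^- 2 * zeta2 (E %/ d)) =
      mu d * (d%:R ^- 2 * (z - zeta2 (E %/ d))) by ring.
    have d2 : 0 <= d%:R ^- 2 :> R by rewrite invr_ge0 sqr_ge0.
    rewrite normrM (@ger0_norm _ (_ * _)) ?mulr_ge0//.
    apply: (@le_trans _ _ (d%:R ^- 2 * (z - zeta2 (E %/ d)))).
      by rewrite ler_piMl ?mu_norm// mulr_ge0.
    apply: (@le_trans _ _ (d%:R ^- 2 * (C / (E %/ d)%:R))); first by rewrite ler_wpM2l.
    have Ed : E%:R <= 2 * d%:R * (E %/ d)%:R :> R.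
      rewrite -!natrM ler_nat {1}(divn_eq E d); have := ltn_pmod E d0.
      by have : (d <= d * (E %/ d))%N; [rewrite leq_pmulr|lia].
    rewrite -(ler_pM2r (_ : 0 < d%:R ^+ 2 * (E %/ d)%:R * E%:R)) ?mulr_gt0 ?exprn_gt0//.
    have -> : d%:R ^- 2 * (C / (E %/ d)%:R) * (d%:R ^+ 2 * (E %/ d)%:R * E%:R) = C * E%:R.
      by field; rewrite !gt_eqF.
    have -> : 2 * C / E%:R / d%:R * (d%:R ^+ 2 * (E %/ d)%:R * E%:R) =
      C * (2 * d%:R * (E %/ d)%:R) by field; rewrite !gt_eqF.
    by rewrite ler_wpM2l// ltW.
  rewrite -big_distrr /=; apply: (@le_trans _ _ (2 * C / E%:R * (2 * D%:R))).
    by rewrite ler_wpM2l ?sum_inv_sqr_le// divr_ge0 ?mulr_ge0// ltW.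
  rewrite /E natrX le_eqVlt; apply/orP; left; apply/eqP.
  by move: (C) => c; field; rewrite gt_eqF.
rewrite -/(a D) -(ler_pM2l z0) -{1}[z]gtr0_norm// -normrM mulrBr.
have -> : z * (6 / pi ^+ 2) = 1.
  by rewrite /z; move: (pi ^+ 2) p2 => p p0; field; rewrite gt_eqF.
have -> : z * a D - 1 = (z * a (D ^ 2)%N - 1) - z * (a (D ^ 2)%N - a D) by ring.
apply: (le_trans (ler_normB _ _)); rewrite normrM (gtr0_norm z0).
have : z * `|a (D ^ 2)%N - a D| <= z * D%:R^-1 by rewrite ler_wpM2l// ltW.
have -> : z * (density_bound / D%:R) = z * D%:R^-1 + 4 * C / D%:R.
  rewrite /density_bound -/z -/C; move: (z) (C) z0 => z' C' z0'; field.
  by rewrite !gt_eqF.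
by lra.
Qed.

(** The part of [f] in the open positive quadrant. *)
Definition coprime_sum q m n : R := \sum_(1 <= i < m) \sum_(1 <= j < n | gcdn i j == q)
  (m%:R - i%:R) * (n%:R - j%:R).

Lemma coprime_sumE q m n : (0 < q)%N -> coprime_sum q m n =
  \sum_(1 <= d < m.+1) mu d * (multiples_sum m (q * d) * multiples_sum n (q * d)).
Proof.
move=> q0.
pose F d i j : R := if (q * d %| i)%N && (q * d %| j)%N
  then mu d * ((m%:R - i%:R) * (n%:R - j%:R)) else 0.
transitivity (\sum_(1 <= d < m.+1) \sum_(1 <= i < m) \sum_(1 <= j < n) F d i j); last first.
  apply: eq_bigr => d _; rewrite /multiples_sum big_distrl big_distrr [RHS]big_mkcond /=.
  apply: eq_bigr => i _; case: ifP => qi; last first.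
    by rewrite big1// => j _; rewrite /F qi.
  rewrite big_distrr big_distrr [RHS]big_mkcond /=; apply: eq_bigr => j _.
  by rewrite /F qi /=; case: ifP.
rewrite exchange_big /= /coprime_sum [LHS]big_nat [RHS]big_nat; apply: eq_bigr => i /andP[i0 im].
rewrite exchange_big /= big_mkcond big_nat [RHS]big_nat; apply: eq_bigr => j /andP[j0 jn].
have g0 : (0 < gcdn i j <= m)%N.
  by rewrite gcdn_gt0 i0 (leq_trans (dvdn_leq i0 (dvdn_gcdl i j)))// ltnW.
transitivity ((m%:R - i%:R) * (n%:R - j%:R) * ((gcdn i j == q)%:R : int)%:~R : R).
  by case: eqP => _; rewrite ?mulr1 ?mulr0.
rewrite -(sum_mobius_mul q0 g0) [in LHS]big_mkcond /= rmorph_sum big_distrr /=.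
apply: eq_bigr => d _; rewrite /F dvdn_gcd; case: ifP => _; last by rewrite mulr0.
by rewrite mulrC.
Qed.

(** The constant collects [density_bound] from truncating the sum of [mu(d) / d^2], [6 = 2 * 3] from
    the sum of [mu(d) / d], and [3 / 2] from [err], the last two rounded up to 8. *)
Lemma coprime_sum_asymptotic q m n : (0 < q)%N -> (0 < m <= n)%N ->
  `|4 * coprime_sum q m n - 6 / (pi ^+ 2 * q%:R ^+ 2) * m%:R ^+ 2 * n%:R ^+ 2| <=
  (density_bound + 8) * (m%:R * n%:R ^+ 2).
Proof.
move=> q0 /andP[m0 mn]; have n0 : (0 < n)%N by exact: leq_trans mn.
have mR : 0 < m%:R :> R by rewrite ltr0n.
have nR : 0 < n%:R :> R by rewrite ltr0n.
have mnR : m%:R <= n%:R :> R by rewrite ler_nat.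
have qR : 0 < q%:R :> R by rewrite ltr0n.
have q1 : q%:R^-1 <= 1 :> R by rewrite invf_le1// ler1n.
pose t k d : R := 2 * multiples_sum k (q * d) - k%:R ^+ 2 / (q * d)%:R + k%:R.
have tP k d : (0 < d)%N -> [/\ 0 <= t k d, t k d <= k%:R & t k d <= (q * d)%:R / 4].
  move=> d0; have qd : (0 < q * d)%N by rewrite muln_gt0 q0.
  have [s [e s0 s1 s2]] := multiples_sum_approx R k qd.
  have -> : t k d = s by rewrite /t e; lra.
  by [].
(* What remains of the product once the terms in [d^-2] and in [d^-1] with constant coefficients are
   split off. Each piece is [O(n^2)] uniformly in [d], and there are [m] values of [d]. *)
pose err d : R := m%:R ^+ 2 / (q * d)%:R * t n d + n%:R ^+ 2 / (q * d)%:R * t m d +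
  (t m d - m%:R) * (t n d - n%:R).
have E : 4 * coprime_sum q m n =
  m%:R ^+ 2 * n%:R ^+ 2 / q%:R ^+ 2 * (\sum_(1 <= d < m.+1) mu d * d%:R ^- 2)
  - (n%:R * m%:R ^+ 2 + m%:R * n%:R ^+ 2) / q%:R * (\sum_(1 <= d < m.+1) mu d * d%:R^-1)
  + \sum_(1 <= d < m.+1) mu d * err d.
  rewrite coprime_sumE// !big_distrr -sumrB -big_split /=.
  rewrite big_nat [RHS]big_nat; apply: eq_bigr => d /andP[d0 _].
  have dR : 0 < d%:R :> R by rewrite ltr0n.
  have -> : 4 * (mu d * (multiples_sum m (q * d) * multiples_sum n (q * d))) =
    mu d * ((2 * multiples_sum m (q * d)) * (2 * multiples_sum n (q * d))) by ring.
  have e k : 2 * multiples_sum k (q * d) = t k d + k%:R ^+ 2 / (q * d)%:R - k%:R.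
    by rewrite /t; ring.
  rewrite !e /err natrM; move: (t m d) (t n d) (mu d) => u v w.
  by field; rewrite !gt_eqF.
have errb d : (1 <= d < m.+1)%N -> `|err d| <= 3 / 2 * n%:R ^+ 2.
  move=> /andP[d0 _]; have [a0 a1 a2] := tP m d d0; have [b0 b1 b2] := tP n d d0.
  have qdR : 0 < (q * d)%:R :> R by rewrite ltr0n muln_gt0 q0.
  have h1 : 0 <= m%:R ^+ 2 / (q * d)%:R * t n d <= n%:R ^+ 2 / 4.
    apply/andP; split; first by rewrite mulr_ge0// divr_ge0// sqr_ge0.
    apply: (@le_trans _ _ (m%:R ^+ 2 / (q * d)%:R * ((q * d)%:R / 4))).
      by rewrite ler_wpM2l// divr_ge0// sqr_ge0.
    rewrite mulrA divfK ?gt_eqF// ler_wpM2r// ler_pXn2r ?nnegrE//.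
  have h2 : 0 <= n%:R ^+ 2 / (q * d)%:R * t m d <= n%:R ^+ 2 / 4.
    apply/andP; split; first by rewrite mulr_ge0// divr_ge0// sqr_ge0.
    apply: (@le_trans _ _ (n%:R ^+ 2 / (q * d)%:R * ((q * d)%:R / 4))).
      by rewrite ler_wpM2l// divr_ge0// sqr_ge0.
    by rewrite mulrA divfK ?gt_eqF.
  have h3 : 0 <= (t m d - m%:R) * (t n d - n%:R) <= n%:R ^+ 2.
    rewrite mulr_le0 ?subr_le0//= -mulrNN expr2 !opprB.
    by apply: ler_pM; rewrite ?subr_ge0//; lra.
  rewrite ger0_norm; first by move: h1 h2 h3; rewrite /err; lra.
  by move: h1 h2 h3; rewrite /err; lra.
have B3 := norm_sum_mu errb.
have B2 := sum_mu_inv R m0.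
have B1 := sum_mu_inv_sqr m0.
have iq0 : 0 <= q%:R^-1 :> R by rewrite invr_ge0.
have p2 : 0 < pi ^+ 2 :> R by rewrite exprn_gt0// pi_gt0.
have db0 : 0 <= density_bound.
  rewrite /density_bound; move: (pi ^+ 2) p2 => p /ltW p0.
  by rewrite addr_ge0 ?divr_ge0 ?mulr_ge0 ?addr_ge0.
rewrite E; set s2 := \sum_(_ <= _ < _) _ * _ ^- 2; set s1 := \sum_(_ <= _ < _) _ * _^-1.
set s3 := \sum_(_ <= _ < _) _.
have -> : 6 / (pi ^+ 2 * q%:R ^+ 2) * m%:R ^+ 2 * n%:R ^+ 2 =
   m%:R ^+ 2 * n%:R ^+ 2 / q%:R ^+ 2 * (6 / pi ^+ 2) :> R.
  by move: (pi ^+ 2) p2 => p p0; field; rewrite !gt_eqF.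
set c := m%:R ^+ 2 * n%:R ^+ 2 / q%:R ^+ 2; set b := (_ + _) / q%:R.
have -> : c * s2 - b * s1 + s3 - c * (6 / pi ^+ 2) = c * (s2 - 6 / pi ^+ 2) - b * s1 + s3.
  by ring.
have m2n2 : 0 <= m%:R ^+ 2 * n%:R ^+ 2 :> R by rewrite mulr_ge0// sqr_ge0.
have c0 : 0 <= c by rewrite divr_ge0// sqr_ge0.
have cle : c <= m%:R ^+ 2 * n%:R ^+ 2.
  by rewrite /c ler_piMr// -exprVn exprn_ile1.
have mn2 : n%:R * m%:R ^+ 2 <= m%:R * n%:R ^+ 2 :> R.
  by rewrite !expr2 mulrCA ler_pM2l// mulrC ler_pM2r.
have b0 : 0 <= b by rewrite divr_ge0// addr_ge0// mulr_ge0// sqr_ge0.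
have ble : b <= 2 * (m%:R * n%:R ^+ 2).
  apply: (@le_trans _ _ (n%:R * m%:R ^+ 2 + m%:R * n%:R ^+ 2)); last by lra.
  by rewrite /b ler_piMr// addr_ge0// mulr_ge0// sqr_ge0.
have T1 : `|c * (s2 - 6 / pi ^+ 2)| <= density_bound * (m%:R * n%:R ^+ 2).
  rewrite normrM (ger0_norm c0).
  apply: (@le_trans _ _ (m%:R ^+ 2 * n%:R ^+ 2 * (density_bound / m%:R))).
    by apply: ler_pM.
  by rewrite le_eqVlt; apply/orP; left; apply/eqP; move: density_bound => k; field; rewrite gt_eqF.
have T2 : `|b * s1| <= 6 * (m%:R * n%:R ^+ 2).
  rewrite normrM (ger0_norm b0); apply: (@le_trans _ _ (2 * (m%:R * n%:R ^+ 2) * 3)); last by lra.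
  by apply: ler_pM.
apply: (le_trans (ler_normD _ _)); have := ler_normB (c * (s2 - 6 / pi ^+ 2)) (b * s1).
by move: B3 T1 T2; rewrite -/s3; lra.
Qed.

End Density.

(** * Asymptotics *)

Lemma sum_open_range_even (V : zmodType) (h : int -> V) m :
  (forall i, h (- i) = h i) ->
  \sum_(i <- open_range m.+1) h i = h 0 + (\sum_(1 <= i < m.+1) h i%:Z) *+ 2.
Proof.
move=> hN; elim: m => [|m IHm].
  by rewrite /open_range /= big_seq1 big_geq// mul0rn addr0 subrr.
rewrite sum_open_rangeS IHm hN [in RHS]big_nat_recr// mulrnDl.
  by rewrite [in RHS](mulr2n (h _)) -!addrA.
Qed.

Section Asymptotics.
Variable R : realType.

Lemma sum_tent_le q m : (0 < m)%N ->
  0 <= \sum_(1 <= i < m) (if i == q then m%:R - i%:R else 0 : R) <= m%:R.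
Proof.
move=> m0; apply/andP; split.
  rewrite big_nat; apply: sumr_ge0 => i /andP[_ im].
  by case: ifP => // _; rewrite subr_ge0 ler_nat ltnW.
case: (boolP (q \in index_iota 1 m)) => qm.
  rewrite (bigD1_seq q) ?iota_uniq//= eqxx big1 ?addr0 ?gerBl// => i /negbTE iq.
  by rewrite iq.
rewrite big_nat big1// => i im; case: eqP => // iq.
by rewrite -iq mem_index_iota im in qm.
Qed.

(** Sign symmetry makes the four open quadrants equal. On the axes [gcdz i 0] is the absolute value
    of [i], so only the points at distance [q] from the origin remain, at most four, each of weight
    at most [m n]. *)
Lemma f_coprime_sum q m n : (0 < q)%N -> (0 < m)%N -> (0 < n)%N ->
  0 <= (f q m n)%:~R - 4 * coprime_sum R q m n <= 4 * (m%:R * n%:R).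
Proof.
case: m n => [|m] [|n] // q0 _ _.
pose F (i j : int) : R := if gcdz i j == q%:Z
  then (m.+1%:R - `|i|%:~R) * (n.+1%:R - `|j|%:~R) else 0.
have FNl i j : F (- i) j = F i j by rewrite /F gcdNz normrN.
have FNr i j : F i (- j) = F i j by rewrite /F gcdzN normrN.
have -> : (f q m.+1 n.+1)%:~R =
    \sum_(i <- open_range m.+1) \sum_(j <- open_range n.+1) F i j.
  rewrite /f rmorph_sum; apply: eq_bigr => i _; rewrite [LHS]rmorph_sum big_mkcond /=.
  by apply: eq_bigr => j _; rewrite /F; case: ifP => // _; rewrite rmorphM !rmorphB.
rewrite sum_open_range_even; last by move=> i; apply: eq_bigr => j _; exact: FNl.
rewrite (sum_open_range_even n (FNr 0)).
rewrite [X in _ + X *+ 2](eq_bigr (fun i : nat => F i 0 + (\sum_(1 <= j < n.+1) F i j) *+ 2)); last first.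
  by move=> i _; exact: (sum_open_range_even n (FNr i)).
have -> : F 0 0 = 0 by rewrite /F gcdz0 normr0; case: eqP => // -[] e; rewrite -e in q0.
rewrite big_split /= sumrMnl.
have -> : \sum_(1 <= i < m.+1) \sum_(1 <= j < n.+1) F i j = coprime_sum R q m.+1 n.+1.
  by apply: eq_bigr => i _; rewrite [RHS]big_mkcond.
have -> : \sum_(1 <= i < n.+1) F 0 i =
    m.+1%:R * \sum_(1 <= i < n.+1) (if i == q then n.+1%:R - i%:R else 0 : R).
  rewrite big_distrr; apply: eq_bigr => i _.
  by rewrite /F gcd0z normr0 subr0 /= eqz_nat; case: ifP; rewrite ?mulr0.
have -> : \sum_(1 <= i < m.+1) F i 0 =
    n.+1%:R * \sum_(1 <= i < m.+1) (if i == q then m.+1%:R - i%:R else 0 : R).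
  rewrite big_distrr; apply: eq_bigr => i _.
  by rewrite /F gcdz0 normr0 subr0 /= eqz_nat; case: ifP; rewrite ?mulr0// mulrC.
have /andP[a0 a1] := sum_tent_le q (ltn0Sn m); have /andP[b0 b1] := sum_tent_le q (ltn0Sn n).
move: a0 a1 b0 b1; set a := \sum_(_ <= _ < _) _; set b := \sum_(_ <= _ < _) _.
move=> a0 a1 b0 b1; have mR : 0 <= m.+1%:R :> R by []; have nR : 0 <= n.+1%:R :> R by [].
have h1 := mulr_ge0 nR a0; have h2 := mulr_ge0 mR b0.
have h3 := ler_wpM2l nR a1; have h4 := ler_wpM2l mR b1.
apply/andP; split; first by rewrite mulrnDl; lra.
by rewrite mulrnDl; lra.
Qed.

Definition f_bound : R := density_bound R + 12.

Lemma f_asymptotic q m n : (0 < q)%N -> (0 < m <= n)%N ->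
  `|(f q m n)%:~R - 6 / (pi ^+ 2 * q%:R ^+ 2) * m%:R ^+ 2 * n%:R ^+ 2| <=
  f_bound * (m%:R * n%:R ^+ 2).
Proof.
move=> q0 h; have := coprime_sum_asymptotic R q0 h; move: h => /andP[m0 mn].
have n0 : (0 < n)%N by exact: leq_trans mn.
have /andP[A0 A1] := f_coprime_sum q0 m0 n0.
set c := _ * _ ^+ 2 * n%:R ^+ 2; rewrite /f_bound => h.
have e : m%:R * n%:R <= m%:R * n%:R ^+ 2 :> R.
  by rewrite ler_wpM2l// expr2 ler_peMl// ler1n.
move: h; rewrite !ler_norml => /andP[h1 h2]; apply/andP; split; lra.
Qed.

Lemma s_le m n : (s m n <= m * n)%N.
Proof. by rewrite /s (leq_trans (max_card _))// card_prod !card_ord. Qed.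

Lemma real_counts m n : (2 <= m)%N -> (2 <= n)%N ->
  [/\ (num_cells R m n)%:R = (f 1 m n)%:~R / 2 + 1 :> R,
      (num_polygons R 3 m n)%:R = (f 2 m n)%:~R + 4 :> R,
      (num_polygons R 4 m n)%:R = (f 1 m n)%:~R / 2 - (f 2 m n)%:~R - 3 :> R,
      (num_edges R m n)%:R
        = (f 1 m n)%:~R - (f 2 m n)%:~R / 2 - (s m n)%:R - 2 :> R &
      (num_vertices R m n)%:R
        = (f 1 m n)%:~R / 2 - (f 2 m n)%:~R / 2 - (s m n)%:R - 2 :> R].
Proof.
move=> m2 n2; have [c c3 c34 e v] := exact_counts R m2 n2.
have {}c := congr1 (intr : int -> R) c; have {}c3 := congr1 (intr : int -> R) c3.
have {}e := congr1 (intr : int -> R) e; have {}v := congr1 (intr : int -> R) v.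
have {}c34 := congr1 (fun k => k%:R : R) c34; rewrite natrD in c34.
rewrite ?(rmorphMn, rmorphD, rmorphB, rmorphN) /= in c c3 e v.
by split; lra.
Qed.

(** The coefficients 6 and [3 / 2] are [6 / q^2] for [q = 1] and [q = 2]; [s] and the constant are
    absorbed by the error, as [s m n <= m * n]. *)
Lemma asymptotics_of_f (g : nat -> nat -> nat) (a b u w : R) :
    (forall m n, (2 <= m)%N -> (2 <= n)%N ->
      (g m n)%:R = a * (f 1 m n)%:~R + b * (f 2 m n)%:~R + u * (s m n)%:R + w) ->
  asymptotics g ((6 * a + 3 / 2 * b) / pi ^+ 2).
Proof.
move=> gE; exists ((`|a| + `|b|) * f_bound + `|u| + `|w|) => m n /andP[m2 mn].
have n2 : (2 <= n)%N by exact: leq_trans mn.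
have m0 : (0 < m <= n)%N by rewrite (ltn_trans _ m2).
have h1 := f_asymptotic (ltn0Sn 0) m0; have h2 := f_asymptotic (ltn0Sn 1) m0.
have p2 : 0 < pi ^+ 2 :> R by rewrite exprn_gt0// pi_gt0.
have X1 : 1 <= m%:R * n%:R ^+ 2 :> R.
  by rewrite -natrX -natrM ler1n muln_gt0 expn_gt0; lia.
have sX : (s m n)%:R <= m%:R * n%:R ^+ 2 :> R.
  rewrite -natrX -natrM ler_nat (leq_trans (s_le m n))// leq_mul2l.
  by rewrite -{1}(expn1 n) leq_exp2l ?orbT.
rewrite gE//; set X := m%:R * _ in h1 h2 X1 sX *.
set d1 := _ - _ in h1; set d2 := _ - _ in h2.
have -> : a * (f 1 m n)%:~R + b * (f 2 m n)%:~R + u * (s m n)%:R + w -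
    (6 * a + 3 / 2 * b) / pi ^+ 2 * m%:R ^+ 2 * n%:R ^+ 2 =
    a * d1 + b * d2 + u * (s m n)%:R + w.
  by rewrite /d1 /d2; move: (pi ^+ 2) p2 => p p0; field; rewrite gt_eqF.
have t1 : `|a * d1| <= `|a| * (f_bound * X) by rewrite normrM ler_wpM2l.
have t2 : `|b * d2| <= `|b| * (f_bound * X) by rewrite normrM ler_wpM2l.
have t3 : `|u * (s m n)%:R| <= `|u| * X by rewrite normrM ler_wpM2l// ger0_norm.
have t4 : `|w| <= `|w| * X by rewrite ler_peMr.
have := ler_normD (a * d1) (b * d2); have := ler_normD (a * d1 + b * d2) (u * (s m n)%:R).
have := ler_normD (a * d1 + b * d2 + u * (s m n)%:R) w; lra.
Qed.

End Asymptotics.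

Theorem theorem5 (R : realType) :
  (forall m n : nat, (2 <= m)%N -> (2 <= n)%N ->
    [/\ finite_set (cells R m n), finite_set (edges R m n) &
        finite_set (vertices R m n)] /\
    (forall Q, cells R m n Q ->
      generalized_polygon 3 Q \/ generalized_polygon 4 Q) /\
    [/\ (num_polygons R 3 m n)%:R = (f 2 m n)%:~R + 4 :> R,
        (num_polygons R 4 m n)%:R
          = (f 1 m n)%:~R / 2 - (f 2 m n)%:~R - 3 :> R &
        num_cells R m n = (num_polygons R 3 m n + num_polygons R 4 m n)%N] /\
    [/\ (num_cells R m n)%:R = (f 1 m n)%:~R / 2 + 1 :> R,
        (num_edges R m n)%:R
          = (f 1 m n)%:~R - (f 2 m n)%:~R / 2 - (s m n)%:R - 2 :> R &
        (num_vertices R m n)%:R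
          = (f 1 m n)%:~R / 2 - (f 2 m n)%:~R / 2 - (s m n)%:R - 2 :> R]) /\
  [/\ asymptotics (num_polygons R 3) (3 / (2 * pi ^+ 2) : R),
      asymptotics (num_polygons R 4) (3 / (2 * pi ^+ 2) : R),
      asymptotics (num_cells R) (3 / pi ^+ 2 : R),
      asymptotics (num_edges R) (21 / (4 * pi ^+ 2) : R) &
      asymptotics (num_vertices R) (9 / (4 * pi ^+ 2) : R)].
Proof.
split=> [m n m2 n2|].
  have [c c3 c4 e v] := real_counts R m2 n2; have [_ _ c34 _ _] := exact_counts R m2 n2.
  split; first by split; [have [] := number_cells R m n | have [] := number_edges R m n |
    have [] := number_vertices R m2 n2].
  split=> // Q; rewrite cellsE => -[B /= Bc <-].
  have := @card_essentials_bounds R m n m2 n2 B Bc.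
  have := fun k => @region_polygonP R m n m2 n2 k B Bc.
  case: #|essentials _ _| => [|[|[|[|[|k]]]]] H h; try by move: h.
    by left; apply/H.
  by right; apply/H.
have p0 : pi != 0 :> R by rewrite gt_eqF ?pi_gt0.
split.
- have -> : 3 / (2 * pi ^+ 2) = (6 * 0 + 3 / 2 * 1) / pi ^+ 2 :> R by move: (@pi R) p0 => p p0; field.
  apply: (@asymptotics_of_f _ _ _ _ 0 4) => m n m2 n2.
  by have [_ -> _ _ _] := real_counts R m2 n2; lra.
- have -> : 3 / (2 * pi ^+ 2) = (6 * 2^-1 + 3 / 2 * -1) / pi ^+ 2 :> R by move: (@pi R) p0 => p p0; field.
  apply: (@asymptotics_of_f _ _ _ _ 0 (-3)) => m n m2 n2.
  by have [_ _ -> _ _] := real_counts R m2 n2; lra.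
- have -> : 3 / pi ^+ 2 = (6 * 2^-1 + 3 / 2 * 0) / pi ^+ 2 :> R by move: (@pi R) p0 => p p0; field.
  apply: (@asymptotics_of_f _ _ _ _ 0 1) => m n m2 n2.
  by have [-> _ _ _ _] := real_counts R m2 n2; lra.
- have -> : 21 / (4 * pi ^+ 2) = (6 * 1 + 3 / 2 * - 2^-1) / pi ^+ 2 :> R by move: (@pi R) p0 => p p0; field.
  apply: (@asymptotics_of_f _ _ _ _ (-1) (-2)) => m n m2 n2.
  by have [_ _ _ -> _] := real_counts R m2 n2; lra.
- have -> : 9 / (4 * pi ^+ 2) = (6 * 2^-1 + 3 / 2 * - 2^-1) / pi ^+ 2 :> R by move: (@pi R) p0 => p p0; field.
  apply: (@asymptotics_of_f _ _ _ _ (-1) (-2)) => m n m2 n2.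
  by have [_ _ _ _ ->] := real_counts R m2 n2; lra.
Qed.
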